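(* Let $n\ge 2$ and $0<s<1$. Suppose that $u\in\mathscr L_s(\mathbb R^n)$ and that on a given open set $\Omega\subset\mathbb R^n$ one has $(-\Delta)^s u=0$ in $\mathscr D'(\Omega)$. Then $u$ can be modified on a set of measure zero in $\Omega$ so as to coincide in $\Omega$ with a function in $C^\infty(\Omega)$.
   Context: $\mathscr L_s(\mathbb R^n)$ is the space of measurable functions $u$ on $\mathbb R^n$ with $\int_{\mathbb R^n}\frac{|u(x)|}{1+|x|^{n+2s}}\,dx<\infty$. For $\varphi\in\mathscr S(\mathbb R^n)$ (Schwartz space), $$(-\Delta)^s \varphi(x)=\frac{\gamma(n,s)}{2}\int_{\mathbb R^n}\frac{2\varphi(x)-\varphi(x+y)-\varphi(x-y)}{|y|^{n+2s}}\,dy,\qquad \gamma(n,s)=\frac{s\,2^{2s}\,\Gamma\left(\frac{n+2s}{2}\right)}{\pi^{n/2}\,\Gamma(1-s)},$$ and one has $|(-\Delta)^s\varphi(x)|\le C_\varphi(1+|x|^{n+2s})^{-1}$. For $u\in\mathscr L_s(\mathbb R^n)$, the statement $(-\Delta)^s u=0$ in $\mathscr D'(\Omega)$ means $\int_{\mathbb R^n}u(x)\,(-\Delta)^s\varphi(x)\,dx=0$ for every $\varphi\in C_0^\infty(\Omega)$. *)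

(* Defs.v *)
From HB Require Import structures.
From mathcomp Require Import all_boot all_order all_algebra.
From mathcomp Require Import all_classical all_reals all_analysis.
From mathcomp Require Import measurable_realfun.

Set Implicit Arguments.
Unset Strict Implicit.
Unset Printing Implicit Defensive.

Import Order.TTheory GRing.Theory Num.Theory.
Import numFieldNormedType.Exports.
Import HBNNSimple.

Local Open Scope classical_set_scope.
Local Open Scope ring_scope.

(* Counterpart for 'rV[R]_n of the library's product sigma-algebra on tuples;
   it is the Borel sigma-algebra of R^n. *)
Definition rV_display : measure_display.
Proof. exact: default_measure_display. Qed.

Section measurable_rV.
Variables (R : realType) (n : nat).

Let coors : 'I_n -> 'rV[R]_n -> measurableTypeR R := fun i x => x ord0 i.

Let rV_set0 : g_sigma_preimage coors set0.
Proof. exact: sigma_algebra0. Qed.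

Let rV_setC A : g_sigma_preimage coors A -> g_sigma_preimage coors (~` A).
Proof. exact: sigma_algebraC. Qed.

Let rV_bigcup (F : (set 'rV[R]_n)^nat) :
  (forall i, g_sigma_preimage coors (F i)) ->
  g_sigma_preimage coors (\bigcup_i (F i)).
Proof. exact: sigma_algebra_bigcup. Qed.

HB.instance Definition _ := @isMeasurable.Build rV_display
  'rV[R]_n (g_sigma_preimage coors) rV_set0 rV_setC rV_bigcup.

Lemma measurable_coord (i : 'I_n) :
  measurable_fun [set: 'rV[R]_n]
    (fun x : 'rV[R]_n => x ord0 i : measurableTypeR R).
Proof.
move=> _ Y mY; rewrite setTI; apply: sub_sigma_algebra => /=.
rewrite -bigcup_seq/=; exists i => /=; first by rewrite mem_index_enum.
by exists Y => //; rewrite setTI.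
Qed.

Lemma measurable_fun_coord d (T : measurableType d) (f : T -> 'rV[R]_n) :
  (forall i, measurable_fun [set: T]
     (fun t => f t ord0 i : measurableTypeR R)) ->
  measurable_fun [set: T] f.
Proof.
move=> mf _ A mA; rewrite setTI.
move: A mA; apply: (@smallest_sub _ _ _ [set B | measurable (f @^-1` B)]).
  split; rewrite /= ?preimage_set0//.
  - by move=> B GB; rewrite /= setTD preimage_setC; exact: measurableC.
  - by move=> F GF; rewrite /= preimage_bigcup; exact: bigcup_measurable.
rewrite -bigcup_seq => B /= -[i _ [C mC <-]].
by have := mf i measurableT C mC; rewrite !setTI.
Qed.

End measurable_rV.

Section lebesgue_rV_succ.
Variables (R : realType) (n : nat).

Definition rV_cons (p : measurableTypeR R * 'rV[R]_n) : 'rV[R]_n.+1 :=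
  \row_i oapp (fun j => p.2 ord0 j) p.1 (unlift ord0 i).

Definition rV_uncons (x : 'rV[R]_n.+1) : measurableTypeR R * 'rV[R]_n :=
  (x ord0 ord0, \row_j x ord0 (lift ord0 j)).

Lemma rV_consK : cancel rV_cons rV_uncons.
Proof.
case=> a v; congr pair; first by rewrite mxE unlift_none.
by apply/rowP => j; rewrite !mxE liftK.
Qed.

Lemma rV_unconsK : cancel rV_uncons rV_cons.
Proof.
move=> x; apply/rowP => i; rewrite mxE.
by case: unliftP => [j ->|->] //=; rewrite mxE.
Qed.

Lemma measurable_rV_cons : measurable_fun setT rV_cons.
Proof.
apply: measurable_fun_coord => i.
have [j ij|i0] := unliftP ord0 i.
  rewrite (_ : (fun _ => _) = (fun x : 'rV[R]_n => x ord0 j) \o snd).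
    by apply: measurableT_comp; [exact: measurable_coord|exact: measurable_snd].
  by apply/funext => p; rewrite mxE ij liftK.
rewrite (_ : (fun _ => _) = fst); first exact: measurable_fst.
by apply/funext => p; rewrite mxE i0 unlift_none.
Qed.

Lemma measurable_rV_uncons : measurable_fun setT rV_uncons.
Proof.
apply/measurable_fun_pairP; split; first exact: measurable_coord.
apply: measurable_fun_coord => i.
rewrite (_ : (fun _ => _) = (fun x : 'rV[R]_n.+1 => x ord0 (lift ord0 i))).
  exact: measurable_coord.
by apply/funext => p; rewrite /= mxE.
Qed.

Variable mu : {sigma_finite_measure set 'rV[R]_n -> \bar R}.

Definition lebesgue_rV_succ : set 'rV[R]_n.+1 -> \bar R :=
  pushforward (lebesgue_measure \x mu)%E rV_cons.

Let succ0 : lebesgue_rV_succ set0 = 0%E.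
Proof. by rewrite /lebesgue_rV_succ /pushforward preimage_set0 measure0. Qed.

Let succ_ge0 A : (0 <= lebesgue_rV_succ A)%E.
Proof. by rewrite /lebesgue_rV_succ /pushforward; exact: measure_ge0. Qed.

Let succ_additive : semi_sigma_additive lebesgue_rV_succ.
Proof.
exact: (@measure_semi_sigma_additive _ _ _
  (measure_function_pushforward__canonical__measure_function_Measure
    (lebesgue_measure \x mu)%E measurable_rV_cons)).
Qed.

HB.instance Definition _ := isMeasure.Build _ _ _ lebesgue_rV_succ
  succ0 succ_ge0 succ_additive.

Let succ_sigma_finite : sigma_finite setT lebesgue_rV_succ.
Proof.
have /sigma_finiteP[F [TF ndF Foo]] := sigma_finiteT (@lebesgue_measure R).
have /sigma_finiteP[G [TG ndG Goo]] := sigma_finiteT mu.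
exists (fun k => rV_uncons @^-1` (F k `*` G k)).
  rewrite -preimage_bigcup -[LHS](preimage_setT rV_uncons) -setXTT TF TG.
  congr (_ @^-1` _); apply/seteqP; split=> -[x y] /=.
    move=> [[k _ Fkx] [m _ Gmy]]; exists (maxn k m) => //; split.
    - by move: x Fkx; exact/subsetPset/ndF/leq_maxl.
    - by move: y Gmy; exact/subsetPset/ndG/leq_maxr.
  by move=> [k _ [? ?]]; split; exists k.
move=> k; have [mFk Fk] := Foo k; have [mGk Gk] := Goo k; split.
  rewrite -[X in measurable X]setTI; apply: measurable_rV_uncons => //.
  exact: measurableX.
rewrite /lebesgue_rV_succ /pushforward -comp_preimage.
rewrite (_ : _ \o _ = id) ?preimage_id; last by apply/funext; exact: rV_consK.
by rewrite product_measure1E// lte_mul_pinfty// ge0_fin_numE.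
Qed.

HB.instance Definition _ := Measure_isSigmaFinite.Build _ _ _ lebesgue_rV_succ
  succ_sigma_finite.

End lebesgue_rV_succ.

(* Lebesgue measure on R^n: the n-fold product of lebesgue_measure. *)
Fixpoint lebesgue_rV (R : realType) (n : nat) :
    {sigma_finite_measure set 'rV[R]_n -> \bar R} :=
  match n with
  | 0 => \d_(0 : 'rV[R]_0)
  | m.+1 => lebesgue_rV_succ (lebesgue_rV R m)
  end.

Lemma lebesgue_rV_box (R : realType) n (A : 'I_n -> set (measurableTypeR R)) :
  (forall i, measurable (A i)) ->
  (lebesgue_rV R n [set x | forall i, A i (x ord0 i)] =
   \prod_(i < n) lebesgue_measure (A i))%E.
Proof.
elim: n A => [|n IHn] A mA.
  by rewrite big_ord0 /= diracE mem_set// => -[].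
rewrite big_ord_recl /= /lebesgue_rV_succ /pushforward.
pose B := [set x : 'rV[R]_n | forall i, A (lift ord0 i) (x ord0 i)].
have mB : measurable B.
  rewrite (_ : B = \bigcap_(i in [set: 'I_n])
      ((fun x : 'rV[R]_n => x ord0 i) @^-1` A (lift ord0 i))).
    apply: fin_bigcap_measurable => // i _.
    by rewrite -[X in measurable X]setTI; exact: measurable_coord.
  by apply/seteqP; split=> x Bx i; [move=> _; exact: Bx|exact: (Bx i)].
rewrite (_ : _ @^-1` _ = A ord0 `*` B); last first.
  apply/seteqP; split=> -[a v] /=.
    move=> h; split; first by have := h ord0; rewrite mxE unlift_none.
    by move=> i; have := h (lift ord0 i); rewrite mxE liftK.
  by move=> [Aa Bv] i; rewrite mxE; case: unliftP => [j|] ->; [exact: Bv|].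
by rewrite product_measure1E//; congr (_ * _)%E; exact: IHn.
Qed.

(* The integral of any nonnegative function is a supremum over the measurable
   simple functions below it, so it has the right value on functions that are
   only measurable for the completion of mu: f need not be measurable here. *)
Lemma ge0_integral_ae_measurable d (T : measurableType d) (R : realType)
    (mu : {measure set T -> \bar R}) (f g : T -> \bar R) :
  (forall x, 0 <= f x)%E -> (forall x, 0 <= g x)%E -> measurable_fun setT g ->
  {ae mu, forall x, f x = g x} ->
  (\int[mu]_x f x = \int[mu]_x g x)%E.
Proof.
move=> f0 g0 mg [N [mN muN fgN]]; apply/eqP; rewrite eq_le; apply/andP; split.
  rewrite ge0_integralTE//; apply: ge_ereal_sup => _ [h hf <-].
  have -> : sintegral mu h = (\int[mu]_x (h x)%:E)%E.
    by rewrite integral_nnsfun// patch_setT.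
  apply: ae_ge0_le_integral => //.
  - by move=> x _; rewrite lee_fin; exact: fun_ge0.
  - exact/measurable_EFinP.
  - exists N; split=> // x /= hgx; apply: fgN => /= fgx; apply: hgx => _.
    by rewrite -fgx; exact: hf.
rewrite (ge0_negligible_integral mN _ _ _ muN)// setTD integral_mkcond.
rewrite !ge0_integralTE//; last by move=> x; apply: erestrict_ge0.
apply: ereal_sup_le => _ [h hg <-]; exists h => // x.
apply: (le_trans (hg x)); rewrite patchE; case: ifPn => [|_]; last exact: f0.
rewrite inE /= => Nx; suff -> : f x = g x by [].
by apply: contrapT => fgx; apply: Nx; exact: fgN.
Qed.

Section euclidean_space.
Variables (R : realType) (n : nat).
Implicit Types (s : R) (f u phi : 'rV[R]_n -> R) (Omega : set 'rV[R]_n).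

Local Notation mu := (lebesgue_rV R n).

(* The library's norm on 'rV[R]_n is the sup norm. *)
Definition enorm (x : 'rV[R]_n) : R := Num.sqrt (\sum_i x ord0 i ^+ 2).

(* Measurability for the completion of the Borel sigma-algebra; integrals of
   such functions against mu are covered by ge0_integral_ae_measurable. *)
Definition lebesgue_measurable_fun u :=
  measurable_fun setT
    (u : g_sigma_algebraType (completed_algebra_gen mu) -> R).

Definition L_s s u :=
  lebesgue_measurable_fun u /\
  (\int[mu]_x (`|u x| / (1 + enorm x `^ (n%:R + 2 * s)))%:E < +oo)%E.

Definition partial_deriv (i : 'I_n) f : 'rV[R]_n -> R :=
  fun x => 'D_(delta_mx ord0 i) f x.

(* C^oo(Omega) for open Omega: every iterated partial derivative exists and is
   continuous on Omega. *)
Definition smooth_on Omega f :=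
  forall (l : seq 'I_n) (x : 'rV[R]_n), Omega x ->
    {for x, continuous (foldr partial_deriv f l)} /\
    forall i : 'I_n, derivable (foldr partial_deriv f l) x (delta_mx ord0 i).

Definition tsupport f := closure [set x | f x != 0].

Definition test_function Omega phi :=
  [/\ smooth_on setT phi, compact (tsupport phi) & tsupport phi `<=` Omega].

End euclidean_space.

Definition Gamma (R : realType) (a : R) : R :=
  \int[lebesgue_measure]_(t in `]0, +oo[) (t `^ (a - 1) * expR (- t)).

Definition gamma_ns (R : realType) (n : nat) (s : R) : R :=
  s * 2 `^ (2 * s) * Gamma ((n%:R + 2 * s) / 2) /
  (pi `^ (n%:R / 2) * Gamma (1 - s)).

Definition frac_laplacian (R : realType) (n : nat) (s : R)
    (phi : 'rV[R]_n -> R) (x : 'rV[R]_n) : R :=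
  gamma_ns n s / 2 *
  \int[lebesgue_rV R n]_y
    ((2 * phi x - phi (x + y) - phi (x - y)) / enorm y `^ (n%:R + 2 * s)).

(* (- Laplacian)^s u = 0 in D'(Omega). *)
Definition frac_harmonic (R : realType) (n : nat) (s : R)
    (Omega : set 'rV[R]_n) (u : 'rV[R]_n -> R) :=
  forall phi, test_function Omega phi ->
    (\int[lebesgue_rV R n]_x (u x * frac_laplacian s phi x)%:E = 0)%E.

(* Main.v *)
(* Let eta be a smooth radially decreasing bump and h = (-Delta)^s eta up to the
   normalizing constant. Averaging over scales,
     K_N(x) = int_0^N h(t^(1/n) x) dt,
   polar coordinates give c |x|^n K_N(x) = int_{|y| < N^(1/n) |x|} h(y) dy, which is
   nonnegative because a centred ball captures the most mass of eta, and decays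
   like |x|^(-2s). Hence K_N(x) = N K_1(N^(1/n) x) is an approximate identity, up
   to the factor int K_1 > 0, and K_N and all its derivatives are
   O((1 + |x|^(n+2s))^(-1)), so that K_N * u is smooth for u in L_s.

   Testing the equation against the bumps eta(c (. - z)) gives
   int u(x) h(c (z - x)) dx = 0 as soon as the ball of radius 1/c around z lies in
   Omega; integrating in t, K_N * u is independent of N at z for large N. Letting
   N tend to infinity in the weak sense identifies it with a multiple of u. *)
Require Import Defs.
From mathcomp Require Import all_boot all_order all_algebra.
From mathcomp Require Import all_classical all_reals all_analysis.
From mathcomp Require Import measurable_realfun.
From mathcomp Require Import ring lra.

Set Implicit Arguments.
Unset Strict Implicit.
Unset Printing Implicit Defensive.

Import Order.TTheory GRing.Theory Num.Theory.
Import numFieldNormedType.Exports.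

Local Open Scope classical_set_scope.
Local Open Scope ring_scope.

(** Why averaging helps: [h] has integral zero, so its dilates alone do not form an approximate
    identity. Averaged over all scales [t > 0], it becomes homogeneous of degree [-n] and vanishes
    off the origin, hence is a multiple of the Dirac mass. [K_N] truncates this average, and the
    scales cut off are fractional Laplacians of small bumps, which the equation annihilates near
    each point of [Omega].

    Three obstacles shape the proof. Integrating the decay of [h] over small scales converges only
    for derivatives of order above [2s]; order 0 is saved by the ball formula and order 1 by
    interpolation. Next, [u] has no continuity, so [K_N * u] is compared with [u] by pairing with a
    bump cut by orthants: such functions are continuous almost everywhere, and orthants generate the
    Borel sets. Last, the ball formula needs [h] radial; reflections suffice for this, since one of
    them exchanges any two vectors of equal norm. *)

(** * Borel sets of R^n and uniqueness of Lebesgue measure *)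

Section measurability_rV.
Variables (R : realType) (n : nat).
Implicit Types (A : 'I_n -> set (measurableTypeR R)) (x : 'rV[R]_n).

Definition box A : set 'rV[R]_n := [set x | forall i, A i (x ord0 i)].

Lemma measurable_box A : (forall i, measurable (A i)) -> measurable (box A).
Proof.
move=> mA; rewrite (_ : box A = \bigcap_(i in [set: 'I_n])
    ((fun x : 'rV[R]_n => x ord0 i) @^-1` A i)).
  apply: fin_bigcap_measurable => // i _.
  by rewrite -[X in measurable X]setTI; exact: measurable_coord.
by apply/seteqP; split=> x Bx i; [move=> _; exact: Bx|exact: (Bx i)].
Qed.

Lemma coord_le_norm x i : `|x ord0 i| <= `|x|.
Proof.
rewrite [leRHS]/Num.norm/= mx_normrE.
by apply/bigmax_geP; right => /=; exists (ord0, i).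
Qed.

Lemma norm_le_coord x (e : R) : 0 <= e -> (forall i, `|x ord0 i| <= e) -> `|x| <= e.
Proof.
move=> e0 h; rewrite [leLHS]/Num.norm/= mx_normrE.
by apply/bigmax_leP; split=> // -[i j] _ /=; rewrite (ord1 i).
Qed.

Lemma rV_ballE x (e : R) : 0 < e ->
  ball x e = box (fun i => (ball (x ord0 i) e : set (measurableTypeR R))).
Proof.
move=> e0; apply/seteqP; split=> [y [_ h] i|y h]; first exact: h.
by split=> // i j; rewrite (ord1 i); exact: h.
Qed.

(** An open set is the countable union of the sup-norm balls with rational centre and radius
    [1 / (k + 1)] that it contains, and such balls are boxes. *)
Lemma rV_open_measurable (U : set 'rV[R]_n) : open U -> measurable U.
Proof.
move=> oU.
(* The first factor does not involve [x]: it is everything or empty, so [F p] is the ball when it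
   fits in [U] and nothing otherwise. *)
pose F (p : 'rV[rat]_n * nat) : set 'rV[R]_n :=
  [set x | ball (map_mx ratr p.1 : 'rV[R]_n) p.2.+1%:R^-1 `<=` U] `&`
  ball (map_mx ratr p.1 : 'rV[R]_n) p.2.+1%:R^-1.
have -> : U = \bigcup_p F p.
  apply/seteqP; split=> [x Ux|x [p _ [/= h1 h2]]]; last exact: h1.
  move/open_nbhs_nbhs : (conj oU Ux) => /nbhs_ballP[e /= e0 eU].
  have [k ke] : exists k, k.+1%:R^-1 < e / 2.
    have e20 : 0 < e / 2 by rewrite divr_gt0.
    have /cvgrPdist_lt/(_ _ e20)[k _ /(_ k)] := @cvg_harmonic R.
    rewrite /= sub0r normrN ger0_norm// => /(_ (leqnn _)) h; by exists k.
  have k0 : 0 < (k.+1%:R^-1 : R) by rewrite invr_gt0.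
  have hq i : {q : rat | ball (ratr q : R) (k.+1%:R^-1) (x ord0 i)}.
    apply: cid; have /rat_in_itvoo[q] : x ord0 i < x ord0 i + k.+1%:R^-1 by rewrite ltrDl.
    rewrite in_itv/= => /andP[q1 q2]; exists q.
    by rewrite /ball/= ltr_distlC ltrBlDr q2/= (lt_trans q1)// ltrDl k0.
  exists (\row_i sval (hq i), k) => //=.
  have bx : ball (map_mx ratr (\row_i sval (hq i)) : 'rV[R]_n) k.+1%:R^-1 x.
    split=> // i j; rewrite !mxE (ord1 i); exact: (svalP (hq j)).
  split=> //= y yb; apply: eU; apply: (@le_ball _ _ _ (k.+1%:R^-1 + k.+1%:R^-1)).
    by rewrite ltW// (splitr e) ltrD.
  apply: ball_triangle yb; exact: ball_sym.
apply: countable_bigcupT_measurable => // p.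
rewrite /F; have [h|h] := pselect (ball (map_mx ratr p.1 : 'rV[R]_n) p.2.+1%:R^-1 `<=` U).
  rewrite [X in X `&` _](_ : _ = setT); last by apply/seteqP; split.
  rewrite setTI rV_ballE ?invr_gt0//; apply: measurable_box => i.
  by apply: open_measurable; exact: ball_open.
by rewrite [X in X `&` _](_ : _ = set0) ?set0I//; apply/seteqP; split.
Qed.

Lemma rV_continuous_measurable (f : 'rV[R]_n -> R) :
  continuous f -> measurable_fun setT f.
Proof.
move=> /continuousP cf; apply: (measurability _ (RGenOpens.measurableE R)).
move=> _ [_ [a [b ->] <-]]; rewrite setTI; apply: rV_open_measurable.
exact/cf/interval_open.
Qed.

Lemma lebesgue_boxE A : (forall i, measurable (A i)) ->
  (lebesgue_rV R n (box A) = \prod_(i < n) lebesgue_measure (A i))%E.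
Proof. exact: lebesgue_rV_box. Qed.

(** Boxes are stable under intersection, generate the sigma-algebra and include the cubes [g k],
    which have finite measure and exhaust the space. *)
Lemma lebesgue_rV_unique (nu : {measure set 'rV[R]_n -> \bar R}) :
  (forall A, (forall i, measurable (A i)) ->
    nu (box A) = \prod_(i < n) lebesgue_measure (A i))%E ->
  forall B, measurable B -> lebesgue_rV R n B = nu B.
Proof.
move=> nuE B mB.
pose G := [set box A | A in [set A | forall i, measurable (A i)]].
pose g (k : nat) := box (fun=> [set` Interval (BLeft (- k%:R : R)) (BRight (k%:R : R))]).
apply: (measure_unique G g) => //.
- apply/seteqP; split; last first.
    apply: smallest_sub; first exact: sigma_algebra_measurable.
    by move=> _ [A mA <-]; exact: measurable_box.
  apply: smallest_sub; first exact: smallest_sigma_algebra.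
  rewrite -bigcup_seq => C /= -[i _ [D mD <-]]; rewrite setTI.
  apply: sub_sigma_algebra.
  exists (fun j => if j == i then D else setT) => /=.
    by move=> j; case: ifP.
  apply/seteqP; split=> x /=; first by move=> /(_ i); rewrite eqxx.
  by move=> Dx j; case: eqP => [->|].
- move=> _ _ [A mA <-] [A' mA' <-]; exists (fun i => A i `&` A' i).
    by move=> i; exact: measurableI.
  apply/seteqP; split=> x; first by move=> h; split=> i; have [] := h i.
  by move=> [h1 h2] i; split; [exact: h1|exact: h2].
- by move=> k; exists (fun=> [set` Interval (BLeft (- k%:R : R)) (BRight (k%:R : R))]).
- apply/seteqP; split=> // x _.
  exists (Num.truncn `|x|).+1 => // i /=; rewrite in_itv/= -ler_norml.
  have /ltW : `|x| < (Num.truncn `|x|).+1%:R by exact: truncnS_gt.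
  exact/le_trans/coord_le_norm.
- by move=> _ [A mA <-]; rewrite nuE//; exact: lebesgue_boxE.
- move=> k; rewrite /g [X in (X < _)%E]lebesgue_boxE//.
  under eq_bigr => i _ do rewrite /= lebesgue_measure_itv/=.
  rewrite (eq_bigr (fun=> (if - k%:R < k%:R :> R then k%:R - - k%:R else 0 : R)%:E)).
    by rewrite prodEFin ltry.
  by move=> i _; rewrite lte_fin; case: ifP.
Qed.

End measurability_rV.

(** * Changes of variables *)

Section measure_preserving.
Context d (T : measurableType d) (R : realType).
Variables (mu : {measure set T -> \bar R}) (phi : T -> T) (c : R).
Hypothesis c_gt0 : 0 < c.
Hypothesis mphi : measurable_fun setT phi.
Hypothesis phi_mu : forall A, measurable A -> (mu (phi @^-1` A) = c%:E * mu A)%E.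

Lemma ge0_integral_comp_scaling (f : T -> \bar R) : measurable_fun setT f ->
  (forall x, 0 <= f x)%E ->
  (\int[mu]_x f (phi x) = c%:E * \int[mu]_x f x)%E.
Proof.
move=> mf f0; rewrite -(@ge0_integral_mscale _ _ _ mu setT measurableT (NngNum (ltW c_gt0)) f)//.
rewrite -[LHS](@ge0_integral_pushforward _ _ _ _ _ _ mphi mu setT f)//.
by apply: eq_measure_integral => A mA _ /=; rewrite /mscale/= -phi_mu.
Qed.

Lemma integral_comp_scaling (f : T -> \bar R) : measurable_fun setT f ->
  (\int[mu]_x f (phi x) = c%:E * \int[mu]_x f x)%E.
Proof.
move=> mf; rewrite [LHS]integralE [in RHS]integralE.
under [X in (X - _)%E]eq_integral do rewrite (funepos_comp f phi)/=.
under [X in (_ - X)%E]eq_integral do rewrite (funeneg_comp f phi)/=.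
rewrite !ge0_integral_comp_scaling//; last 2 first.
  exact: measurable_funeneg.
  exact: measurable_funepos.
have := @integral_ge0 _ _ _ mu setT (f^\+)%E (fun x _ => funepos_ge0 f x).
have := @integral_ge0 _ _ _ mu setT (f^\-)%E (fun x _ => funeneg_ge0 f x).
(* Divergent integrals are covered too: since [c > 0], both sides then take the same infinite
   value. *)
case: (integral mu setT (f^\-)%E) => [a||]; case: (integral mu setT (f^\+)%E) => [b||]//= _ _.
- by rewrite -EFinM -!EFinD -EFinM mulrBr.
- by rewrite gt0_muley ?lte_fin// !addye// gt0_muley ?lte_fin.
- by rewrite gt0_muley ?lte_fin// !addeNy gt0_muleNy ?lte_fin.
- by rewrite gt0_muley ?lte_fin// gt0_muleNy ?lte_fin.
Qed.

Lemma Rintegral_comp_scaling (f : T -> R) : measurable_fun setT f ->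
  \int[mu]_x f (phi x) = c * \int[mu]_x f x.
Proof.
move=> mf; rewrite /Rintegral (@integral_comp_scaling (EFin \o f)); last first.
  exact/measurable_EFinP.
case: (integral _ _ _) => [r||]//=.
  by rewrite gt0_muley ?lte_fin//= mulr0.
by rewrite gt0_muleNy ?lte_fin//= mulr0.
Qed.

End measure_preserving.

Section affine_maps.
Variable R : realType.

Lemma lebesgue_measure_affine (c a : R) (A : set (measurableTypeR R)) :
  0 < c -> measurable A ->
  (lebesgue_measure ((fun t : measurableTypeR R => (c * t + a)%R : measurableTypeR R) @^-1` A)
   = (c^-1)%:E * lebesgue_measure A)%E.
Proof.
move=> c0 mA; pose phi (t : measurableTypeR R) : measurableTypeR R := c * t + a.
have mphi : measurable_fun setT phi.
  by apply: measurable_funD => //; exact: measurable_funM.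
pose nu : {measure set _ -> \bar R} := mscale (NngNum (ltW c0))
  (measure_function_pushforward__canonical__measure_function_Measure lebesgue_measure mphi).
have nuE B : nu B = (c%:E * lebesgue_measure (phi @^-1` B))%E by [].
rewrite (@lebesgue_measure_unique _ nu _ _ mA).
  by rewrite nuE muleA -EFinM mulVf ?(gt_eqF c0)// mul1e.
move=> _ [[x y]] _ <-; rewrite nuE.
rewrite (_ : _ @^-1` _ = `](x - a) / c, (y - a) / c]%classic); last first.
  apply/seteqP; split=> t; rewrite /phi/= !in_itv/= => /andP[h1 h2].
    by rewrite ltr_pdivrMr// ler_pdivlMr//; apply/andP; split; lra.
  move: h1 h2; rewrite ltr_pdivrMr// ler_pdivlMr// => h1 h2.
  by apply/andP; split; lra.
rewrite !lebesgue_measure_itv/= !lte_fin ltr_pM2r ?invr_gt0// ltrD2r.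
case: ifPn => _; last by rewrite mule0.
rewrite -!EFinD -EFinM; congr (_%:E).
by field; rewrite gt_eqF.
Qed.

(** Stated for maps acting coordinate by coordinate, so that it serves dilations, translations and
    [x => - x] alike. *)
Lemma lebesgue_rV_coord (n : nat) (g : 'I_n -> R -> R) (k : R) : 0 < k ->
  (forall i, measurable_fun setT (g i)) ->
  (forall i (A : set (measurableTypeR R)), measurable A ->
    lebesgue_measure ((g i : measurableTypeR R -> measurableTypeR R) @^-1` A) =
    k%:E * lebesgue_measure A)%E ->
  forall B, measurable B ->
  (lebesgue_rV R n ((fun x => \row_i g i (x ord0 i)) @^-1` B) =
   (k ^+ n)%:E * lebesgue_rV R n B)%E.
Proof.
move=> k0 mg gk B mB; pose phi (x : 'rV[R]_n) : 'rV[R]_n := \row_i g i (x ord0 i).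
have mphi : measurable_fun setT phi.
  apply: measurable_fun_coord => i; rewrite /phi.
  under eq_fun do rewrite mxE.
  exact: (measurableT_comp (mg i) (measurable_coord i)).
have kn0 : 0 < k ^- n by rewrite invr_gt0 exprn_gt0.
pose nu : {measure set _ -> \bar R} := mscale (NngNum (ltW kn0))
  (measure_function_pushforward__canonical__measure_function_Measure (lebesgue_rV R n) mphi).
have nuE C : nu C = ((k ^- n)%:E * lebesgue_rV R n (phi @^-1` C))%E by [].
rewrite (@lebesgue_rV_unique _ _ nu _ _ mB).
  by rewrite nuE muleA -EFinM mulfV ?mul1e// expf_neq0 ?(gt_eqF k0)//.
move=> A mA; rewrite nuE.
rewrite (_ : _ @^-1` _ = box (fun i => (g i : measurableTypeR R -> measurableTypeR R) @^-1` A i)); last first.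
  by apply/seteqP; split=> x h i; have := h i; rewrite /phi/= mxE.
rewrite lebesgue_boxE => [|i]; last first.
  by rewrite -[X in measurable X]setTI; exact: (mg i measurableT _ (mA i)).
rewrite (eq_bigr _ (fun i _ => gk i _ (mA i))) big_split/=.
rewrite prodEFin prodr_const card_ord muleA -EFinM mulVf ?mul1e//.
by rewrite expf_neq0 ?(gt_eqF k0)//.
Qed.

Lemma lebesgue_rV_affine (n : nat) (c : R) (a : 'rV[R]_n) B : 0 < c ->
  measurable B ->
  (lebesgue_rV R n ((fun x => c *: x + a)%R @^-1` B) =
   (c ^- n)%:E * lebesgue_rV R n B)%E.
Proof.
move=> c0 mB; rewrite -exprVn.
rewrite -(@lebesgue_rV_coord n (fun i t => c * t + a ord0 i) c^-1)//.
- by congr (lebesgue_rV R n (_ @^-1` B)); apply/funext => x; apply/rowP => i; rewrite !mxE.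
- by rewrite invr_gt0.
- by move=> i; apply: measurable_funD => //; exact: measurable_funM.
- by move=> i A mA; exact: lebesgue_measure_affine.
Qed.

Lemma lebesgue_rVN (n : nat) (B : set 'rV[R]_n) : measurable B ->
  lebesgue_rV R n (-%R @^-1` B) = lebesgue_rV R n B.
Proof.
move=> mB; rewrite -[RHS]mul1e -(expr1n R n).
rewrite -(@lebesgue_rV_coord n (fun i t => - t) 1)//.
- by congr (lebesgue_rV R n (_ @^-1` B)); apply/funext => x; apply/rowP => i; rewrite !mxE.
- by move=> i; exact: oppr_measurable.
- by move=> i A mA; rewrite mul1e; exact: lebesgue_measureN.
Qed.

Variable n : nat.
Local Notation mu := (lebesgue_rV R n).

Lemma measurable_affine (c : R) (a : 'rV[R]_n) : measurable_fun setT (fun x : 'rV[R]_n => c *: x + a).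
Proof.
apply: measurable_fun_coord => i; under eq_fun do rewrite !mxE.
by apply: measurable_funD => //; apply: measurable_funM => //; exact: measurable_coord.
Qed.

Lemma measurable_rVN : measurable_fun setT (-%R : 'rV[R]_n -> 'rV[R]_n).
Proof.
apply: measurable_fun_coord => i; under eq_fun do rewrite !mxE.
by apply: measurableT_comp => //; exact: measurable_coord.
Qed.

Lemma ge0_integral_rV_affine (c : R) (a : 'rV[R]_n) (f : 'rV[R]_n -> \bar R) :
  0 < c -> measurable_fun setT f -> (forall x, 0 <= f x)%E ->
  (\int[mu]_x f (c *: x + a)%R = (c ^- n)%:E * \int[mu]_x f x)%E.
Proof.
move=> c0 mf f0; apply: (@ge0_integral_comp_scaling _ _ _ _ (fun x : 'rV[R]_n => c *: x + a)) => //.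
- by rewrite invr_gt0 exprn_gt0.
- exact: measurable_affine.
- by move=> A mA; exact: lebesgue_rV_affine.
Qed.

Lemma Rintegral_rV_affine (c : R) (a : 'rV[R]_n) (f : 'rV[R]_n -> R) :
  0 < c -> measurable_fun setT f ->
  \int[mu]_x f (c *: x + a) = c ^- n * \int[mu]_x f x.
Proof.
move=> c0 mf; apply: (@Rintegral_comp_scaling _ _ _ _ (fun x : 'rV[R]_n => c *: x + a)) => //.
- by rewrite invr_gt0 exprn_gt0.
- exact: measurable_affine.
- by move=> A mA; exact: lebesgue_rV_affine.
Qed.

Lemma Rintegral_rV_shift (a : 'rV[R]_n) (f : 'rV[R]_n -> R) :
  measurable_fun setT f -> \int[mu]_x f (x + a) = \int[mu]_x f x.
Proof.
move=> mf; have := @Rintegral_rV_affine 1 a f ltr01 mf.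
rewrite expr1n invr1 mul1r => <-; apply: eq_Rintegral => x _.
by rewrite scale1r.
Qed.

Lemma ge0_integral_rV_shift (a : 'rV[R]_n) (f : 'rV[R]_n -> \bar R) :
  measurable_fun setT f -> (forall x, 0 <= f x)%E ->
  (\int[mu]_x f (x + a)%R = \int[mu]_x f x)%E.
Proof.
move=> mf f0; have := @ge0_integral_rV_affine 1 a f ltr01 mf f0.
rewrite expr1n invr1 mul1e => <-; apply: eq_integral => x _.
by rewrite scale1r.
Qed.

Lemma ge0_integral_rVN (f : 'rV[R]_n -> \bar R) :
  measurable_fun setT f -> (forall x, 0 <= f x)%E ->
  (\int[mu]_x f (- x)%R = \int[mu]_x f x)%E.
Proof.
move=> mf f0; rewrite -[RHS]mul1e.
apply: (@ge0_integral_comp_scaling _ _ _ _ (fun x : 'rV[R]_n => - x) 1) => //.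
  exact: measurable_rVN.
by move=> A mA; rewrite mul1e; exact: lebesgue_rVN.
Qed.

Lemma Rintegral_rVN (f : 'rV[R]_n -> R) :
  measurable_fun setT f -> \int[mu]_x f (- x) = \int[mu]_x f x.
Proof.
move=> mf; rewrite -[RHS]mul1r.
apply: (@Rintegral_comp_scaling _ _ _ _ (fun x : 'rV[R]_n => - x) 1) => //.
  exact: measurable_rVN.
by move=> A mA; rewrite mul1e; exact: lebesgue_rVN.
Qed.

End affine_maps.

Section measurable_rV_operations.
Context d (T : measurableType d) (R : realType) (n : nat).
Implicit Types f g : T -> 'rV[R]_n.

Lemma measurable_rVD f g : measurable_fun setT f -> measurable_fun setT g ->
  measurable_fun setT (fun t => f t + g t).
Proof.
move=> mf mg; apply: measurable_fun_coord => i; under eq_fun do rewrite !mxE.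
apply: measurable_funD.
  exact: (measurableT_comp (measurable_coord i) mf).
exact: (measurableT_comp (measurable_coord i) mg).
Qed.

Lemma measurable_rVZ (c : T -> R) f : measurable_fun setT c -> measurable_fun setT f ->
  measurable_fun setT (fun t => c t *: f t).
Proof.
move=> mc mf; apply: measurable_fun_coord => i; under eq_fun do rewrite !mxE.
apply: measurable_funM => //.
exact: (measurableT_comp (measurable_coord i) mf).
Qed.

Lemma measurable_rVB f g : measurable_fun setT f -> measurable_fun setT g ->
  measurable_fun setT (fun t => f t - g t).
Proof.
move=> mf mg; apply: measurable_rVD => //.
exact: (measurableT_comp (@measurable_rVN R n) mg).
Qed.

End measurable_rV_operations.

(** * The Euclidean norm and its balls *)

Section euclidean_norm.
Variables (R : realType) (n : nat).
Implicit Types x y : 'rV[R]_n.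

Definition dot x y : R := \sum_i x ord0 i * y ord0 i.

Lemma dotC x y : dot x y = dot y x.
Proof. by apply: eq_bigr => i _; rewrite mulrC. Qed.

Lemma dotDl x y z : dot (x + y) z = dot x z + dot y z.
Proof. by rewrite -big_split/=; apply: eq_bigr => i _; rewrite mxE mulrDl. Qed.

Lemma dotZl (a : R) x z : dot (a *: x) z = a * dot x z.
Proof. by rewrite mulr_sumr; apply: eq_bigr => i _; rewrite mxE mulrA. Qed.

Lemma dotDr x y z : dot z (x + y) = dot z x + dot z y.
Proof. by rewrite dotC dotDl !(dotC z). Qed.

Lemma dotZr (a : R) x z : dot z (a *: x) = a * dot z x.
Proof. by rewrite dotC dotZl (dotC z). Qed.

Lemma dotBr x y z : dot z (x - y) = dot z x - dot z y.
Proof. by rewrite -scaleN1r dotDr dotZr mulN1r. Qed.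

Lemma dotBl x y z : dot (x - y) z = dot x z - dot y z.
Proof. by rewrite dotC dotBr !(dotC z). Qed.

Lemma dot_ge0 x : 0 <= dot x x.
Proof. by apply: sumr_ge0 => i _; rewrite -expr2 sqr_ge0. Qed.

Lemma dot_eq0 x : (dot x x == 0) = (x == 0).
Proof.
apply/idP/eqP => [|->]; last first.
  by rewrite /dot big1// => i _; rewrite mxE mul0r.
rewrite psumr_eq0 => [/allP h|i _]; last by rewrite -expr2 sqr_ge0.
apply/rowP => i; rewrite mxE.
have := h i; rewrite mem_index_enum => /(_ isT)/=.
by rewrite mulf_eq0 orbb => /eqP.
Qed.

Lemma enormE x : enorm x = Num.sqrt (dot x x).
Proof. by congr Num.sqrt; apply: eq_bigr => i _; rewrite expr2. Qed.

Lemma sqr_enorm x : enorm x ^+ 2 = dot x x.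
Proof. by rewrite enormE sqr_sqrtr// dot_ge0. Qed.

Lemma enorm_ge0 x : 0 <= enorm x.
Proof. by rewrite sqrtr_ge0. Qed.

Lemma enorm_eq0 x : (enorm x == 0) = (x == 0).
Proof. by rewrite -dot_eq0 -sqr_enorm sqrf_eq0. Qed.

Lemma enorm0 : enorm (0 : 'rV[R]_n) = 0.
Proof. by apply/eqP; rewrite enorm_eq0. Qed.

Lemma enorm_gt0 x : (0 < enorm x) = (x != 0).
Proof. by rewrite lt0r enorm_eq0 enorm_ge0 andbT. Qed.

Lemma enormZ (a : R) x : enorm (a *: x) = `|a| * enorm x.
Proof.
by rewrite !enormE dotZl dotZr mulrA sqrtrM -?expr2 ?sqr_ge0// sqrtr_sqr.
Qed.

Lemma enormN x : enorm (- x) = enorm x.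
Proof. by rewrite -scaleN1r enormZ normrN1 mul1r. Qed.

(** Cauchy-Schwarz, by expanding the square of [enorm y *: x - enorm x *: y]. The product of the
    norms is cancelled at the end, hence the zero vectors are set apart. *)
Lemma dot_le_enorm x y : dot x y <= enorm x * enorm y.
Proof.
have [->|x0] := eqVneq x 0.
  by rewrite enorm0 mul0r /dot big1// => i _; rewrite mxE mul0r.
have [->|y0] := eqVneq y 0.
  by rewrite enorm0 mulr0 /dot big1// => i _; rewrite mxE mulr0.
rewrite -enorm_gt0 in x0; rewrite -enorm_gt0 in y0.
have := dot_ge0 (enorm y *: x - enorm x *: y).
rewrite !(dotBl, dotBr, dotZl, dotZr) -!sqr_enorm (dotC y x) => h.
have {}h : 0 <= (enorm x * enorm y) * (enorm x * enorm y - dot x y) by lra.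
by move: h; rewrite pmulr_rge0 ?mulr_gt0// subr_ge0.
Qed.

Lemma ler_enormD x y : enorm (x + y) <= enorm x + enorm y.
Proof.
rewrite -(@ler_pXn2r _ 2)// ?nnegrE ?addr_ge0 ?enorm_ge0// sqr_enorm.
rewrite !(dotDl, dotDr) sqrrD -!sqr_enorm (dotC y x).
by have := dot_le_enorm x y; lra.
Qed.

Lemma enorm_distC x y : enorm (x - y) = enorm (y - x).
Proof. by rewrite -enormN opprB. Qed.

Lemma ler_enormB x y : enorm x - enorm y <= enorm (x - y).
Proof. by rewrite lerBlDr (le_trans _ (ler_enormD _ _))// subrK. Qed.

Lemma coord_le_enorm x i : `|x ord0 i| <= enorm x.
Proof.
rewrite -(@ler_pXn2r _ 2)// ?nnegrE ?enorm_ge0// sqr_enorm /dot.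
rewrite (bigD1 i)//= real_normK ?num_real// expr2 lerDl.
by apply: sumr_ge0 => j _; rewrite -expr2 sqr_ge0.
Qed.

Lemma norm_le_enorm x : `|x| <= enorm x.
Proof. by apply: norm_le_coord; [exact: enorm_ge0|exact: coord_le_enorm]. Qed.

Lemma enorm_le_norm x : enorm x <= n%:R * `|x|.
Proof.
rewrite -(@ler_pXn2r _ 2)// ?nnegrE ?enorm_ge0 ?mulr_ge0// sqr_enorm /dot.
apply: (@le_trans _ _ (\sum_(i < n) `|x| ^+ 2)).
  apply: ler_sum => i _; rewrite -expr2 -real_normK ?num_real//.
  by rewrite ler_pXn2r ?nnegrE//; exact: coord_le_norm.
rewrite sumr_const card_ord -[leLHS]mulr_natl exprMn ler_wpM2r ?sqr_ge0//.
by rewrite -natrX ler_nat -mulnn; case: (n) => // m; exact: leq_pmulr.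
Qed.

Lemma enorm_delta i : enorm (delta_mx ord0 i : 'rV[R]_n) = 1.
Proof.
rewrite enormE /dot (bigD1 i)//= big1 => [|j ji].
  by rewrite !mxE !eqxx/= mulr1 addr0 sqrtr1.
by rewrite !mxE (negbTE ji) andbF mulr0.
Qed.

Lemma enorm_continuous : continuous (@enorm R n).
Proof.
move=> x; apply/(@cvgrPdist_lt _ _ _ _ (nbhs_filter x)) => e e0.
apply/nbhs_ballP; exists (e / n.+1%:R) => /=; first by rewrite divr_gt0.
move=> y; rewrite mx_norm_ball /ball_/= => h.
have : enorm (x - y) < e.
  apply: (le_lt_trans (enorm_le_norm _)).
  rewrite ltr_pdivlMr// mulrC in h; apply: le_lt_trans h.
  by rewrite ler_wpM2r// ler_nat.
have := ler_enormB x y; have := ler_enormB y x; rewrite (enorm_distC y x).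
by rewrite ltr_norml => *; apply/andP; split; lra.
Qed.

Lemma measurable_enorm : measurable_fun setT (@enorm R n).
Proof. by apply: rV_continuous_measurable; exact: enorm_continuous. Qed.

Lemma measurable_fun_enorm d (T : measurableType d) (f : T -> 'rV[R]_n) :
  measurable_fun setT f -> measurable_fun setT (fun t => enorm (f t)).
Proof. exact: measurableT_comp measurable_enorm. Qed.

Definition eball x (r : R) : set 'rV[R]_n := [set y | enorm (y - x) < r].

Lemma open_eball x r : open (eball x r).
Proof.
rewrite (_ : eball x r = (fun y => enorm (y - x)) @^-1` [set t | t < r])//.
apply: open_comp; last exact: open_lt.
move=> y _; apply: (@continuous_comp _ _ _ (fun y => y - x) (@enorm R n)).
  apply: (@cvgB _ _ _ (nbhs y) (nbhs_filter y) id (cst x)).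
    exact: cvg_id.
  exact: (@cvg_cst _ x _ (nbhs y) (nbhs_filter y)).
exact: enorm_continuous.
Qed.

Lemma measurable_eball x r : measurable (eball x r).
Proof. by apply: rV_open_measurable; exact: open_eball. Qed.

Local Notation mu := (lebesgue_rV R n).

Lemma ball_measure x (r : R) : 0 < r -> (mu (ball x r) = ((r *+ 2) ^+ n)%:E)%E.
Proof.
move=> r0; rewrite rV_ballE// lebesgue_boxE; last first.
  by move=> i; apply: open_measurable; exact: ball_open.
under eq_bigr => i _.
  rewrite (_ : lebesgue_measure _ = (r *+ 2)%:E); last first.
    by have := @lebesgue_measure_ball R (x ord0 i) r (ltW r0).
  over.
by rewrite prodEFin prodr_const card_ord.
Qed.

Lemma open_measure_gt0 (U : set 'rV[R]_n) : open U -> U !=set0 -> (0 < mu U)%E.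
Proof.
move=> oU [x Ux]; move/open_nbhs_nbhs : (conj oU Ux) => /nbhs_ballP[e /= e0 eU].
apply: (@lt_le_trans _ _ (mu (ball x e))).
  by rewrite ball_measure// lte_fin exprn_gt0// pmulrn_lgt0.
apply: le_measure => //; rewrite inE; last exact: rV_open_measurable.
by apply: rV_open_measurable; exact: ball_open.
Qed.

Lemma eball_measure_fin x r : (mu (eball x r) < +oo)%E.
Proof.
have r0 : 0 < `|r| + 1 by rewrite ltr_pwDr.
apply: (@le_lt_trans _ _ (mu (ball x (`|r| + 1)))); last by rewrite ball_measure// ltry.
apply: le_measure; rewrite ?inE; first exact: measurable_eball.
  by apply: rV_open_measurable; exact: ball_open.
move=> y; rewrite /eball/= mx_norm_ball /ball_/= -normrN opprB => h.
apply: (le_lt_trans (norm_le_enorm _)); apply: (lt_le_trans h).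
by rewrite (le_trans (ler_norm _))// lerDl.
Qed.

End euclidean_norm.

(** * Invariance of Lebesgue measure under isometries *)

Section isometry.
Variables (R : realType) (n : nat).
Local Notation mu := (lebesgue_rV R n).
Variable H : 'rV[R]_n -> 'rV[R]_n.
Hypothesis mH : measurable_fun setT H.
Hypothesis HD : forall x y, H (x + y) = H x + H y.
Hypothesis HK : involutive H.
Hypothesis enormH : forall x, enorm (H x) = enorm x.

(* Translation invariance determines a measure up to a constant, and H fixes
   the unit ball. *)
Lemma lebesgue_rV_isometry (A : set 'rV[R]_n) : measurable A ->
  mu (H @^-1` A) = mu A.
Proof.
move=> mA; pose B := eball (0 : 'rV[R]_n) 1.
have mB : measurable B by exact: measurable_eball.
pose f (x : 'rV[R]_n) : \bar R := (\1_A x)%:E.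
pose g (x : 'rV[R]_n) : \bar R := (\1_B x)%:E.
have mf : measurable_fun setT f by apply/measurable_EFinP; exact: measurable_indic.
have mg : measurable_fun setT g by apply/measurable_EFinP; exact: measurable_indic.
have f0 x : (0 <= f x)%E by rewrite lee_fin.
have g0 x : (0 <= g x)%E by rewrite lee_fin.
have BE x : (x \in B) = (enorm x < 1) by apply/idP/idP; rewrite in_setE /B /eball/= subr0.
have gN x : g (- x) = g x by rewrite /g !indicE !BE enormN.
have gH x : g (H x) = g x by rewrite /g !indicE !BE enormH.
have intg : (\int[mu]_x g x = mu B)%E by rewrite integral_indic// setIT.
have mHA : measurable (H @^-1` A) by rewrite -[X in measurable X]setTI; exact: mH.
have intf : (\int[mu]_x f x = mu A)%E by rewrite integral_indic// setIT.
have intfH : (\int[mu]_x f (H x) = mu (H @^-1` A))%E.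
  by have := @integral_indic _ _ _ mu _ measurableT _ mHA; rewrite setIT.
suff key : (mu (H @^-1` A) * mu B = mu A * mu B)%E.
  have : (0 < mu B)%E.
    apply: open_measure_gt0; first exact: open_eball.
    by exists 0; rewrite /B /eball/= subr0 enorm0.
  have := @eball_measure_fin R n 0 1; rewrite -/B.
  case: (mu B) key => // r key _; rewrite lte_fin => r0.
  have := congr1 (fun z => z * r^-1%:E)%E key.
  by rewrite /= -!muleA -!EFinM mulfV ?mule1// gt_eqF.
have mfst := @measurable_fst _ _ 'rV[R]_n 'rV[R]_n.
have msnd := @measurable_snd _ _ 'rV[R]_n 'rV[R]_n.
(* Shifting [x] by [H y], exchanging the integrals and shifting [y] by [- H x] turns [f (H x) * g y]
   into [f y * g (y - H x)]. Its integral in [x] is that of [g], because [g] is invariant under [H]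
   and under a change of sign. *)
transitivity (\int[mu]_y \int[mu]_x (f (H x) * g y))%E.
  rewrite -intfH -intg -ge0_integralZl//; last by exact: integral_ge0.
  apply: eq_integral => y _; rewrite ge0_integralZr//.
  exact: measurableT_comp.
transitivity (\int[mu]_y \int[mu]_x (f (H x + y)%R * g y))%E.
  apply: eq_integral => y _.
  rewrite -(@ge0_integral_rV_shift _ _ (H y) (fun x => f (H x) * g y)%E).
  - by apply: eq_integral => x _; rewrite HD HK.
  - by apply: emeasurable_funM => //; exact: measurableT_comp.
  - by move=> x; exact: mule_ge0.
rewrite -(@fubini_tonelli _ _ _ _ _ mu mu (fun p => f (H p.1 + p.2)%R * g p.2)%E); last 2 first.
- apply: emeasurable_funM; apply: measurableT_comp => //.
  by apply: measurable_rVD => //; exact: measurableT_comp.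
- by move=> x; exact: mule_ge0.
transitivity (\int[mu]_x \int[mu]_y (f y * g (y - H x)%R))%E.
  apply: eq_integral => x _.
  rewrite -(@ge0_integral_rV_shift _ _ (- H x) (fun y => f (H x + y)%R * g y)%E).
  - by apply: eq_integral => y _; rewrite addrCA subrr addr0.
  - apply: emeasurable_funM => //; apply: measurableT_comp => //.
    by apply: measurable_rVD.
  - by move=> y; exact: mule_ge0.
rewrite (@fubini_tonelli _ _ _ _ _ mu mu (fun p => f p.2 * g (p.2 - H p.1)%R)%E); last 2 first.
- apply: emeasurable_funM; apply: measurableT_comp => //.
  by apply: measurable_rVB => //; exact: measurableT_comp.
- by move=> x; exact: mule_ge0.
rewrite -intf -ge0_integralZr//; apply: eq_integral => y _ /=.
rewrite ge0_integralZl//; last first.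
  by apply: measurableT_comp => //; apply: measurable_rVB.
congr (_ * _)%E; rewrite -intg.
rewrite -[RHS](ge0_integral_rV_shift (- H y) mg g0).
apply: eq_integral => x _.
have HN z : H (- z) = - H z.
  have H0 : H 0 = 0 by apply: (addrI (H 0)); rewrite -HD !addr0.
  by apply/eqP; rewrite -addr_eq0 -HD addNr H0.
by rewrite -[RHS]gN opprB -[RHS]gH HD HK HN.
Qed.

End isometry.

Section reflection.
Variables (R : realType) (n : nat).
Local Notation mu := (lebesgue_rV R n).
Implicit Types x w : 'rV[R]_n.

(** Reflection across the hyperplane orthogonal to [w]. For [w = 0] the quotient is 0 and the map is
    the identity. *)
Definition refl w x := x - (2 * dot x w / dot w w) *: w.

Lemma reflD w x y : refl w (x + y) = refl w x + refl w y.
Proof. by rewrite /refl dotDl mulrDr mulrDl scalerDl opprD addrACA. Qed.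

Lemma refl_dot w x : dot (refl w x) w = - dot x w.
Proof.
rewrite /refl dotBl dotZl.
have [->|w0] := eqVneq w 0.
  have d0 z : dot z (0 : 'rV[R]_n) = 0 by rewrite -(scale0r 0) dotZr mul0r.
  by rewrite !d0 mulr0 subrr oppr0.
by rewrite -mulrA mulVf ?dot_eq0// mulr1; ring.
Qed.

Lemma reflK w : involutive (refl w).
Proof.
move=> x; rewrite {1}/refl refl_dot /refl -addrA -opprD -scalerDl.
by rewrite mulrN mulNr subrr scale0r subr0.
Qed.

Lemma enorm_refl w x : enorm (refl w x) = enorm x.
Proof.
rewrite !enormE; congr Num.sqrt.
rewrite {2}/refl dotBr dotZr refl_dot /refl dotBl dotZl.
by rewrite (dotC w x); ring.
Qed.

(** Invariance under reflections therefore already gives radial symmetry: no other isometries have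
    to be constructed. *)
Lemma refl_swap x y : enorm x = enorm y -> refl (x - y) x = y.
Proof.
move=> xy; have [->|w0] := eqVneq x y.
  by rewrite /refl subrr scaler0 subr0.
rewrite /refl (_ : 2 * _ / _ = 1) ?scale1r ?subKr//.
have e : dot x x = dot y y by rewrite -!sqr_enorm xy.
have d0 : dot (x - y) (x - y) != 0 by rewrite dot_eq0 subr_eq0.
rewrite -[RHS](mulfV d0); congr (_ / _).
by rewrite !(dotBl, dotBr) -e (dotC y x); ring.
Qed.

Lemma measurable_refl w : measurable_fun setT (refl w).
Proof.
apply: measurable_rVB => //; apply: measurable_rVZ => //.
apply: measurable_funM => //; apply: measurable_funM => //.
rewrite /dot; apply: measurable_sum => i; apply: measurable_funM => //.
exact: measurable_coord.
Qed.

Lemma Rintegral_refl w (f : 'rV[R]_n -> R) : measurable_fun setT f ->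
  \int[mu]_x f (refl w x) = \int[mu]_x f x.
Proof.
move=> mf; rewrite -[RHS]mul1r.
apply: (@Rintegral_comp_scaling _ _ _ _ (refl w) 1) => //.
  exact: measurable_refl.
move=> A mA; rewrite mul1e.
apply: lebesgue_rV_isometry => //.
- exact: measurable_refl.
- exact: reflD.
- exact: reflK.
- exact: enorm_refl.
Qed.

End reflection.

(** * Integrals of powers and polar coordinates *)

Section power_integrals.
Variable R : realType.
Local Notation leb := (@lebesgue_measure R).

Lemma integral_powR_segment (a x y : R) : a + 1 != 0 -> 0 < x -> x < y ->
  (\int[leb]_(t in `[x, y]) (t `^ a)%:E =
   ((y `^ (a + 1) - x `^ (a + 1)) / (a + 1))%:E)%E.
Proof.
move=> a1 x0 xy.
have cpow (b t : R) : 0 < t -> {for t, continuous (@powR R ^~ b)}.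
  move=> t0; apply: differentiable_continuous; apply/derivable1_diffP.
  by apply: derivable_powR; rewrite in_itv/= t0.
rewrite (@continuous_FTC2 _ _ (fun t => (a + 1)^-1 * t `^ (a + 1)) x y xy).
- by rewrite -EFinD; congr (_%:E); field.
- apply: continuous_in_subspaceT => t; rewrite inE/= in_itv/= => /andP[xt _].
  by apply: cpow; exact: lt_le_trans xt.
- have dF t : 0 < t -> derivable (fun t => (a + 1)^-1 * t `^ (a + 1)) t 1.
    move=> t0; apply: derivableM => //.
    by apply: derivable_powR; rewrite in_itv/= t0.
  have cF t : 0 < t -> {for t, continuous (fun t => (a + 1)^-1 * t `^ (a + 1))}.
    by move=> t0; apply: differentiable_continuous; apply/derivable1_diffP/dF.
  split.
  + by move=> t; rewrite in_itv/= => /andP[xt _]; apply: dF; exact: lt_trans xt.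
  + by apply: cvg_at_right_filter; exact: cF.
  + by apply: cvg_at_left_filter; apply: cF; exact: lt_trans xy.
- move=> t; rewrite in_itv/= => /andP[xt _].
  have t0 : 0 < t by exact: lt_trans xt.
  rewrite derive1Ml; last by apply: derivable_powR; rewrite in_itv/= t0.
  rewrite powR_derive1 ?in_itv/= ?t0// mulrA mulVf// mul1r.
  by congr powR; rewrite addrK.
Qed.

Lemma integral_powR_near0 (a b : R) : -1 < a -> 0 < b ->
  (\int[leb]_(t in `]0%R, b]) (t `^ a)%:E < +oo)%E.
Proof.
move=> a1 b0; have a10 : 0 < a + 1 by rewrite -ltrBlDr sub0r.
(* [k.+2] keeps the left end strictly below [b], as [integral_powR_segment] demands. The explicit
   primitive bounds the integrals over all these segments by the same number. *)
pose F (k : nat) : set R := `[b / k.+2%:R, b]%classic.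
have FE : `]0%R, b]%classic = \bigcup_k F k.
  apply/seteqP; split=> [t|t [k _]]; rewrite /F/= !in_itv/= => /andP[t0 t1].
    have tb0 : 0 < t / b by rewrite divr_gt0.
    have /cvgrPdist_lt/(_ _ tb0)[k _ /(_ k.+1 (leqnSn k))] := @cvg_harmonic R.
    rewrite /= sub0r normrN ger0_norm// ltr_pdivlMr// => h; exists k => //=.
    by rewrite in_itv/= t1 andbT ltW// mulrC.
  by rewrite t1 andbT (lt_le_trans _ t0)// divr_gt0.
rewrite FE.
have ndF : nondecreasing_seq F.
  move=> k l kl; apply/subsetPset => t; rewrite /F/= !in_itv/= => /andP[kt ->].
  rewrite andbT (le_trans _ kt)// ler_pM2l// lef_pV2 ?posrE// ler_nat//.
have mp D : measurable_fun D (fun t : R => (t `^ a)%:E).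
  by apply/measurable_EFinP; apply: measurable_funTS; exact: measurable_powR.
have cv := @ge0_nondecreasing_set_cvg_integral _ (measurableTypeR R) R F (fun t => (t `^ a)%:E) leb
  ndF (fun=> measurable_itv _) (fun=> mp _) (fun i x _ => powR_ge0 x a).
rewrite -(cvg_lim _ cv)//; apply: (@le_lt_trans _ _ (b `^ (a + 1) / (a + 1))%:E); last exact: ltry.
apply: lime_le; first by apply/cvg_ex; eexists; exact: cv.
apply: nearW => k; rewrite integral_powR_segment ?gt_eqF ?divr_gt0//; last first.
  by rewrite ltr_pdivrMr// ltr_pMr// ltr1n.
by rewrite lee_fin ler_wpM2r ?invr_ge0 ?(ltW a10)// lerBlDr lerDl powR_ge0.
Qed.

Lemma integral_powR_infty (a : R) : a < -1 ->
  (\int[leb]_(t in `[1%R, +oo[) (t `^ a)%:E < +oo)%E.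
Proof.
move=> a1; have a10 : a + 1 < 0 by rewrite -ltrBrDr sub0r.
pose F (k : nat) : set R := `[1, k.+2%:R]%classic.
have FE : `[1%R, +oo[%classic = \bigcup_k F k.
  apply/seteqP; split=> [t|t [k _]]; rewrite /F/= !in_itv/= andbT; last by move=> /andP[].
  move=> t1; exists (Num.truncn t) => //=; rewrite in_itv/= t1/=.
  by rewrite (le_trans (ltW (truncnS_gt t)))// ler_nat.
rewrite FE.
have ndF : nondecreasing_seq F.
  move=> k l kl; apply/subsetPset => t; rewrite /F/= !in_itv/= => /andP[-> kt].
  by rewrite (le_trans kt)// ler_nat.
have mp D : measurable_fun D (fun t : R => (t `^ a)%:E).
  by apply/measurable_EFinP; apply: measurable_funTS; exact: measurable_powR.
have cv := @ge0_nondecreasing_set_cvg_integral _ (measurableTypeR R) R F (fun t => (t `^ a)%:E) leb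
  ndF (fun=> measurable_itv _) (fun=> mp _) (fun i x _ => powR_ge0 x a).
rewrite -(cvg_lim _ cv)//; apply: (@le_lt_trans _ _ (- (a + 1)^-1)%:E); last exact: ltry.
apply: lime_le; first by apply/cvg_ex; eexists; exact: cv.
apply: nearW => k; rewrite integral_powR_segment ?lt_eqF// ?ltr1n//.
rewrite lee_fin -[leRHS]mulN1r ler_wnM2r ?invr_le0 ?(ltW a10)//.
by rewrite powR1/= lerBrDr addNr powR_ge0.
Qed.

End power_integrals.

Section polar.
Variables (R : realType) (n : nat).
Hypothesis n_gt0 : (0 < n)%N.
Local Notation mu := (lebesgue_rV R n).
Local Notation leb := (@lebesgue_measure R).

Definition ball_vol : R := fine (mu (eball (0 : 'rV[R]_n) 1)).

Lemma ball_volE : mu (eball (0 : 'rV[R]_n) 1) = ball_vol%:E.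
Proof. by rewrite fineK// ge0_fin_numE ?eball_measure_fin. Qed.

Lemma ball_vol_gt0 : 0 < ball_vol.
Proof.
rewrite -lte_fin -ball_volE; apply: open_measure_gt0; first exact: open_eball.
by exists 0; rewrite /eball/= subr0 enorm0.
Qed.

Lemma eball_measure (r : R) : 0 < r ->
  mu (eball (0 : 'rV[R]_n) r) = (r ^+ n * ball_vol)%:E.
Proof.
move=> r0; have r0' : 0 < r^-1 by rewrite invr_gt0.
have := @lebesgue_rV_affine R n r^-1 0 _ r0' (measurable_eball (0 : 'rV[R]_n) 1).
rewrite ball_volE -EFinM exprVn invrK => <-; congr (mu _).
apply/seteqP; split=> x; rewrite /eball/= subr0 addr0 subr0 enormZ gtr0_norm//.
  by rewrite mulrC ltr_pdivrMr// mul1r.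
by rewrite mulrC ltr_pdivrMr// mul1r.
Qed.

(** The radius attached to [u = r ^ n]. The value -1 on [u <= 0] falls outside the set [D] used
    below, so the whole line can be pushed forward and its negative half does not count. *)
Let phi (u : R) : R := if 0 < u then u `^ n%:R^-1 else -1.

Let measurable_phi : measurable_fun [set: measurableTypeR R] (phi : measurableTypeR R -> measurableTypeR R).
Proof.
apply: measurable_fun_ifT => //=; exact: measurable_fun_ltr.
Qed.

Let phi_lt (r u : R) : 0 < r -> 0 < u -> (u `^ n%:R^-1 < r) = (u < r ^+ n).
Proof.
move=> r0 u0.
have n0 : n%:R != 0 :> R by rewrite pnatr_eq0 -lt0n.
have {1}-> : r = (r ^+ n) `^ n%:R^-1.
  by rewrite -powR_mulrn ?(ltW r0)// -powRrM mulfV// powRr1 ?(ltW r0).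
apply/idP/idP => [|h]; last by rewrite gt0_ltr_powR ?nnegrE ?invr_gt0 ?ltr0n ?exprn_ge0 ?ltW.
apply: contraTT; rewrite -!leNgt => h.
by apply: ge0_ler_powR; rewrite ?nnegrE ?invr_ge0 ?exprn_ge0 ?(ltW u0) ?(ltW r0).
Qed.

(* In polar coordinates r, with u = r^n. *)
Lemma polar_integral (F : R -> \bar R) : measurable_fun setT F ->
  (forall t, 0 <= F t)%E ->
  (\int[mu]_x F (enorm x) =
   ball_vol%:E * \int[leb]_(u in `]0%R, +oo[) F (u `^ n%:R^-1)%R)%E.
Proof.
move=> mF F0.
pose D : set (measurableTypeR R) := `]-1, +oo[%classic.
have mD : measurable D by exact: measurable_itv.
have me : measurable_fun setT (@enorm R n : _ -> measurableTypeR R) by exact: measurable_enorm.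
pose m1 : {measure set (measurableTypeR R) -> \bar R} :=
  (measure_function_pushforward__canonical__measure_function_Measure mu me).
pose m2 : {measure set (measurableTypeR R) -> \bar R} := mscale (NngNum (ltW ball_vol_gt0))
  (measure_function_pushforward__canonical__measure_function_Measure leb measurable_phi).
(* Inside [D], both push-forwards give []-oo, r[] the measure [ball_vol * r ^ n] when [r > 0] and 0
   otherwise, and these rays determine a measure. *)
have m12 A : measurable A -> A `<=` D -> m1 A = m2 A.
  move=> mA AD.
  pose r1 : {measure set (measurableTypeR R) -> \bar R} := mrestr m1 mD.
  pose r2 : {measure set (measurableTypeR R) -> \bar R} := mrestr m2 mD.
  suff : r1 A = r2 A by rewrite /r1 /r2 /= /mrestr !setIidl.
  apply: (@measure_unique _ R (measurableTypeR R) (@RGenInftyO.G R) (fun k => `]-oo, k%:R[%classic) _ _ _ _ r1 r2) => //.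
  - exact: RGenInftyO.measurableE.
  - move=> _ _ [x ->] [y ->]; exists (Num.min x y).
    by apply/seteqP; split=> t/=; rewrite !in_itv/= lt_min => /andP.
  - by move=> k; exists k%:R.
  - apply/seteqP; split=> // t _; exists (Num.truncn `|t|).+1 => //=.
    by rewrite in_itv/= (le_lt_trans (ler_norm t))// truncnS_gt.
  - move=> _ [r ->].
    have m1E : mrestr m1 mD `]-oo, r[ = mu (eball 0 r).
      rewrite /mrestr/= /pushforward; congr (mu _); apply/seteqP; split=> x.
        by rewrite /eball/= subr0 in_itv/= => -[].
      rewrite /eball/= subr0 in_itv/= => xr; split=> //.
      by rewrite /D/= in_itv/= andbT (lt_le_trans _ (enorm_ge0 x))// ltrN10.
    have m2E : mrestr m2 mD `]-oo, r[ = (ball_vol%:E * leb [set u : R | (0 < u)%R && (u `^ n%:R^-1 < r)%R])%E.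
      rewrite /mrestr/=; congr (_ * _)%E; rewrite /pushforward; congr (leb _).
      apply/seteqP; split=> u; rewrite /D/phi/= !in_itv/= andbT; case: ifPn => //= u0.
      + by case.
      + by rewrite ltxx => -[].
      + by move=> ->; split=> //; rewrite (lt_le_trans _ (powR_ge0 _ _))// ltrN10.
    rewrite [LHS]m1E [RHS]m2E; have [r0|r0] := ltP 0 r; last first.
      rewrite (_ : eball 0 r = set0) ?measure0; last first.
        apply/seteqP; split=> // x; rewrite /eball/= subr0 => /lt_le_trans/(_ r0).
        by rewrite ltNge enorm_ge0.
      rewrite (_ : [set u | _] = set0) ?measure0 ?mule0//.
      apply/seteqP; split=> // u /= /andP[_ /lt_le_trans/(_ r0)].
      by rewrite ltNge powR_ge0.
    rewrite eball_measure// (_ : [set u | _] = `]0, r ^+ n[%classic); last first.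
      apply/seteqP; split=> u /=; rewrite in_itv/= => /andP[u0 h].
        by rewrite u0 -phi_lt.
      by rewrite u0 phi_lt.
    rewrite [X in (_ * X)%E]lebesgue_measure_itv/= lte_fin exprn_gt0//.
    by rewrite oppr0 addr0 -EFinM mulrC.
  - move=> k; apply: (@le_lt_trans _ _ (mu (eball 0 k%:R))); last exact: eball_measure_fin.
    rewrite /mrestr/= /pushforward; apply: le_measure; rewrite ?inE.
    + rewrite -[X in measurable X]setTI; apply: (me measurableT).
      by apply: measurableI; first exact: measurable_itv.
    + exact: measurable_eball.
    + by move=> x; rewrite /eball/= subr0 in_itv/= => -[].
have := @ge0_integral_pushforward _ _ _ _ _ _ me mu D F mD (measurable_funTS mF) (fun y _ => F0 y).
rewrite (_ : @enorm R n @^-1` D = setT); last first.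
  apply/seteqP; split=> // x _; rewrite /D/= in_itv/= andbT.
  by rewrite (lt_le_trans _ (enorm_ge0 x))// ltrN10.
move=> <-.
rewrite (@eq_measure_integral _ _ _ D m2 m1 F m12).
rewrite [LHS](@ge0_integral_mscale _ _ _
  (measure_function_pushforward__canonical__measure_function_Measure leb measurable_phi)
  D mD (NngNum (ltW ball_vol_gt0)) F (measurable_funTS mF) (fun x _ => F0 x)).
congr (_ * _)%E.
rewrite [LHS](@ge0_integral_pushforward _ _ _ _ _ _ measurable_phi leb D F mD (measurable_funTS mF) (fun y _ => F0 y)).
rewrite (_ : phi @^-1` D = `]0%R, +oo[%classic).
  by apply: eq_integral => u; rewrite inE/= in_itv/= andbT /phi => ->.
apply/seteqP; split=> u; rewrite /D/= /phi !in_itv/= !andbT; case: ifPn => // u0.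
  by rewrite ltxx.
by rewrite (lt_le_trans _ (powR_ge0 _ _))// ltrN10.
Qed.

End polar.

Section radial_integrability.
Variables (R : realType) (n : nat).
Hypothesis n_gt0 : (0 < n)%N.
Local Notation mu := (lebesgue_rV R n).
Local Notation leb := (@lebesgue_measure R).

(** In the variable [u = r ^ n] the two majorants become [u ^ (a / n)] near 0 and [u ^ (- b / n)] at
    infinity, with exponents above and below -1 respectively. *)
Lemma radial_integral_fin (F : R -> R) (A a b : R) : measurable_fun setT F ->
  (forall t, 0 <= F t) -> 0 <= A -> - n%:R < a -> n%:R < b ->
  (forall t, 0 < t <= 1 -> F t <= A * t `^ a) ->
  (forall t, 1 <= t -> F t <= A * t `^ (- b)) ->
  (\int[mu]_x (F (enorm x))%:E < +oo)%E.
Proof.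
move=> mF F0 A0 na nb Fa Fb.
have n0 : 0 < n%:R :> R by rewrite ltr0n.
rewrite (@polar_integral _ _ n_gt0 (EFin \o F))//; last exact/measurable_EFinP.
apply: lte_mul_pinfty => //; first by rewrite lee_fin ltW// ball_vol_gt0.
pose G (u : measurableTypeR R) : R := F (u `^ n%:R^-1).
have mG (D : set (measurableTypeR R)) : measurable_fun D (EFin \o G).
  apply/measurable_EFinP; apply: measurable_funTS.
  by apply: measurableT_comp => //; exact: measurable_powR.
have mP (c : R) (D : set (measurableTypeR R)) : measurable_fun D (fun u : R => (A * u `^ c)%:E).
  apply/measurable_EFinP; apply: measurable_funTS; exact: measurable_funM.
have intP (c : R) (D : set (measurableTypeR R)) : measurable D ->
    (\int[leb]_(u in D) (u `^ c)%:E < +oo)%E ->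
    (\int[leb]_(u in D) (A * u `^ c)%:E < +oo)%E.
  move=> mD h; under eq_integral do rewrite EFinM.
  rewrite ge0_integralZl//; first exact: lte_mul_pinfty.
    by apply/measurable_EFinP; apply: measurable_funTS; exact: measurable_powR.
  by move=> u _; rewrite lee_fin powR_ge0.
rewrite (@itv_bndbnd_setU _ _ _ (BRight (1 : R))); [|by rewrite bnd_simp..].
rewrite ge0_integral_setU//=; last 2 first.
- by move=> u _; rewrite lee_fin.
- apply/disj_setPS => u /= []; rewrite !in_itv/= andbT => /andP[_ u1].
  by rewrite ltNge u1.
apply: lte_add_pinfty.
- apply: (@le_lt_trans _ _ (\int[leb]_(u in `]0%R, 1%R]) (A * u `^ (a / n%:R))%:E)%E).
    apply: ge0_le_integral => //.
    + by move=> u _; rewrite lee_fin.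
    + move=> u /=; rewrite in_itv/= => /andP[u0 u1]; rewrite lee_fin.
      rewrite (mulrC a) powRrM; apply: Fa; rewrite powR_gt0//=.
      by rewrite -[leRHS](@powRr0 _ u) ger_powR ?u0 ?u1//= invr_ge0 ltW.
  apply: intP => //; apply: integral_powR_near0 => //.
  by rewrite ltr_pdivlMr// mulN1r.
- apply: (@le_lt_trans _ _ (\int[leb]_(u in `]1%R, +oo[) (A * u `^ (- b / n%:R))%:E)%E).
    apply: ge0_le_integral => //.
    + by move=> u _; rewrite lee_fin.
    + move=> u /=; rewrite in_itv/= andbT => u1; rewrite lee_fin.
      rewrite (mulrC (- b)) powRrM; apply: Fb.
      by rewrite -[leLHS](@powRr0 _ u) ler_powR ?(ltW u1)//= invr_ge0 ltW.
  apply: intP => //.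
  apply: le_lt_trans (@integral_powR_infty R (- b / n%:R) _); last first.
    by rewrite ltr_pdivrMr// mulN1r ltrN2.
  apply: ge0_subset_integral => //.
  + by apply/measurable_EFinP; apply: measurable_funTS; exact: measurable_powR.
  + by move=> u _; rewrite lee_fin powR_ge0.
  + by move=> u /=; rewrite !in_itv/= !andbT => /ltW.
Qed.

End radial_integrability.

(** * The weight of [L_s] and a majorant for second differences *)

Section weight.
Variables (R : realType) (n : nat) (s : R).
Hypotheses (n_gt0 : (0 < n)%N) (s_gt0 : 0 < s) (s_lt1 : s < 1).
Local Notation mu := (lebesgue_rV R n).
Local Notation p := (n%:R + 2 * s).

Definition weight (x : 'rV[R]_n) : R := (1 + enorm x `^ p)^-1.

Let p_gt0 : 0 < p. Proof. by rewrite ltr_wpDl// mulr_gt0. Qed.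

Lemma weight_gt0 x : 0 < weight x.
Proof. by rewrite invr_gt0 ltr_pwDl// powR_ge0. Qed.

Lemma weight_le1 x : weight x <= 1.
Proof. by rewrite invf_le1 ?lerDl ?powR_ge0// ltr_pwDl// powR_ge0. Qed.

Let measurable_invr1 (f : R -> R) : measurable_fun setT f -> (forall t, 0 <= f t) ->
  measurable_fun setT (fun t => (f t)^-1).
Proof.
move=> mf f0; under eq_fun do rewrite -powR_inv1//.
exact: (measurableT_comp (measurable_powR (-1)) mf).
Qed.

Lemma measurable_weight : measurable_fun setT weight.
Proof.
have h : measurable_fun setT (fun t : R => (1 + t `^ p)^-1).
  apply: measurable_invr1; first by apply: measurable_funD => //; exact: measurable_powR.
  by move=> t; rewrite addr_ge0// powR_ge0.
exact: (measurableT_comp h (@measurable_enorm R n)).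
Qed.

Lemma weightN x : weight (- x) = weight x.
Proof. by rewrite /weight enormN. Qed.

Lemma integral_weight_fin : (\int[mu]_x (weight x)%:E < +oo)%E.
Proof.
apply: (@radial_integral_fin _ _ n_gt0 (fun t => (1 + t `^ p)^-1) 1 0 p) => //.
- apply: measurable_invr1; first by apply: measurable_funD => //; exact: measurable_powR.
  by move=> t; rewrite addr_ge0// powR_ge0.
- by move=> t; rewrite invr_ge0 addr_ge0// powR_ge0.
- by rewrite oppr_lt0 ltr0n.
- by rewrite ltrDl mulr_gt0.
- move=> t /andP[t0 _]; rewrite powRr0 mulr1.
  by rewrite invf_le1 ?lerDl ?powR_ge0// ltr_pwDl// powR_ge0.
- move=> t t1; rewrite mul1r powRN lef_pV2 ?posrE ?lerDr//.
    by rewrite ltr_pwDl// powR_ge0.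
  by rewrite powR_gt0// (lt_le_trans _ t1).
Qed.

(** A bounded translation costs only a constant, because [enorm x] is at most twice the larger of
    [enorm (x + a)] and [r]. *)
Lemma weight_shift (r : R) : 0 <= r ->
  exists2 C, 0 < C & forall x a, enorm a <= r -> weight (x + a) <= C * weight x.
Proof.
move=> r0; pose C := 1 + 2 `^ p * (1 + r `^ p).
have C1 : 1 <= C by rewrite lerDl mulr_ge0 ?addr_ge0 ?powR_ge0.
exists C => [|x a ar]; first exact: lt_le_trans C1.
rewrite /weight ler_pdivlMr ?ltr_pwDl ?powR_ge0// mulrC ler_pdivrMr ?ltr_pwDl ?powR_ge0//.
set y := enorm (x + a).
have xy : enorm x <= y + r.
  have := ler_enormB x (- a); rewrite opprK enormN -/y => h.
  by rewrite -lerBlDr (le_trans _ h)// lerB.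
have : enorm x `^ p <= 2 `^ p * (y `^ p + r `^ p).
  have y0 : 0 <= y by exact: enorm_ge0.
  have [yr|ry] := leP y r.
    apply: (@le_trans _ _ ((2 * r) `^ p)).
      apply: ge0_ler_powR; rewrite ?nnegrE ?enorm_ge0 ?mulr_ge0 ?(ltW p_gt0)//.
      by rewrite (le_trans xy)// mulr_natl mulr2n lerD2r.
    by rewrite powRM// ler_pM2l ?powR_gt0// lerDr powR_ge0.
  apply: (@le_trans _ _ ((2 * y) `^ p)).
    apply: ge0_ler_powR; rewrite ?nnegrE ?enorm_ge0 ?mulr_ge0 ?(ltW p_gt0)//.
    by rewrite (le_trans xy)// mulr_natl mulr2n lerD2l ltW.
  by rewrite powRM// ler_pM2l ?powR_gt0// lerDl powR_ge0.
have := powR_ge0 y p; have := powR_ge0 r p; have := powR_ge0 (2 : R) p.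
rewrite /C; move: (y `^ p) (r `^ p) (2 `^ p) (enorm x `^ p) => a1 a2 a3 a4 h1 h2 h3 h4.
have h5 : 0 <= a3 * a2 * a1 by rewrite !mulr_ge0.
by lra.
Qed.

(** The common form of the decay estimates below. [C] depends on [r] and [K] but not on [f], which
    is what makes [kernel_avg_bound] uniform in [N]. *)
Lemma weight_bound (r K : R) : 0 < r -> 0 <= K ->
  exists2 C, 0 < C & forall f : 'rV[R]_n -> R, (forall x, `|f x| <= K) ->
    (forall x, r <= enorm x -> `|f x| <= K * enorm x `^ (- p)) ->
    forall x, `|f x| <= C * weight x.
Proof.
move=> r0 K0; pose C := 1 + K * (1 + r `^ p) + K * (r `^ (- p) + 1).
have h1 : 0 <= K * (1 + r `^ p) by rewrite mulr_ge0 ?addr_ge0 ?powR_ge0.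
have h2 : 0 <= K * (r `^ (- p) + 1) by rewrite mulr_ge0 ?addr_ge0 ?powR_ge0.
exists C => [|f fK fr x]; first by rewrite /C -addrA ltr_pwDl// addr_ge0.
rewrite /weight ler_pdivlMr ?ltr_pwDl ?powR_ge0//.
have [xr|rx] := leP (enorm x) r.
  apply: (@le_trans _ _ (K * (1 + r `^ p))); last by rewrite /C addrAC lerDr addr_ge0.
  apply: ler_pM => //; first by rewrite addr_ge0 ?powR_ge0.
  by rewrite lerD2l ge0_ler_powR ?nnegrE ?enorm_ge0 ?(ltW p_gt0) ?(ltW r0).
apply: (@le_trans _ _ (K * (r `^ (- p) + 1))); last by rewrite /C lerDr addr_ge0.
have x0 : 0 < enorm x by exact: lt_trans rx.
apply: (@le_trans _ _ (K * enorm x `^ (- p) * (1 + enorm x `^ p))).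
  by rewrite ler_wpM2r ?addr_ge0 ?powR_ge0// fr// ltW.
rewrite -mulrA ler_wpM2l// mulrDr mulr1 -powRD ?(gt_eqF x0) ?implybT// addNr powRr0 lerD2r.
by rewrite !powRN lef_pV2 ?posrE ?powR_gt0// ge0_ler_powR ?nnegrE ?enorm_ge0 ?(ltW p_gt0) ?(ltW r0) ?(ltW rx).
Qed.

(** Comparable to [min(|y|^2, 1) / |y|^p]: integrable at 0 because [s < 1] and at infinity because
    [s > 0]. *)
Definition kbound (y : 'rV[R]_n) : R :=
  enorm y ^+ 2 / (1 + enorm y ^+ 2) / enorm y `^ p.

Lemma kbound_ge0 y : 0 <= kbound y.
Proof. by rewrite /kbound divr_ge0 ?powR_ge0// divr_ge0 ?addr_ge0 ?sqr_ge0. Qed.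

Let kb (t : R) := t ^+ 2 / (1 + t ^+ 2) / t `^ p.

Let measurable_kb : measurable_fun setT kb.
Proof.
apply: measurable_funM; last first.
  by apply: measurable_invr1 => [|t]; [exact: measurable_powR|exact: powR_ge0].
apply: measurable_funM; first exact: exprn_measurable.
apply: measurable_invr1; last by move=> t; rewrite addr_ge0// sqr_ge0.
by apply: measurable_funD => //; exact: exprn_measurable.
Qed.

Lemma measurable_kbound : measurable_fun setT kbound.
Proof. exact: (measurableT_comp measurable_kb (@measurable_enorm R n)). Qed.

Lemma integral_kbound_fin : (\int[mu]_y (kbound y)%:E < +oo)%E.
Proof.
apply: (@radial_integral_fin _ _ n_gt0 kb 1 (2 - p) p) => //.
- by move=> t; rewrite /kb divr_ge0 ?powR_ge0// divr_ge0 ?addr_ge0 ?sqr_ge0.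
- by rewrite opprD addrCA ltrDl subr_gt0 -[ltRHS]mulr1 ltr_pM2l.
- by rewrite ltrDl mulr_gt0.
- move=> t /andP[t0 _]; rewrite mul1r powRB ?(gt_eqF t0) ?implybT//.
  rewrite /kb ler_wpM2r ?invr_ge0 ?powR_ge0// powR_mulrn ?(ltW t0)//.
  by rewrite ler_piMr ?sqr_ge0// invf_le1 ?lerDl ?sqr_ge0// ltr_pwDl// sqr_ge0.
- move=> t t1; rewrite mul1r powRN /kb ler_piMl ?invr_ge0 ?powR_ge0//.
  by rewrite ler_pdivrMr ?mul1r ?lerDr// ltr_pwDl// sqr_ge0.
Qed.

Lemma kbound_bound (A B : R) (f : 'rV[R]_n -> R) :
  (forall y, `|f y| <= A * enorm y ^+ 2) -> (forall y, `|f y| <= B) ->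
  forall y, `|f y / enorm y `^ p| <= (A + B) * kbound y.
Proof.
move=> fA fB y; rewrite normrM (ger0_norm (_ : 0 <= (enorm y `^ p)^-1)) ?invr_ge0 ?powR_ge0//.
rewrite /kbound (mulrA (A + B)) ler_wpM2r ?invr_ge0 ?powR_ge0// (mulrA (A + B)).
have e0 : 0 <= enorm y ^+ 2 by rewrite exprn_ge0// enorm_ge0.
rewrite ler_pdivlMr ?ltr_pwDl//.
have := fA y; have := fB y; move: (enorm y ^+ 2) e0 => v v0 h1 h2.
by rewrite mulrDr mulr1 mulrDl lerD// ler_wpM2r.
Qed.

End weight.

(** * Directional derivatives and mean value estimates *)

Section directional_derivatives.
Variables (R : realType) (n : nat).
Implicit Types (f : 'rV[R]_n -> R) (x y z v : 'rV[R]_n).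
Local Notation e i := (delta_mx ord0 i : 'rV[R]_n).

Let line_quotient f z v (t : R) :
  (fun h : R => h^-1 *: (((fun t => f (z + t *: v)) \o shift t) (h *: (1 : R)) - f (z + t *: v))) =
  (fun h : R => h^-1 *: ((f \o shift (z + t *: v)) (h *: v) - f (z + t *: v))).
Proof.
apply/funext => h /=; congr (_ *: (f _ - _)).
by rewrite [_%:A]mulr1 scalerDl addrCA.
Qed.

(** Restriction to lines makes the one-variable theorems (chain rule, mean value, derivation under
    the integral) available for partial derivatives. *)
Lemma derivable_line f z v (t : R) :
  derivable (fun t : R => f (z + t *: v)) t 1 <-> derivable f (z + t *: v) v.
Proof. by rewrite /derivable line_quotient. Qed.

Lemma derive_line f z v (t : R) :
  'D_1 (fun t : R => f (z + t *: v)) t = 'D_v f (z + t *: v).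
Proof. by rewrite /derive line_quotient. Qed.

Let shift_quotient f a x v :
  (fun h : R => h^-1 *: (((fun x : 'rV[R]_n => f (x + a)) \o shift x) (h *: v) - f (x + a))) =
  (fun h : R => h^-1 *: ((f \o shift (x + a)) (h *: v) - f (x + a))).
Proof. by apply/funext => h /=; rewrite addrA. Qed.

Lemma derive_shift_arg f a x v :
  'D_v (fun x : 'rV[R]_n => f (x + a)) x = 'D_v f (x + a).
Proof. by rewrite /derive shift_quotient. Qed.

Lemma derivable_shift_arg f a x v :
  derivable (fun x : 'rV[R]_n => f (x + a)) x v <-> derivable f (x + a) v.
Proof. by rewrite /derivable shift_quotient. Qed.

Lemma is_derive_scale_arg f (c : R) x v : derivable f (c *: x) v ->
  is_derive x v (fun x : 'rV[R]_n => f (c *: x)) (c * 'D_v f (c *: x)).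
Proof.
move=> df.
have h0 : is_derive (0 : R) 1 (fun t : R => f (c *: x + (c * t) *: v)) (c * 'D_v f (c *: x)).
  rewrite mulrC; apply: (@is_derive1_comp _ (fun t : R => f (c *: x + t *: v)) (fun t : R => c * t)).
    rewrite mulr0; have e0 : c *: x = c *: x + (0 : R) *: v by rewrite scale0r addr0.
    apply: DeriveDef; last by rewrite derive_line -e0.
    by apply/derivable_line; rewrite -e0.
  by apply: is_derive_eq; rewrite [LHS]mulr1.
have ext : (fun t : R => f (c *: x + (c * t) *: v)) = (fun t : R => f (c *: (x + t *: v))).
  by apply/funext => t; rewrite scalerDr scalerA.
have x0 : x = x + (0 : R) *: v by rewrite scale0r addr0.
rewrite ext in h0; case: h0 => h1 h2; apply: DeriveDef.
  rewrite [X in derivable _ X _]x0.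
  exact: (proj1 (derivable_line (fun x : 'rV[R]_n => f (c *: x)) x v 0) h1).
by rewrite [X in 'D_v _ X]x0 -(@derive_line (fun x : 'rV[R]_n => f (c *: x)) x v 0).
Qed.

Lemma coord_mean_value f z i (c K : R) :
  (forall t : R, `|t| <= `|c| -> derivable f (z + t *: e i) (e i) /\
     `|partial_deriv i f (z + t *: e i)| <= K) ->
  `|f (z + c *: e i) - f z| <= K * `|c|.
Proof.
move=> h; pose g (t : R) := f (z + t *: e i).
have g0 : f z = g 0 by rewrite /g scale0r addr0.
have dg (t : R) : `|t| <= `|c| -> is_derive t 1 g (partial_deriv i f (z + t *: e i)).
  move=> /h[h1 _]; apply: DeriveDef; first exact/derivable_line.
  by rewrite derive_line.
have cg (t : R) : `|t| <= `|c| -> {for t, continuous g}.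
  move=> /dg[h1 _]; apply: differentiable_continuous; exact/derivable1_diffP.
rewrite g0 -/(g c); have [c0|c0] := leP 0 c.
  have h1 (t : R) : t \in `[0, c] -> `|t| <= `|c|.
    by rewrite in_itv/= => /andP[t0 tc]; rewrite !ger0_norm.
  have [||u /h1 uc ->] := @MVT_segment _ g (fun t : R => partial_deriv i f (z + t *: e i)) 0 c c0.
  - by move=> t tc; apply/dg/h1; exact: subset_itv_oo_cc tc.
  - by apply: continuous_in_subspaceT => t; rewrite inE => tc; apply/cg/h1.
  by rewrite subr0 normrM ler_wpM2r//; have [] := h u uc.
have h1 (t : R) : t \in `[c, 0] -> `|t| <= `|c|.
  by rewrite in_itv/= => /andP[t0 tc]; rewrite !ler0_norm ?lerN2// ltW.
have [||u /h1 uc e0] := @MVT_segment _ g (fun t : R => partial_deriv i f (z + t *: e i)) c 0 (ltW c0).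
- by move=> t tc; apply/dg/h1; exact: subset_itv_oo_cc tc.
- by apply: continuous_in_subspaceT => t; rewrite inE => tc; apply/cg/h1.
by rewrite distrC e0 sub0r normrM normrN ler_wpM2r//; have [] := h u uc.
Qed.

(** The coordinates are changed one at a time: [yk k] carries the first [k] of them, and all
    intermediate points stay in the sup-norm ball where the bound is assumed. *)
Lemma partial_lipschitz f x y (K : R) : 0 <= K ->
  (forall z i, `|z - x| <= `|y| -> derivable f z (e i) /\ `|partial_deriv i f z| <= K) ->
  `|f (x + y) - f x| <= n%:R * K * `|y|.
Proof.
move=> K0 h; pose yk k : 'rV[R]_n := \row_i (if (i < k)%N then y ord0 i else 0).
suff H k : (k <= n)%N -> `|f (x + yk k) - f x| <= k%:R * K * `|y|.
  have := H n (leqnn n); rewrite (_ : yk n = y)//.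
  by apply/rowP => i; rewrite mxE ltn_ord.
elim: k => [_|k IH kn].
  rewrite (_ : yk 0%N = 0) ?addr0 ?subrr ?normr0 ?mul0r//.
  by apply/rowP => i; rewrite !mxE.
pose i := Ordinal kn.
have ykS : yk k.+1 = yk k + y ord0 i *: e i.
  apply/rowP => j; rewrite !mxE eqxx/= ltnS leq_eqVlt -val_eqE/=.
  have [jk|jk] := eqVneq (j : nat) k; last by rewrite mulr0 addr0.
  rewrite /= jk ltnn add0r mulr1; congr (y ord0 _); exact: val_inj.
have step : `|f (x + yk k + y ord0 i *: e i) - f (x + yk k)| <= K * `|y ord0 i|.
  apply: coord_mean_value => t ty; apply: h.
  rewrite -(addrA x) [x + _]addrC addrK; apply: norm_le_coord => // j; rewrite !mxE eqxx/= -val_eqE/=.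
  have [jk|jk] := eqVneq (j : nat) k.
    by rewrite jk ltnn add0r mulr1 (le_trans ty)// coord_le_norm.
  rewrite mulr0 addr0; case: ifP => _; first exact: coord_le_norm.
  by rewrite normr0.
rewrite ykS addrA -(subrK (f (x + yk k)) (f (_ + _ *: _))) -addrA.
apply: (le_trans (ler_normD _ _)); rewrite -natr1 !mulrDl mul1r [leRHS]addrC.
apply: lerD; last exact/IH/ltnW.
by apply: (le_trans step); rewrite ler_wpM2l// coord_le_norm.
Qed.

(** Reduces the continuity of a parameter integral to local bounds on its first derivatives, which
    the domination hypothesis already supplies. *)
Lemma bounded_partials_continuous f x (d K : R) : 0 < d -> 0 <= K ->
  (forall z i, `|z - x| < d -> derivable f z (e i) /\ `|partial_deriv i f z| <= K) ->
  {for x, continuous f}.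
Proof.
move=> d0 K0 h; apply/(@cvgrPdist_lt _ _ _ _ (nbhs_filter x)) => eps eps0.
pose C := n%:R * K + 1.
have C0 : 0 < C by rewrite ltr_wpDl// mulr_ge0.
apply/nbhs_ballP; exists (Num.min d (eps / C)) => /=; first by rewrite lt_min d0 divr_gt0.
move=> y; rewrite mx_norm_ball /ball_/= lt_min => /andP[yd ye].
have := @partial_lipschitz f x (y - x) K K0; rewrite [x + _]addrC subrK => H.
rewrite distrC; apply: le_lt_trans (H _) _.
  by move=> z i zx; apply: h; apply: (le_lt_trans zx); rewrite distrC.
rewrite distrC in ye; rewrite ltr_pdivlMr// in ye; apply: le_lt_trans ye.
by rewrite mulrC ler_wpM2l// /C lerDl.
Qed.

(** Subtracting the differential at [x] does not change the second difference. The partial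
    derivatives of the remainder [g] vanish at [x] and are Lipschitz, so [g] varies by
    [O(|y|^2)]. *)
Lemma second_difference_bound f (K : R) : 0 <= K ->
  (forall z i, derivable f z (e i)) ->
  (forall z i j, derivable (partial_deriv i f) z (e j)) ->
  (forall z i j, `|partial_deriv j (partial_deriv i f) z| <= K) ->
  forall x y, `|2 * f x - f (x + y) - f (x - y)| <= (2 * n%:R ^+ 2 * K) * enorm y ^+ 2.
Proof.
move=> K0 df ddf dK x y.
pose g z := f z - \sum_i partial_deriv i f x * z ord0 i.
have dlin z i : is_derive z (e i) (fun z : 'rV[R]_n => \sum_i partial_deriv i f x * z ord0 i) (partial_deriv i f x).
  have quot : (fun h : R => h^-1 *: (((fun z : 'rV[R]_n => \sum_i partial_deriv i f x * z ord0 i) \o shift z) (h *: e i) -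
     \sum_i partial_deriv i f x * z ord0 i)) @ (0 : R)^' --> partial_deriv i f x.
    apply: cvg_near_cst; exists 1 => //= h _ h0.
    rewrite -sumrB (eq_bigr (fun j => if j == i then partial_deriv i f x * h else 0)) => [|j _].
      by rewrite -big_mkcond big_pred1_eq/= /GRing.scale/= mulrCA mulVf ?mulr1.
    rewrite !mxE eqxx/=; case: eqP => [->|_] /=.
      by rewrite mulr1 -mulrBr addrK.
    by rewrite mulr0 add0r subrr.
  apply: DeriveDef; first by apply/cvg_ex; eexists; exact: quot.
  exact: cvg_lim quot.
have dg z i : is_derive z (e i) g (partial_deriv i f z - partial_deriv i f x).
  exact: (is_deriveB (derivableP (df z i)) (dlin z i)).
have K' : 0 <= n%:R * K * `|y| by rewrite !mulr_ge0.
have lip y' : `|y'| = `|y| -> `|g (x + y') - g x| <= n%:R * (n%:R * K * `|y|) * `|y|.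
  move=> yy'; rewrite -{2}yy'; apply: partial_lipschitz => // z i; rewrite yy' => zx.
  split; first by have [] := dg z i.
  rewrite /partial_deriv (@derive_val _ _ _ _ _ _ _ (dg z i)).
  have := @partial_lipschitz (partial_deriv i f) x (z - x) K K0.
  rewrite [x + _]addrC subrK => H; apply: (le_trans (H _)) => //.
  by rewrite ler_wpM2l ?mulr_ge0.
have -> : 2 * f x - f (x + y) - f (x - y) = - ((g (x + y) - g x) + (g (x - y) - g x)).
  have e1 : \sum_i partial_deriv i f x * (x + y) ord0 i + \sum_i partial_deriv i f x * (x - y) ord0 i =
      2 * \sum_i partial_deriv i f x * x ord0 i.
    by rewrite mulr_sumr -big_split/=; apply: eq_bigr => i _; rewrite !mxE; ring.
  by rewrite /g; lra.
rewrite normrN; apply: (le_trans (ler_normD _ _)).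
apply: (le_trans (lerD (lip y erefl) (lip (- y) (normrN y)))).
have h : `|y| ^+ 2 <= enorm y ^+ 2 by rewrite ler_pXn2r ?nnegrE ?enorm_ge0// norm_le_enorm.
rewrite (_ : _ + _ = (2 * n%:R ^+ 2 * K) * `|y| ^+ 2); last by ring.
by rewrite ler_wpM2l// mulr_ge0// mulr_ge0// sqr_ge0.
Qed.

End directional_derivatives.

(** * Differentiation under the integral sign *)

Section smooth_integral.
Context d (T : measurableType d) (R : realType) (nu : {measure set T -> \bar R}).
Variables (B : set T) (n : nat) (D : seq 'I_n -> 'rV[R]_n -> T -> R).
Hypothesis mB : measurable B.
Hypothesis mD : forall l x, measurable_fun B (D l x).
Hypothesis dD : forall l i x t, B t ->
  is_derive x (delta_mx ord0 i) (fun x => D l x t) (D (i :: l) x t).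
Hypothesis bD : forall l x0, exists2 g : T -> R, nu.-integrable B (EFin \o g) &
  exists2 eps, 0 < eps & forall x, `|x - x0| < eps -> forall t, B t -> `|D l x t| <= g t.
Local Notation e i := (delta_mx ord0 i : 'rV[R]_n).

Let F l x : R := \int[nu]_(t in B) D l x t.

Lemma integrable_param l x : nu.-integrable B (EFin \o D l x).
Proof.
have [g ig [eps eps0 h]] := bD l x.
apply: (le_integrable mB _ _ ig); first exact/measurable_EFinP.
move=> t Bt /=; rewrite lee_fin; apply: le_trans (ler_norm _).
by apply: h => //; rewrite subrr normr0.
Qed.

Let integrable_normr (g : T -> R) : nu.-integrable B (EFin \o g) ->
  nu.-integrable B (EFin \o (fun t => `|g t|)).
Proof.
move=> ig; apply: (le_integrable mB _ _ ig); last by move=> t _ /=; rewrite normr_id.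
apply/measurable_EFinP; apply: measurableT_comp => //.
by case/integrableP : ig => /measurable_EFinP.
Qed.

Let norm_e i : `|e i| <= 1.
Proof.
apply: norm_le_coord => // j; rewrite mxE eqxx/=.
by case: (j == i); rewrite ?normr0 ?normr1.
Qed.

Lemma is_derive_integral l i x : is_derive x (e i) (F l) (F (i :: l) x).
Proof.
have [g ig [eps eps0 h]] := bD (i :: l) x.
pose f (t : R) y := D l (x + t *: e i) y.
have I0 : `]- eps, eps[%classic (0 : R) by rewrite /= in_itv/= oppr_lt0 eps0.
have near_x (t : R) : `]- eps, eps[%classic t -> `|x + t *: e i - x| < eps.
  rewrite /= in_itv/= -ltr_norml [x + _]addrC addrK normrZ => te.
  by apply: le_lt_trans te; rewrite -[leRHS]mulr1 ler_wpM2l.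
have df (t : R) y : B y -> is_derive t 1 (f ^~ y) (D (i :: l) (x + t *: e i) y).
  move=> By; have [h1 h2] := dD l i (x + t *: e i) By; apply: DeriveDef.
    exact/(derivable_line (fun x => D l x y)).
  by rewrite (derive_line (fun x => D l x y)).
have intf (t : R) : `]- eps, eps[%classic t -> nu.-integrable B (EFin \o f t).
  by move=> _; exact: integrable_param.
have derf (t : R) y : `]- eps, eps[%classic t -> B y -> derivable (f ^~ y) t 1.
  by move=> _ By; have [] := df t y By.
have parf (t : R) y : B y -> partial1of2 f t y = D (i :: l) (x + t *: e i) y.
  by move=> By; rewrite partial1of2E (@derive_val _ _ _ _ _ _ _ (df t y By)).
have ub (t : R) y : `]- eps, eps[%classic t -> B y -> `|partial1of2 f t y| <= `|g y|.
  by move=> It By; rewrite parf//; apply: le_trans (ler_norm _); exact: h (near_x t It) _ By.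
have x0 : x = x + (0 : R) *: e i by rewrite scale0r addr0.
have G0 y : 0 <= `|g y| by [].
have h1 : derivable (F l) (x + (0 : R) *: e i) (e i).
  apply: (proj1 (derivable_line (F l) x (e i) 0)).
  exact (@derivable_under_integral _ _ _ _ f B mB 0 _ _ I0 intf derf _ G0 (integrable_normr ig) ub).
have h2 : 'D_(e i) (F l) (x + (0 : R) *: e i) = F (i :: l) (x + (0 : R) *: e i).
  rewrite -(derive_line (F l) x (e i) 0) -derive1E.
  have := @differentiation_under_integral _ _ _ _ f B mB 0 _ _ I0 intf derf _ G0 (integrable_normr ig) ub.
  rewrite -/(F l) => ->.
  by apply: eq_Rintegral => y; rewrite inE => By; rewrite parf.
by rewrite -x0 in h1 h2; apply: DeriveDef.
Qed.

Lemma foldr_partial_integral l : foldr (@partial_deriv R n) (F [::]) l = F l.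
Proof.
elim: l => //= i l ->; apply/funext => x; rewrite /partial_deriv.
exact: (@derive_val _ _ _ _ _ _ _ (is_derive_integral l i x)).
Qed.

(** Every iterated derivative is again an integral from the family [D], so each one is
    differentiable with locally bounded partial derivatives, hence continuous. *)
Lemma smooth_integral : smooth_on setT (F [::]).
Proof.
move=> l x _; rewrite foldr_partial_integral; split; last first.
  by move=> i; have [] := is_derive_integral l i x.
have bF i : exists M : R, exists2 eps, 0 < eps & forall z, `|z - x| < eps -> `|F (i :: l) z| <= M.
  have [g ig [eps eps0 h]] := bD (i :: l) x.
  exists (\int[nu]_(t in B) `|g t|); exists eps => // z zx.
  apply: (le_trans (le_normr_Rintegral mB (integrable_param _ _))).
  apply: le_Rintegral => //.
  - exact/integrable_normr/integrable_param.
  - exact: integrable_normr.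
  - by move=> t Bt; apply: le_trans (ler_norm _); exact: h.
have [M /(_ _)/cid2 h] := choice bF.
pose eps i := s2val (h i).
have [d0 d00 dle] : exists2 d0, 0 < d0 & forall i, d0 <= eps i.
  (* The default 1 keeps the radius positive when there is no index. *)
  exists (\big[Num.min/1]_i eps i).
    by apply: lt_bigmin => // i _; exact: (s2valP (h i)).
  by move=> i; exact: bigmin_le_cond.
apply: (@bounded_partials_continuous _ _ _ _ d0 (\sum_i `|M i|)) => //.
  by apply: sumr_ge0.
move=> z i zx; have [h1 h2] := is_derive_integral l i z; split=> //.
rewrite /partial_deriv h2; apply: (@le_trans _ _ (M i)).
  by apply: (s2valP' (h i)); exact: lt_le_trans zx (dle i).
rewrite (bigD1 i)//=; apply: (le_trans (ler_norm _)); rewrite lerDl.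
by apply: sumr_ge0.
Qed.

End smooth_integral.

(** * Smooth functions: locality and algebra *)

Section smooth_locality.
Variables (R : realType) (n : nat).
Implicit Types (f g : 'rV[R]_n -> R) (U : set 'rV[R]_n).

Lemma eq_open_foldr U f g l : open U -> (forall x, U x -> f x = g x) ->
  forall x, U x -> foldr (@partial_deriv R n) f l x = foldr (@partial_deriv R n) g l x.
Proof.
move=> oU fg; elim: l => //= i l IH x Ux; rewrite /partial_deriv.
apply: near_eq_derive; have : nbhs x U by exact: open_nbhs_nbhs.
by apply: filterS => y /IH.
Qed.

Lemma eq_open_smooth_on U f g : open U -> (forall x, U x -> f x = g x) ->
  smooth_on U f -> smooth_on U g.
Proof.
move=> oU fg sf l x Ux; have [cf df] := sf l x Ux.
have nU : nbhs x U by exact: open_nbhs_nbhs.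
have nfg : {near x, foldr (@partial_deriv R n) f l =1 foldr (@partial_deriv R n) g l}.
  by apply: filterS nU => y Uy; exact: (eq_open_foldr l oU fg Uy).
split; last by move=> i; exact: near_eq_derivable (df i).
rewrite /prop_for /continuous_at -(nbhs_singleton nfg).
exact: (cvg_trans (near_eq_cvg nfg) cf).
Qed.

End smooth_locality.

Section smooth_algebra.
Variables (R : realType) (n : nat).
Implicit Types (f g : 'rV[R]_n -> R).
Local Notation e i := (delta_mx ord0 i : 'rV[R]_n).

(** Recursion on the order makes products and compositions accessible to a plain induction; with
    lists of derivatives, as in [smooth_on], they would require a Leibniz formula. *)
Fixpoint Ck k f : Prop :=
  continuous f /\
  if k is k'.+1 then forall i, (forall x, derivable f x (e i)) /\ Ck k' (partial_deriv i f)
  else True.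

Lemma Ck_smooth f : (forall k, Ck k f) -> smooth_on setT f.
Proof.
move=> sf l x _.
suff H k : Ck k (foldr (@partial_deriv R n) f l).
  by split; [have [+ _] := H 0%N; exact|move=> i; have [_ /(_ i)[]] := H 1%N].
(* [foldr] applies the last index of the list first, hence the induction from the right. *)
elim/last_ind: l f sf k => [//|l i IH] f sf k /=.
by rewrite foldr_rcons; apply: IH => {}k; have [_ /(_ i)[]] := sf k.+1.
Qed.

Lemma smooth_partial f i : smooth_on setT f -> smooth_on setT (partial_deriv i f).
Proof. by move=> sf l x _; have := sf (rcons l i) x I; rewrite foldr_rcons. Qed.

Lemma smooth_continuous f : smooth_on setT f -> continuous f.
Proof. by move=> sf x; have [] := sf [::] x I. Qed.

Lemma smooth_derivable f x i : smooth_on setT f -> derivable f x (e i).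
Proof. by move=> sf; have [_] := sf [::] x I; exact. Qed.

Lemma smooth_foldr f l : smooth_on setT f -> smooth_on setT (foldr (@partial_deriv R n) f l).
Proof. by move=> sf; elim: l => [//|i l IH]; exact: (smooth_partial i IH). Qed.

Lemma CkW k f : Ck k.+1 f -> Ck k f.
Proof.
elim: k f => [|k IH] f [cf h]; split=> // i; have [h1 h2] := h i; split=> //.
exact: IH.
Qed.

Lemma Ck_cst k (c : R) : Ck k (fun=> c).
Proof.
elim: k c => [|k IH] c /=; (split; first exact: cst_continuous) => // i.
split=> [x|]; first exact: derivable_cst.
rewrite (_ : partial_deriv i _ = fun=> 0); first exact: IH.
by apply/funext => x; rewrite /partial_deriv; exact: derive_cst.
Qed.

Lemma CkD k f g : Ck k f -> Ck k g -> Ck k (fun x => f x + g x).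
Proof.
have cD f' g' : continuous f' -> continuous g' -> continuous (fun x : 'rV[R]_n => f' x + g' x).
  by move=> cf cg x; exact: (@cvgD _ _ _ (nbhs x) (nbhs_filter x) f' g' _ _ (cf x) (cg x)).
elim: k f g => [|k IH] f g [cf hf] [cg hg]; (split; first exact: cD) => // i.
have [df sf] := hf i; have [dg sg] := hg i; split.
  by move=> x; exact: derivableD.
rewrite (_ : partial_deriv i _ = fun x => partial_deriv i f x + partial_deriv i g x); first exact: IH.
by apply/funext => x; rewrite /partial_deriv; exact: deriveD.
Qed.

Lemma CkM k f g : Ck k f -> Ck k g -> Ck k (fun x => f x * g x).
Proof.
have cM f' g' : continuous f' -> continuous g' -> continuous (fun x : 'rV[R]_n => f' x * g' x).
  by move=> cf cg x; exact: (@cvgM _ _ (nbhs x) (nbhs_filter x) f' g' _ _ (cf x) (cg x)).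
elim: k f g => [|k IH] f g hf0 hg0; case: (hf0) => cf hf; case: (hg0) => cg hg;
  (split; first exact: cM) => // i.
have [df sf] := hf i; have [dg sg] := hg i; split.
  by move=> x; exact: derivableM.
rewrite (_ : partial_deriv i _ = fun x => f x * partial_deriv i g x + g x * partial_deriv i f x).
  by apply: CkD; apply: IH => //; exact: CkW.
by apply/funext => x; rewrite /partial_deriv; exact: deriveM.
Qed.

Lemma Ck_sum k (I : Type) (r : seq I) (F : I -> 'rV[R]_n -> R) :
  (forall i, Ck k (F i)) -> Ck k (fun x => \sum_(i <- r) F i x).
Proof.
move=> h; elim: r => [|i r IH].
  by under eq_fun do rewrite big_nil; exact: Ck_cst.
by under eq_fun do rewrite big_cons; exact: CkD.
Qed.

Lemma Ck_coord k (j : 'I_n) : Ck k (fun x => x ord0 j).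
Proof.
have cc : continuous (fun x : 'rV[R]_n => x ord0 j) by exact: coord_continuous.
case: k => [|k]; (split; first exact: cc) => // i.
have h (x : 'rV[R]_n) : is_derive x (e i) (fun x : 'rV[R]_n => x ord0 j) (e i ord0 j).
  have quot : (fun h : R => h^-1 *: (((fun x : 'rV[R]_n => x ord0 j) \o shift x) (h *: e i) -
     x ord0 j)) @ (0 : R)^' --> e i ord0 j.
    apply: cvg_near_cst; exists 1 => //= h _ h0.
    by rewrite !mxE addrK /GRing.scale/= mulrA mulVf ?mul1r.
  apply: DeriveDef; first by apply/cvg_ex; eexists; exact: quot.
  exact: cvg_lim quot.
split=> [x|]; first by have [] := h x.
rewrite (_ : partial_deriv i _ = fun=> e i ord0 j); first exact: Ck_cst.
by apply/funext => x; rewrite /partial_deriv (@derive_val _ _ _ _ _ _ _ (h x)).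
Qed.

End smooth_algebra.

(** * The bump function *)

Section bump.
Variable R : realType.

(** The powers of [1/t] make the family closed under derivation up to linear combinations, so
    smoothness follows by induction for all [j] together. *)
Definition ebump j (t : R) : R := if 0 < t then t^-1 ^+ j * expR (- t^-1) else 0.

Lemma ebump_ge0 j t : 0 <= ebump j t.
Proof.
rewrite /ebump; case: ifP => // t0.
by rewrite mulr_ge0 ?expR_ge0// exprn_ge0// invr_ge0 ltW.
Qed.

(** Keep one term of the exponential series, of order [j + 1] at [1/t]. Used with [j.+1], it shows
    that the difference quotient of [ebump j] at 0 tends to 0. *)
Lemma ebump_le j t : 0 < t -> ebump j t <= (j.+1)`!%:R * t.
Proof.
move=> t0; rewrite /ebump t0.
have x0 : 0 < t^-1 by rewrite invr_gt0.
rewrite expRN ler_pdivrMr ?expR_gt0//.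
have := @expR_ge1Dxn _ _ j (ltW x0) => h.
have {}h : t^-1 ^+ j.+1 / (j.+1)`!%:R <= expR t^-1 by apply: le_trans h; rewrite lerDr.
apply: (@le_trans _ _ ((j.+1)`!%:R * t * (t^-1 ^+ j.+1 / (j.+1)`!%:R))); last first.
  by rewrite ler_wpM2l// mulr_ge0// ltW.
have f0 : (j.+1)`!%:R != 0 :> R by rewrite pnatr_eq0 -lt0n fact_gt0.
have t1 : t != 0 by rewrite gt_eqF.
rewrite (_ : _ * _ * _ = t^-1 ^+ j)// exprS; move: (t^-1 ^+ j) => a.
by field; rewrite f0 t1.
Qed.

Lemma ebump_homo s t : s <= t -> ebump 0 s <= ebump 0 t.
Proof.
move=> st; rewrite /ebump; case: ifPn => s0; last by case: ifP => // t0; rewrite mulr_ge0 ?expR_ge0.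
rewrite (lt_le_trans s0 st) !expr0 !mul1r ler_expR lerN2 lef_pV2 ?posrE//.
exact: lt_le_trans st.
Qed.

Lemma is_derive_ebump j (t : R) :
  is_derive t 1 (ebump j) (ebump j.+2 t - j%:R * ebump j.+1 t).
Proof.
have [t0|t0|<-] := ltgtP 0 t.
- pose k (x : R) : R := x ^+ j * expR (- x).
  have dk : is_derive t^-1 1 k (t^-1 ^+ j * - expR (- t^-1) + expR (- t^-1) * (j%:R * t^-1 ^+ j.-1)).
    have h1 : is_derive t^-1 1 (fun x : R => expR (- x)) (- expR (- t^-1)).
      have hN : is_derive t^-1 1 (fun x : R => - x) (- 1) by exact: (is_deriveN (is_derive_id t^-1 (1 : R))).
      have := @is_derive1_comp _ expR (fun x : R => - x) t^-1 _ _ (is_derive_expR (- t^-1)) hN.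
      by rewrite mulrN1.
    have h2 : is_derive t^-1 1 (fun x : R => x ^+ j) (j%:R * t^-1 ^+ j.-1).
      apply: DeriveDef; first exact: exprn_derivable.
      by rewrite exp_derive [LHS]mulr1.
    have := is_deriveM h2 h1; rewrite /GRing.scale/= => h; exact: h.
  have dV : is_derive t 1 (fun y : R => y^-1) (- t ^- 2).
    have := @is_deriveV _ id t 1 1 (lt0r_neq0 t0) (is_derive_id t 1).
    by rewrite /GRing.scale/= mulr1.
  have dkV := is_derive1_comp dk dV.
  apply: (@near_eq_is_derive _ _ _ (k \o (fun y : R => y^-1))).
    near=> u; have u0 : 0 < u by near: u; exact: lt_nbhsr.
    by rewrite /ebump u0.
  apply: is_derive_eq dkV _; rewrite /ebump t0 -exprVn.
  case: (j) => [|j']; first by rewrite !mul0r; ring.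
  by rewrite /= !exprS; ring.
- apply: (@near_eq_is_derive _ _ _ (fun=> 0)).
    near=> u; have u0 : u < 0 by near: u; exact: lt_nbhsl.
    by rewrite /ebump ltNge (ltW u0).
  rewrite /ebump [0 < t]ltNge (ltW t0)/= mulr0 subrr; exact: is_derive_cst.
- have quot : (fun h : R => h^-1 *: ((ebump j \o shift 0) (h *: (1 : R)) - ebump j 0)) @ (0 : R)^' --> (0 : R).
    apply/cvgrPdist_lt => eps eps0.
    pose C : R := (j.+2)`!%:R.
    have C0 : 0 < C by rewrite ltr0n fact_gt0.
    exists (eps / C) => /=; first by rewrite divr_gt0.
    move=> h /=; rewrite sub0r normrN => hC h0.
    rewrite sub0r normrN addr0 [_%:A]mulr1 {2}/ebump ltxx subr0.
    rewrite /GRing.scale/= /ebump; case: ifP => hp; last by rewrite mulr0 normr0.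
    have <- : ebump j.+1 h = h^-1 * (h^-1 ^+ j * expR (- h^-1)).
      by rewrite /ebump hp exprS mulrA.
    rewrite ger0_norm ?ebump_ge0//; apply: (le_lt_trans (ebump_le _ hp)).
    by move: hC; rewrite gtr0_norm// ltr_pdivlMr// mulrC.
  rewrite /ebump ltxx mulr0 subrr; apply: DeriveDef.
    by apply/cvg_ex; eexists; exact: quot.
  exact: cvg_lim quot.
Unshelve. all: by end_near. Qed.

Variable n : nat.
Local Notation e i := (delta_mx ord0 i : 'rV[R]_n).

Lemma Ck_ebump_comp k j (q : 'rV[R]_n -> R) : (forall k, Ck k q) -> Ck k (fun x => ebump j (q x)).
Proof.
move=> sq; elim: k j => [|k IH] j.
  split=> // x; apply: continuous_comp; first by have [+ _] := sq 0%N; exact.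
  apply: differentiable_continuous; apply/derivable1_diffP.
  by have [] := is_derive_ebump j (q x).
have h i x : is_derive x (e i) (fun x => ebump j (q x))
    ((ebump j.+2 (q x) - j%:R * ebump j.+1 (q x)) * partial_deriv i q x).
  have dq : derivable q x (e i) by have [_ /(_ i)[]] := sq 1%N.
  have x0 : x = x + (0 : R) *: e i by rewrite scale0r addr0.
  have dql : is_derive (0 : R) 1 (fun t : R => q (x + t *: e i)) (partial_deriv i q x).
    apply: DeriveDef; last by rewrite derive_line -x0.
    by apply: (proj2 (derivable_line q x (e i) 0)); rewrite -x0.
  have := is_derive_ebump j (q (x + (0 : R) *: e i)); rewrite -x0 => de.
  have {}de : is_derive (q (x + (0 : R) *: e i)) 1 (ebump j) (ebump j.+2 (q x) - j%:R * ebump j.+1 (q x)).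
    by rewrite -x0.
  have [h1 h2] := @is_derive1_comp _ (ebump j) (fun t : R => q (x + t *: e i)) 0 _ _ de dql.
  have {}h1 := proj1 (derivable_line (fun x => ebump j (q x)) x (e i) 0) h1.
  have {}h2 : 'D_(e i) (fun x => ebump j (q x)) (x + (0 : R) *: e i) =
      (ebump j.+2 (q x) - j%:R * ebump j.+1 (q x)) * partial_deriv i q x.
    by rewrite -h2 -(derive_line (fun x => ebump j (q x)) x (e i) 0).
  by rewrite -x0 in h1 h2; apply: DeriveDef.
split.
  move=> x; apply: continuous_comp; first by have [+ _] := sq 0%N; exact.
  apply: differentiable_continuous; apply/derivable1_diffP.
  by have [] := is_derive_ebump j (q x).
move=> i; split=> [x|]; first by have [] := h i x.
rewrite (_ : partial_deriv i _ = fun x =>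
    (ebump j.+2 (q x) + (- j%:R) * ebump j.+1 (q x)) * partial_deriv i q x).
  apply: CkM; last by have [_ /(_ i)[]] := sq k.+1.
  apply: CkD => //; apply: CkM => //; exact: Ck_cst.
apply/funext => x; rewrite /partial_deriv (@derive_val _ _ _ _ _ _ _ (h i x)).
by rewrite mulNr.
Qed.

Definition bump (x : 'rV[R]_n) : R := ebump 0 (1 - dot x x).

Lemma smooth_bump : smooth_on setT bump.
Proof.
apply: Ck_smooth => k; apply: Ck_ebump_comp => {}k.
have -> : (fun x : 'rV[R]_n => 1 - dot x x) =
    (fun x => 1 + (-1) * \sum_(i < n) x ord0 i * x ord0 i).
  by apply/funext => x; rewrite mulN1r.
apply: CkD; first exact: Ck_cst.
apply: CkM; first exact: Ck_cst.
by apply: Ck_sum => i; apply: CkM; exact: Ck_coord.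
Qed.

Lemma bump_ge0 x : 0 <= bump x.
Proof. exact: ebump_ge0. Qed.

Lemma bump_decr x y : enorm x <= enorm y -> bump y <= bump x.
Proof.
move=> xy; apply: ebump_homo; rewrite lerD2l lerN2 -!sqr_enorm.
by rewrite ler_pXn2r ?nnegrE ?enorm_ge0.
Qed.

Lemma bump_radial x y : enorm x = enorm y -> bump x = bump y.
Proof. by move=> xy; rewrite /bump -!sqr_enorm xy. Qed.

Lemma bump_out x : 1 <= enorm x -> bump x = 0.
Proof.
move=> x1; rewrite /bump /ebump ifF// subr_gt0 -sqr_enorm.
by apply/negbTE; rewrite -leNgt expr_ge1// enorm_ge0.
Qed.

Lemma bump0_gt0 : 0 < bump 0.
Proof.
have d0 : dot (0 : 'rV[R]_n) 0 = 0 by rewrite -sqr_enorm enorm0 expr0n.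
by rewrite /bump d0 subr0 /ebump ltr01 expr0 mul1r expR_gt0.
Qed.

End bump.

(** * Fubini for real-valued integrals with a product majorant *)

Section Rintegral_fubini.
Context d1 d2 (T1 : measurableType d1) (T2 : measurableType d2) (R : realType).
Variables (m1 : {sigma_finite_measure set T1 -> \bar R})
  (m2 : {sigma_finite_measure set T2 -> \bar R}).

Lemma Rintegral_indic_mul d (T : measurableType d) (m : {measure set T -> \bar R})
    (A : set T) (f : T -> R) :
  \int[m]_(x in A) f x = \int[m]_x (\1_A x * f x).
Proof.
rewrite Rintegral_mkcond; apply: eq_Rintegral => x _.
by rewrite patchE indicE; case: (x \in A); rewrite ?mul1r ?mul0r.
Qed.

Lemma integrable_ge0_fin d (T : measurableType d) (m : {measure set T -> \bar R})
    (g : T -> R) : measurable_fun setT g -> (forall x, 0 <= g x) ->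
  (\int[m]_x (g x)%:E < +oo)%E -> m.-integrable setT (EFin \o g).
Proof.
move=> mg g0 gfin; apply/integrableP; split; first exact/measurable_EFinP.
by under eq_integral do rewrite /= ger0_norm//.
Qed.

Lemma integrable_indic_fin d (T : measurableType d) (m : {measure set T -> \bar R})
    (A : set T) : measurable A -> (m A < +oo)%E -> m.-integrable setT (EFin \o \1_A).
Proof.
move=> mA Afin; apply: integrable_ge0_fin; first exact: measurable_indic.
  by move=> x; rewrite indicE.
by rewrite integral_indic// setIT.
Qed.

Lemma integrable_subr d (T : measurableType d) (m : {measure set T -> \bar R})
    (g h : T -> R) : m.-integrable setT (EFin \o g) -> m.-integrable setT (EFin \o h) ->
  m.-integrable setT (EFin \o (fun x => g x - h x)).
Proof. by move=> ig ih; exact: (integrableB measurableT ig ih). Qed.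

Lemma integrable_normr d (T : measurableType d) (m : {measure set T -> \bar R})
    (g : T -> R) : m.-integrable setT (EFin \o g) ->
  m.-integrable setT (EFin \o (fun x => `|g x|)).
Proof.
move=> ig; apply: (le_integrable measurableT _ _ ig); last by move=> t _ /=; rewrite normr_id.
apply/measurable_EFinP; apply: measurableT_comp => //.
by case/integrableP : ig => /measurable_EFinP.
Qed.

Variables (f : T1 -> T2 -> R) (g1 : T1 -> R) (g2 : T2 -> R).
Hypotheses (mf : measurable_fun setT (fun p : T1 * T2 => f p.1 p.2))
  (mg1 : measurable_fun setT g1) (mg2 : measurable_fun setT g2)
  (g10 : forall x, 0 <= g1 x) (g20 : forall y, 0 <= g2 y)
  (g1fin : (\int[m1]_x (g1 x)%:E < +oo)%E) (g2fin : (\int[m2]_y (g2 y)%:E < +oo)%E)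
  (fg : forall x y, `|f x y| <= g1 x * g2 y).

Let mfE : measurable_fun setT (fun p : T1 * T2 => (f p.1 p.2)%:E).
Proof. exact/measurable_EFinP. Qed.

Let mfx x : measurable_fun setT (f x).
Proof. exact: (measurableT_comp mf (@pair1_measurable _ _ T1 T2 x)). Qed.

Let mfy y : measurable_fun setT (f ^~ y).
Proof. exact: (measurableT_comp mf (@pair2_measurable _ _ T1 T2 y)). Qed.

Let ix x : m2.-integrable setT (EFin \o f x).
Proof.
apply: (@le_integrable _ _ _ m2 setT measurableT _ (fun y => (g1 x)%:E * (g2 y)%:E)%E).
- exact/measurable_EFinP.
- by move=> y _ /=; rewrite lee_fin [leRHS]ger0_norm ?mulr_ge0.
- by apply: integrableZl => //; exact: integrable_ge0_fin.
Qed.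

Let iy y : m1.-integrable setT (EFin \o f ^~ y).
Proof.
apply: (@le_integrable _ _ _ m1 setT measurableT _ (fun x => (g2 y)%:E * (g1 x)%:E)%E).
- exact/measurable_EFinP.
- by move=> x _ /=; rewrite lee_fin [leRHS]ger0_norm ?mulr_ge0// mulrC.
- by apply: integrableZl => //; exact: integrable_ge0_fin.
Qed.

Let intf : (m1 \x m2)%E.-integrable setT (fun p : T1 * T2 => (f p.1 p.2)%:E).
Proof.
apply/(integrable12ltyP _ _ mfE) => /=.
apply: (@le_lt_trans _ _ (\int[m1]_x ((g1 x)%:E * \int[m2]_y (g2 y)%:E))%E).
  apply: ge0_le_integral => //.
  - by move=> x _; exact: integral_ge0.
  - apply: (@measurable_fun_fubini_tonelli_F _ _ _ _ _ m2 (fun p => `|(f p.1 p.2)%:E|)%E) => //.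
    exact: measurableT_comp.
  - by apply: emeasurable_funM => //; exact/measurable_EFinP.
  - move=> x _; rewrite -ge0_integralZl//.
    + apply: ge0_le_integral => //.
      * by apply/measurable_EFinP; apply: measurableT_comp.
      * by apply: emeasurable_funM => //; exact/measurable_EFinP.
      * by move=> y _; rewrite -EFinM lee_fin.
    + exact/measurable_EFinP.
    + by move=> y _; rewrite lee_fin.
    + by rewrite lee_fin.
rewrite ge0_integralZr//.
- rewrite lte_mul_pinfty//; first by apply: integral_ge0 => x _; rewrite lee_fin.
  by rewrite ge0_fin_numE//; apply: integral_ge0 => x _; rewrite lee_fin.
- exact/measurable_EFinP.
- by move=> x _; rewrite lee_fin.
- by apply: integral_ge0 => x _; rewrite lee_fin.
Qed.

Let Ex x : (\int[m2]_y f x y)%:E = (\int[m2]_y (f x y)%:E)%E.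
Proof. by rewrite fineK//; exact: (integrable_fin_num _ (ix x)). Qed.

Let Ey y : (\int[m1]_x f x y)%:E = (\int[m1]_x (f x y)%:E)%E.
Proof. by rewrite fineK//; exact: (integrable_fin_num _ (iy y)). Qed.

Lemma measurable_Rintegral_r : measurable_fun setT (fun y => \int[m1]_x f x y).
Proof.
apply/measurable_EFinP; rewrite (_ : _ \o _ = fun y => (\int[m1]_x (f x y)%:E)%E).
  exact: (measurable_fubini_G intf).
exact/funext.
Qed.

Lemma Rintegral_fubini : \int[m1]_x \int[m2]_y f x y = \int[m2]_y \int[m1]_x f x y.
Proof.
have := Fubini intf => E; rewrite /Rintegral; congr fine.
transitivity (\int[m1]_x \int[m2]_y (f x y)%:E)%E.
  by apply: eq_integral => x _; exact: Ex.
by rewrite E; apply: eq_integral => y _; exact/esym/Ey.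
Qed.

End Rintegral_fubini.

(** * Compactly supported functions and their fractional Laplacian *)

Section compactly_supported.
Variables (R : realType) (n : nat).
Implicit Types f : 'rV[R]_n -> R.
Local Notation pd := (@partial_deriv R n).
Local Notation mu := (lebesgue_rV R n).

Definition smooth_cs f := smooth_on setT f /\
  exists2 r, 0 < r & forall x, r < enorm x -> f x = 0.

Lemma smooth_cs_foldr f l : smooth_cs f -> smooth_cs (foldr pd f l).
Proof.
move=> [sf [r r0 fr]]; split; first exact: smooth_foldr.
exists r => // x xr; pose U := [set x : 'rV[R]_n | r < enorm x].
have oU : open U.
  rewrite (_ : U = @enorm R n @^-1` [set t | r < t])//.
  by apply: open_comp; [move=> y _; exact: enorm_continuous|exact: open_gt].
have f0 y : U y -> f y = (fun=> 0) y by exact: fr.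
rewrite (eq_open_foldr l oU f0 xr).
elim: l => //= i l IH.
have -> : foldr pd (fun=> 0) l = fun=> 0.
  elim: l {IH} => //= j l ->; apply/funext => z; rewrite /partial_deriv; exact: derive_cst.
by rewrite /partial_deriv; exact: derive_cst.
Qed.

Lemma smooth_cs_bounded f : smooth_cs f -> exists2 K, 0 <= K & forall x, `|f x| <= K.
Proof.
move=> [sf [r r0 fr]].
pose A := [set x : 'rV[R]_n | `|x| <= r].
have cA : compact A.
  apply: bounded_closed_compact.
    exists r; split; first exact: num_real.
    by move=> M rM x /= xr; exact: le_trans (ltW rM).
  rewrite (_ : A = (fun x : 'rV[R]_n => `|x|) @^-1` [set t | t <= r])//.
  by apply: closed_comp; [move=> x _; exact: norm_continuous|exact: closed_le].
have cf : continuous (fun x => `|f x|).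
  move=> x; apply: continuous_comp; first exact: smooth_continuous.
  exact: norm_continuous.
have A0 : A 0 by rewrite /A/= normr0 ltW.
have [c Ac hc] := @EVT_max_rV _ _ (fun x => `|f x|) A (ex_intro _ 0 A0) cA (continuous_subspaceT cf).
exists `|f c| => // x; have [xr|xr] := leP (enorm x) r.
  by apply: hc; rewrite inE /A/=; exact: le_trans (norm_le_enorm x) xr.
by rewrite fr// normr0.
Qed.

Lemma smooth_cs_integral f : smooth_cs f -> (\int[mu]_x (`|f x|%R : R)%:E < +oo)%E.
Proof.
move=> sf; have [K K0 fK] := smooth_cs_bounded sf; have [sm [r r0 fr]] := sf.
have mf : measurable_fun setT f by apply: rV_continuous_measurable; exact: smooth_continuous.
apply: (@le_lt_trans _ _ (\int[mu]_x (K * \1_(eball 0 (r + 1)) x)%:E)%E).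
  apply: ge0_le_integral => //.
  - by apply/measurable_EFinP; exact: measurableT_comp.
  - apply/measurable_EFinP; apply: measurable_funM => //; apply: measurable_indic.
    exact: measurable_eball.
  - move=> x _; rewrite lee_fin indicE.
    have [xr|xr] := boolP (x \in eball 0 (r + 1)); first by rewrite mulr1.
    rewrite mulr0 fr ?normr0//; move: xr; rewrite notin_setE /eball/= subr0 => /negP.
    by rewrite -leNgt => h; apply: lt_le_trans h; rewrite ltrDl.
under eq_integral do rewrite EFinM.
rewrite ge0_integralZl//.
- rewrite integral_indic ?setIT//; last exact: measurable_eball.
  rewrite lte_mul_pinfty//; exact: eball_measure_fin.
- by apply/measurable_EFinP; apply: measurable_indic; exact: measurable_eball.
Qed.

End compactly_supported.

Section laplacian.
Variables (R : realType) (n : nat) (s : R).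
Hypotheses (n_gt0 : (0 < n)%N) (s_gt0 : 0 < s) (s_lt1 : s < 1).
Implicit Types f : 'rV[R]_n -> R.
Local Notation pd := (@partial_deriv R n).
Local Notation mu := (lebesgue_rV R n).
Local Notation p := (n%:R + 2 * s).
Local Notation kb := (kbound (n := n) s).
Local Notation w := (weight (n := n) s).

Let p_gt0 : 0 < p. Proof. by rewrite ltr_wpDl// mulr_gt0. Qed.

Definition diff2 f x y : R := 2 * f x - f (x + y) - f (x - y).

(* frac_laplacian without its normalizing constant. *)
Definition Lap f x : R := \int[mu]_y (diff2 f x y / enorm y `^ p).

Lemma measurable_diff2 d (T : measurableType d) f (a b : T -> 'rV[R]_n) :
  measurable_fun setT f -> measurable_fun setT a -> measurable_fun setT b ->
  measurable_fun setT (fun t => diff2 f (a t) (b t) / enorm (b t) `^ p).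
Proof.
move=> mf ma mb; apply: measurable_funM.
  apply: measurable_funB; last exact: (measurableT_comp mf (measurable_rVB ma mb)).
  apply: measurable_funB; last exact: (measurableT_comp mf (measurable_rVD ma mb)).
  by apply: measurable_funM => //; exact: measurableT_comp mf ma.
under eq_fun do rewrite -powRN.
apply: (measurableT_comp (measurable_powR (- p))).
exact: measurable_fun_enorm.
Qed.

Lemma measurable_smooth_cs f : smooth_cs f -> measurable_fun setT f.
Proof. by move=> [sf _]; apply: rV_continuous_measurable; exact: smooth_continuous. Qed.

Lemma integrable_kbound : mu.-integrable setT (EFin \o kb).
Proof.
apply: integrable_ge0_fin.
- exact: measurable_kbound.
- exact: kbound_ge0.
- exact: integral_kbound_fin.
Qed.

Lemma integrable_weight : mu.-integrable setT (EFin \o w).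
Proof.
apply: integrable_ge0_fin.
- exact: measurable_weight.
- by move=> x; rewrite ltW// weight_gt0.
- exact: integral_weight_fin.
Qed.

Lemma integrable_dominated (g h : 'rV[R]_n -> R) (C : R) : measurable_fun setT g ->
  mu.-integrable setT (EFin \o h) -> (forall x, `|g x| <= C * h x) ->
  mu.-integrable setT (EFin \o g).
Proof.
move=> mg ih gh; apply: (@le_integrable _ _ _ mu setT measurableT _ (fun x => C%:E * (h x)%:E)%E).
- exact/measurable_EFinP.
- by move=> x _ /=; rewrite lee_fin (le_trans (gh x))// ler_norm.
- exact: integrableZl.
Qed.

Lemma integrable_scale (C : R) (h : 'rV[R]_n -> R) : mu.-integrable setT (EFin \o h) ->
  mu.-integrable setT (EFin \o (fun x => C * h x)).
Proof.
move=> ih; apply: (@integrable_dominated _ (fun x => `|h x|) `|C|).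
- by apply: measurable_funM => //; case/integrableP : ih => /measurable_EFinP.
- exact: integrable_normr.
- by move=> x; rewrite normrM.
Qed.

(** The second-order bound [A |y|^2] serves for small [y], the sup bound [4 B] for large [y];
    [kbound] merges the two. *)
Lemma diff2_bound f : smooth_cs f -> exists2 C, 0 <= C &
  forall x y, `|diff2 f x y / enorm y `^ p| <= C * kb y.
Proof.
move=> sf; have [B B0 fB] := smooth_cs_bounded sf.
have /choice[K hK] : forall ij : 'I_n * 'I_n, exists K, 0 <= K /\ forall x, `|pd ij.2 (pd ij.1 f) x| <= K.
  move=> [i j]; have [K K0 h] := smooth_cs_bounded (smooth_cs_foldr [:: j; i] sf).
  by exists K.
pose A : R := 2 * n%:R ^+ 2 * \sum_ij K ij.
have SK0 : 0 <= \sum_ij K ij by apply: sumr_ge0 => ij _; exact: (hK ij).1.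
have A0 : 0 <= A by rewrite mulr_ge0// mulr_ge0// sqr_ge0.
exists (A + 4 * B) => [|x y]; first by rewrite addr_ge0// mulr_ge0.
apply: (@kbound_bound _ _ s A (4 * B) (diff2 f x)) => {}y.
- apply: second_difference_bound => //.
  + by move=> z i; exact: smooth_derivable sf.1.
  + by move=> z i j; apply: smooth_derivable; exact: smooth_partial sf.1.
  + move=> z i j; apply: (le_trans ((hK (i, j)).2 z)).
    by rewrite (bigD1 (i, j))//= lerDl; apply: sumr_ge0 => ij _; exact: (hK ij).1.
- rewrite /diff2; apply: (le_trans (ler_normB _ _)).
  apply: (@le_trans _ _ (2 * B + B + B)); last by lra.
  apply: lerD => //; apply: (le_trans (ler_normB _ _)); apply: lerD => //.
  by rewrite normrM ger0_norm// ler_wpM2l.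
Qed.

Lemma integrable_diff2 f x : smooth_cs f ->
  mu.-integrable setT (EFin \o (fun y => diff2 f x y / enorm y `^ p)).
Proof.
move=> sf; have [C C0 h] := diff2_bound sf.
apply: (@integrable_dominated _ kb C) => //; last exact: integrable_kbound.
by apply: measurable_diff2 => //; exact: measurable_smooth_cs.
Qed.

Let D f (l : seq 'I_n) (x y : 'rV[R]_n) := diff2 (foldr pd f l) x y / enorm y `^ p.

(** The majorant of [diff2_bound] does not depend on [x], so one may differentiate under the
    integral everywhere. The radius 1 chosen below is arbitrary. *)
Let D_smooth f : smooth_cs f ->
  (forall l, foldr pd (Lap f) l = Lap (foldr pd f l)) /\ smooth_on setT (Lap f).
Proof.
move=> sf.
have mD l x : measurable_fun setT (D f l x).
  by apply: measurable_diff2 => //; apply: measurable_smooth_cs; exact: smooth_cs_foldr.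
have dD l i x t : setT t ->
    is_derive x (delta_mx ord0 i) (fun x => D f l x t) (D f (i :: l) x t).
  move=> _; have sg := smooth_foldr l sf.1; rewrite /D /=; set g := foldr pd f l.
  have h0 z : is_derive z (delta_mx ord0 i) g (pd i g z) by exact/derivableP/smooth_derivable.
  have hs a : is_derive x (delta_mx ord0 i) (fun x => g (x + a)) (pd i g (x + a)).
    apply: DeriveDef; last exact: derive_shift_arg.
    by apply: (proj2 (derivable_shift_arg g a x _)); exact: smooth_derivable.
  have := is_deriveZ ((enorm t `^ p)^-1)
    (is_deriveB (is_deriveB (is_deriveZ (2 : R) (h0 x)) (hs t)) (hs (- t))).
  rewrite [X in is_derive _ _ _ X -> _]mulrC.
  set F := (X in is_derive _ _ X _ -> _).
  suff -> : F = (fun x0 => diff2 g x0 t / enorm t `^ p) by [].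
  by apply/funext => z; rewrite [RHS]mulrC.
have bD l x0 : exists2 g : _ -> R, mu.-integrable setT (EFin \o g) &
    exists2 eps : R, 0 < eps & forall x, `|x - x0| < eps -> forall t, setT t -> `|D f l x t| <= g t.
  have [C C0 h] := diff2_bound (smooth_cs_foldr l sf).
  exists (fun y => C * kb y); last by exists 1 => // x _ t _; exact: h.
  exact/integrable_scale/integrable_kbound.
split=> [l|]; first exact: (foldr_partial_integral measurableT mD dD bD l).
exact: (smooth_integral measurableT mD dD bD).
Qed.

Lemma foldr_Lap f l : smooth_cs f -> foldr pd (Lap f) l = Lap (foldr pd f l).
Proof. by move=> sf; have [+ _] := D_smooth sf; exact. Qed.

Lemma smooth_Lap f : smooth_cs f -> smooth_on setT (Lap f).
Proof. by move=> sf; have [_] := D_smooth sf. Qed.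

(** Once [|x| >= 2 r], [f x = 0] and [f] at [x + y] or [x - y] can be nonzero only for
    [|y| >= |x| / 2], where the kernel is at most [2^p |x|^(-p)]. What remains is two translated
    integrals of [|f|]. *)
Lemma Lap_bound f : smooth_cs f -> exists2 C, 0 < C & forall x, `|Lap f x| <= C * w x.
Proof.
move=> sf; have [C C0 hC] := diff2_bound sf.
have mf := measurable_smooth_cs sf.
have [_ [r r0 fr]] := sf.
have mnf : measurable_fun setT (fun x => `|f x|) by exact: measurableT_comp.
pose I := \int[mu]_x `|f x|; have I0 : 0 <= I by apply: Rintegral_ge0.
pose K1 := C * \int[mu]_y kb y.
have K10 : 0 <= K1 by rewrite mulr_ge0//; apply: Rintegral_ge0 => y _; exact: kbound_ge0.
pose K2 := 2 `^ p * (I + I).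
have K20 : 0 <= K2 by rewrite mulr_ge0 ?powR_ge0// addr_ge0.
have inD x : mu.-integrable setT (EFin \o (fun y => `|diff2 f x y / enorm y `^ p|)).
  exact: (integrable_normr (integrable_diff2 x sf)).
have h1 x : `|Lap f x| <= K1.
  apply: (le_trans (le_normr_Rintegral measurableT (integrable_diff2 x sf))).
  rewrite /K1 -RintegralZl//; last exact: integrable_kbound.
  apply: le_Rintegral => //; exact/integrable_scale/integrable_kbound.
have shint a : mu.-integrable setT (EFin \o (fun y => `|f (y + a)|)).
  apply: integrable_ge0_fin => //.
    apply: (measurableT_comp mnf).
    by apply: measurable_rVD => //; exact: measurable_cst.
  rewrite (@ge0_integral_rV_shift _ _ a (fun x => `|f x|%:E))//.
  - exact: smooth_cs_integral.
  - exact/measurable_EFinP.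
have shI a : \int[mu]_y `|f (y + a)| = I.
  exact: (@Rintegral_rV_shift _ _ a (fun x => `|f x|)).
have msh a : measurable_fun setT (fun y : 'rV[R]_n => `|f (y + a)|).
  by have /integrableP[/measurable_EFinP] := shint a.
have shintN a : mu.-integrable setT (EFin \o (fun y => `|f (- y + a)|)).
  apply: integrable_ge0_fin => //.
    exact: (measurableT_comp (msh a) (@measurable_rVN R n)).
  rewrite (@ge0_integral_rVN _ _ (fun y => `|f (y + a)|%:E))//; last exact/measurable_EFinP.
  by have /integrableP[_] := shint a; under eq_integral do rewrite /= normr_id.
have shIN a : \int[mu]_y `|f (- y + a)| = I.
  by rewrite (@Rintegral_rVN _ _ (fun y => `|f (y + a)|)).
have h2 x : 2 * r <= enorm x -> `|Lap f x| <= K2 * enorm x `^ (- p).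
  move=> xr; have x0 : 0 < enorm x by apply: lt_le_trans xr; rewrite mulr_gt0.
  have fx0 : f x = 0 by apply: fr; lra.
  apply: (le_trans (le_normr_Rintegral measurableT (integrable_diff2 x sf))).
  pose c := 2 `^ p * enorm x `^ (- p).
  have c0 : 0 <= c by rewrite mulr_ge0 ?powR_ge0.
  have ifD : mu.-integrable setT (EFin \o (fun y => `|f (y + x)| + `|f (- y + x)|)).
    exact: (integrableD measurableT (shint x) (shintN x)).
  apply: (@le_trans _ _ (\int[mu]_y (c * (`|f (y + x)| + `|f (- y + x)|)))).
    apply: le_Rintegral => //; first exact: integrable_scale.
    move=> y _; rewrite /diff2 fx0 mulr0 sub0r normrM.
    rewrite (ger0_norm (_ : 0 <= (enorm y `^ p)^-1)) ?invr_ge0 ?powR_ge0//.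
    rewrite (addrC x y) (addrC x (- y)).
    have [xy|xy] := leP (enorm x) (2 * enorm y).
      rewrite mulrC; apply: ler_pM => //; first by rewrite invr_ge0 powR_ge0.
        have y0 : 0 < enorm y by lra.
        rewrite /c (powRN (enorm x)) (ler_pdivlMr _ _ (powR_gt0 p x0)) mulrC.
        rewrite (ler_pdivrMr _ _ (powR_gt0 p y0)).
        rewrite -powRM ?enorm_ge0//.
        by apply: ge0_ler_powR; rewrite ?nnegrE ?(ltW p_gt0) ?mulr_ge0 ?enorm_ge0.
      by rewrite -opprD normrN ler_normD.
    have nr z : enorm z = enorm y -> f (z + x) = 0.
      move=> zy; apply: fr; have := ler_enormB x (- z).
      by rewrite opprK enormN zy (addrC x z); lra.
    rewrite !nr ?enormN// subr0 oppr0 normr0 mul0r addr0 mulr0//.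
  rewrite RintegralZl// RintegralD// shI shIN /c /K2.
  by rewrite mulrAC.
have K0 : 0 <= K1 + K2 by rewrite addr_ge0.
have r20 : 0 < 2 * r by rewrite mulr_gt0.
have [C' C'0 hC'] := weight_bound n s_gt0 r20 K0; exists C' => //; apply: hC'.
- by move=> x; apply: (le_trans (h1 x)); rewrite lerDl.
- move=> x /h2 h; apply: (le_trans h); rewrite ler_wpM2r ?powR_ge0//.
  by rewrite lerDr.
Qed.

Lemma Lap_scale f (c : R) x : smooth_cs f -> 0 < c ->
  Lap (fun x => f (c *: x)) x = c `^ (2 * s) * Lap f (c *: x).
Proof.
move=> sf c0; pose F y := diff2 f (c *: x) y / enorm y `^ p.
have iF : mu.-integrable setT (EFin \o F) by exact: integrable_diff2.
have mF : measurable_fun setT F by have /integrableP[/measurable_EFinP] := iF.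
have cp : c `^ p = c ^+ n * c `^ (2 * s).
  by rewrite powRD ?(gt_eqF c0) ?implybT// powR_mulrn// ltW.
have e1 : \int[mu]_y F (c *: y + 0) = c ^- n * Lap f (c *: x).
  exact: Rintegral_rV_affine.
have iFc : mu.-integrable setT (EFin \o (fun y => F (c *: y + 0))).
  have mFc : measurable_fun setT (fun y : 'rV[R]_n => F (c *: y + 0)).
    exact: (measurableT_comp mF (@measurable_affine R n c 0)).
  apply/integrableP; split; first exact/measurable_EFinP.
  rewrite (@ge0_integral_rV_affine _ _ c 0 (fun y => `|(F y)%:E|)%E)//; last first.
    have mFE : measurable_fun setT (EFin \o F) by exact/measurable_EFinP.
    exact: (measurableT_comp (@abse_measurable R setT) mFE).
  by rewrite lte_mul_pinfty//; [rewrite lee_fin invr_ge0 exprn_ge0// ltW|case/integrableP : iF].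
transitivity (c `^ p * \int[mu]_y F (c *: y + 0)); last first.
  by rewrite e1 cp mulrA [c ^+ n * _]mulrC mulfK// expf_neq0// gt_eqF.
rewrite -RintegralZl//; apply: eq_Rintegral => y _; rewrite /F /diff2 addr0 scalerDr scalerBr.
rewrite enormZ (gtr0_norm c0) powRM ?enorm_ge0 ?(ltW c0)//.
rewrite invfM [RHS]mulrCA; congr (_ * _).
by rewrite mulrA mulfV ?mul1r// gt_eqF ?powR_gt0.
Qed.

(** The reflection exchanging [x] and [y] preserves Lebesgue measure, the norm and the bump. *)
Lemma Lap_bump_radial x y : enorm x = enorm y -> Lap (@bump R n) x = Lap (@bump R n) y.
Proof.
move=> xy; rewrite -(refl_swap xy); set v := x - y.
have mb : measurable_fun setT (@bump R n) by apply: rV_continuous_measurable; exact/smooth_continuous/smooth_bump.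
rewrite /Lap -[RHS](Rintegral_refl v); last exact: measurable_diff2.
have reflN z : - refl v z = refl v (- z).
  have r0 : refl v 0 = 0 by apply: (addrI (refl v 0)); rewrite -reflD !addr0.
  by apply/esym/eqP; rewrite -addr_eq0 -reflD addNr r0.
apply: eq_Rintegral => z _; rewrite enorm_refl; congr (_ / _); rewrite /diff2.
rewrite reflN -!reflD; congr (_ * _ - _ - _); apply: bump_radial; rewrite enorm_refl//.
Qed.

Lemma smooth_cs_bump : smooth_cs (@bump R n).
Proof.
split; first exact: smooth_bump.
by exists 1 => // x /ltW; exact: bump_out.
Qed.

(** The bump is maximal at 0, so its second differences there are nonnegative. This sign is what
    finally makes [kernel_mass] positive. *)
Lemma Lap_bump0_gt0 : 0 < Lap (@bump R n) 0.
Proof.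
pose F (y : 'rV[R]_n) := diff2 (@bump R n) 0 y / enorm y `^ p.
have iF : mu.-integrable setT (EFin \o F) by apply: integrable_diff2; exact: smooth_cs_bump.
have F0 y : 0 <= F y.
  rewrite /F /diff2 add0r sub0r mulr_ge0// ?invr_ge0 ?powR_ge0//.
  have h1 := @bump_decr R n 0 y; have h2 := @bump_decr R n 0 (- y).
  rewrite enorm0 enorm_ge0 in h1; rewrite enorm0 enorm_ge0 in h2.
  by have := h1 isT; have := h2 isT; lra.
(* On the annulus 1 < |y| < 2 the integrand is bounded below. *)
pose U := [set y : 'rV[R]_n | 1 < enorm y] `&` eball 0 2.
have oU : open U.
  apply: openI; last exact: open_eball.
  rewrite (_ : [set y : 'rV[R]_n | 1 < enorm y] = @enorm R n @^-1` [set t | 1 < t])//.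
  by apply: open_comp; [move=> y _; exact: enorm_continuous|exact: open_gt].
have U0 : U !=set0.
  pose v : 'rV[R]_n := delta_mx ord0 (Ordinal n_gt0).
  exists ((3 / 2) *: v); rewrite /U /eball/= subr0 enormZ enorm_delta mulr1 ger0_norm; last by lra.
  by split; lra.
have mU : measurable U by exact: rV_open_measurable.
have Upos := open_measure_gt0 oU U0.
have Ufin : (mu U < +oo)%E.
  apply: le_lt_trans (@eball_measure_fin R n 0 2).
  by apply: le_measure; rewrite ?inE//; [exact: measurable_eball|exact: subIsetr].
pose c : R := 2 * @bump R n 0 / 2 `^ p.
have c0 : 0 < c by rewrite divr_gt0 ?powR_gt0// mulr_gt0// bump0_gt0.
apply: (@lt_le_trans _ _ (\int[mu]_y (c * \1_U y))).
  rewrite RintegralZl//; last exact: integrable_indic_fin.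
  rewrite mulr_gt0// /Rintegral integral_indic// setIT fine_gt0// Upos Ufin//.
apply: le_Rintegral => //.
  by apply: integrable_scale; exact: integrable_indic_fin.
move=> y _; rewrite indicE; have [|_] := boolP (y \in U); last by rewrite mulr0; exact: F0.
rewrite inE /U /eball/= subr0 => -[y1 y2]; rewrite mulr1 /F /diff2 add0r sub0r.
rewrite (@bump_out _ _ y) ?(ltW y1)// (@bump_out _ _ (- y)) ?enormN ?(ltW y1)// !subr0 /c ler_wpM2l//.
  by rewrite mulr_ge0// ltW// bump0_gt0.
rewrite lef_pV2 ?posrE ?powR_gt0//; last exact: lt_trans y1.
by apply: ge0_ler_powR; rewrite ?nnegrE ?enorm_ge0 ?(ltW p_gt0) ?(ltW y2).
Qed.

End laplacian.

(** * Integral over balls of the fractional Laplacian of the bump *)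

Section ball_integral.
Variables (R : realType) (n : nat) (s : R).
Hypotheses (n_gt0 : (0 < n)%N) (s_gt0 : 0 < s) (s_lt1 : s < 1).
Local Notation mu := (lebesgue_rV R n).
Local Notation p := (n%:R + 2 * s).
Local Notation kb := (kbound (n := n) s).
Local Notation eta := (@bump R n).
Local Notation h := (Lap s eta).
Local Notation B r := (eball (0 : 'rV[R]_n) r).

Let p_gt0 : 0 < p. Proof. by rewrite ltr_wpDl// mulr_gt0. Qed.

Let meta : measurable_fun setT eta.
Proof. by apply: measurable_smooth_cs; exact: smooth_cs_bump. Qed.

Let ieta : mu.-integrable setT (EFin \o eta).
Proof.
apply: integrable_ge0_fin => //; first exact: bump_ge0.
rewrite (eq_integral (fun x => (`|eta x| : R)%:E)).
  exact: smooth_cs_integral (@smooth_cs_bump R n).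
by move=> x _; rewrite ger0_norm// bump_ge0.
Qed.

Let mB r a : measurable_fun setT (fun x : 'rV[R]_n => \1_(B r) (x + a) : R).
Proof.
apply: (@measurableT_comp _ _ _ _ _ _ (\1_(B r) : 'rV[R]_n -> R)).
  by apply: measurable_indic; exact: measurable_eball.
by apply: measurable_rVD => //; exact: measurable_cst.
Qed.

Let iB r a : mu.-integrable setT (EFin \o (fun x : 'rV[R]_n => \1_(B r) (x + a) : R)).
Proof.
apply: integrable_ge0_fin => //.
rewrite (@ge0_integral_rV_shift _ _ a (fun x => (\1_(B r) x)%:E))//.
- rewrite integral_indic ?setIT//; [exact: eball_measure_fin|exact: measurable_eball].
- by apply/measurable_EFinP; apply: measurable_indic; exact: measurable_eball.
Qed.

Let iBeta r a : mu.-integrable setT (EFin \o (fun x : 'rV[R]_n => \1_(B r) (x + a) * eta x)).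
Proof.
apply: (@integrable_dominated _ _ _ eta 1) => //; first exact: measurable_funM.
move=> x; rewrite mul1r normrM (ger0_norm (bump_ge0 x)) ler_piMl ?bump_ge0//.
by rewrite indicE; case: (_ \in _); rewrite ?normr1 ?normr0.
Qed.

(* Bathtub principle: the centred ball captures the most mass of a radially
   decreasing function. *)
Let overlap r a := \int[mu]_x (\1_(B r) (x + a) * eta x).
Let mass r := \int[mu]_x (\1_(B r) x * eta x).

Let overlap_le r a : 0 < r -> overlap r a <= mass r.
Proof.
move=> r0; pose c : R := ebump 0 (1 - r ^+ 2).
have iB0 : mu.-integrable setT (EFin \o (\1_(B r) : 'rV[R]_n -> R)).
  by have := iB r 0; under eq_fun do rewrite addr0.
have iBe0 : mu.-integrable setT (EFin \o (fun x : 'rV[R]_n => \1_(B r) x * eta x)).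
  by have := iBeta r 0; under eq_fun do rewrite addr0.
have eqI : \int[mu]_x (\1_(B r) (x + a) : R) = \int[mu]_x (\1_(B r) x : R).
  apply: (@Rintegral_rV_shift _ _ a (\1_(B r) : 'rV[R]_n -> R)).
  by apply: measurable_indic; exact: measurable_eball.
have iBc b : mu.-integrable setT (EFin \o (fun x => \1_(B r) (x + b) * (eta x - c))).
  rewrite (_ : (fun _ => _) = (fun x => \1_(B r) (x + b) * eta x - c * \1_(B r) (x + b))).
    exact: (integrable_subr (iBeta r b) (integrable_scale c (iB r b))).
  by apply/funext => x; rewrite mulrBr (mulrC c).
(* [c] is the value of the bump on the sphere of radius [r], so [eta - c] is nonnegative in the ball
   and nonpositive outside: no other set gives it a larger integral. The subtracted [c] costs the
   same on both sides, as the two balls have equal volume. *)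
have key : \int[mu]_x (\1_(B r) (x + a) * (eta x - c)) <= \int[mu]_x (\1_(B r) x * (eta x - c)).
  have iBc0 : mu.-integrable setT (EFin \o (fun x => \1_(B r) x * (eta x - c))).
    by have := iBc 0; under eq_fun do rewrite addr0.
  apply: (le_Rintegral measurableT (iBc a) iBc0).
  - move=> x _; rewrite !indicE.
    have e1 : (x \in B r) = (enorm x < r) by apply/idP/idP; rewrite in_setE /eball/= subr0.
    have hom : enorm x <= r -> c <= eta x.
      move=> xr; apply: ebump_homo; rewrite lerD2l lerN2 -sqr_enorm.
      by rewrite ler_pXn2r ?nnegrE ?enorm_ge0// ltW.
    have hom' : r <= enorm x -> eta x <= c.
      move=> xr; apply: ebump_homo; rewrite lerD2l lerN2 -sqr_enorm.
      by rewrite ler_pXn2r ?nnegrE ?enorm_ge0// ltW.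
    rewrite e1; case: ltP => [/ltW/hom hc|/hom' hc]; case: (_ \in _); rewrite ?mul1r ?mul0r//.
      by rewrite subr_ge0.
    by rewrite subr_le0.
have split_int (g : 'rV[R]_n -> R) : mu.-integrable setT (EFin \o g) ->
    mu.-integrable setT (EFin \o (fun x => g x * eta x)) ->
    \int[mu]_x (g x * (eta x - c)) = \int[mu]_x (g x * eta x) - c * \int[mu]_x g x.
  move=> ig ige; under eq_Rintegral do rewrite mulrBr (mulrC _ c).
  by rewrite (RintegralB measurableT ige (integrable_scale c ig)) (RintegralZl c measurableT ig).
by rewrite /overlap /mass; move: key; rewrite (split_int _ (iB r a) (iBeta r a)) (split_int _ iB0 iBe0) eqI lerD2r.
Qed.

Definition ball_Lap r : R := \int[mu]_x (\1_(B r) x * h x).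

(** Once the integrals are exchanged, [ball_Lap r] is the integral in [y] of [S r y / |y|^p]; both
    its sign and its decay are read off [S]. *)
Let S r y := \int[mu]_x (\1_(B r) x * diff2 eta x y).

Let iBe0 r : mu.-integrable setT (EFin \o (fun x : 'rV[R]_n => \1_(B r) x * eta x)).
Proof. by have := iBeta r 0; under eq_fun do rewrite addr0. Qed.

Let shifted r a :
  mu.-integrable setT (EFin \o (fun x : 'rV[R]_n => \1_(B r) x * eta (x + a))) /\
  \int[mu]_x (\1_(B r) x * eta (x + a)) = overlap r (- a).
Proof.
split.
  apply: (@integrable_dominated _ _ _ (fun x => \1_(B r) (x + 0)) (eta 0)).
  - apply: measurable_funM; first by apply: measurable_indic; exact: measurable_eball.
    apply: (measurableT_comp meta).
    by apply: measurable_rVD => //; exact: measurable_cst.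
  - exact: iB.
  - move=> x; rewrite addr0 normrM (ger0_norm (bump_ge0 _)) mulrC ger0_norm//.
    by apply: ler_wpM2r => //; apply: bump_decr; rewrite enorm0 enorm_ge0.
rewrite /overlap -(@Rintegral_rV_shift _ _ a (fun x => \1_(B r) (x - a) * eta x)).
  by apply: eq_Rintegral => x _; rewrite addrK.
exact: measurable_funM.
Qed.

Let S_E r y : S r y = 2 * mass r - overlap r (- y) - overlap r y.
Proof.
have [i1 e1] := shifted r y; have [i2 e2] := shifted r (- y); rewrite opprK in e2.
rewrite -e1 -e2 /S /mass -(RintegralZl 2 measurableT (iBe0 r)).
have i3 := integrable_scale 2 (iBe0 r).
rewrite -(RintegralB measurableT i3 i1) -(RintegralB measurableT (integrable_subr i3 i1) i2).
by apply: eq_Rintegral => x _; rewrite /diff2; ring.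
Qed.

Let S_ge0 r y : 0 < r -> 0 <= S r y.
Proof.
move=> r0; rewrite S_E; have := overlap_le y r0; have := overlap_le (- y) r0.
by move: (overlap r y) (overlap r (- y)) (mass r) => a b c; lra.
Qed.

Let I := \int[mu]_x eta x.

Let S_le r y : S r y <= 2 * I.
Proof.
rewrite S_E; have h1 a : 0 <= overlap r a.
  by apply: Rintegral_ge0 => x _; rewrite mulr_ge0 ?bump_ge0.
have h2 : mass r <= I.
  apply: (le_Rintegral measurableT (iBe0 r) ieta) => x _.
  by rewrite ler_piMl ?bump_ge0// indicE; case: (x \in _).
have := h1 y; have := h1 (- y).
by move: (overlap r y) (overlap r (- y)) (mass r) (I) h2 => a b c d; lra.
Qed.

(** For such [y] the translated balls still contain the unit ball, outside which the bump vanishes,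
    so every overlap is the full integral [I]. *)
Let S_eq0 r y : enorm y <= r - 1 -> S r y = 0.
Proof.
move=> yr; rewrite S_E; have y0 := enorm_ge0 y.
have h1 a : enorm a <= r - 1 -> overlap r a = I.
  move=> ar; apply: eq_Rintegral => x _.
  have [x1|x1] := leP 1 (enorm x); first by rewrite bump_out// mulr0.
  rewrite indicE mem_set ?mul1r// /eball/= subr0.
  by have := ler_enormD x a; lra.
have -> : mass r = I.
  rewrite -(h1 0); last by rewrite enorm0; lra.
  by apply: eq_Rintegral => x _; rewrite addr0.
by rewrite !h1 ?enormN//; ring.
Qed.

Let F r x y : R := \1_(B r) x * (diff2 eta x y / enorm y `^ p).

Let F_fubini r :
  \int[mu]_x \int[mu]_y F r x y = \int[mu]_y \int[mu]_x F r x y /\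
  measurable_fun setT (fun y => \int[mu]_x F r x y).
Proof.
have [C C0 hC] := diff2_bound s (@smooth_cs_bump R n).
have mb : measurable_fun setT (\1_(B r) : 'rV[R]_n -> R).
  by apply: measurable_indic; exact: measurable_eball.
have mF : measurable_fun setT (fun z : 'rV[R]_n * 'rV[R]_n => F r z.1 z.2).
  apply: measurable_funM; first exact: (measurableT_comp mb).
  exact: measurable_diff2.
have mkb : measurable_fun setT (fun y => C * kb y).
  by apply: measurable_funM => //; exact: measurable_kbound.
have b0 x : 0 <= (\1_(B r) x : R) by rewrite indicE.
have k0 y : 0 <= C * kb y by rewrite mulr_ge0// kbound_ge0.
have bfin : (\int[mu]_x (\1_(B r) x : R)%:E < +oo)%E.
  by rewrite integral_indic ?setIT//; [exact: eball_measure_fin|exact: measurable_eball].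
have kfin : (\int[mu]_y (C * kb y)%:E < +oo)%E.
  have /integrableP[_] := integrable_scale C (integrable_kbound n_gt0 s_gt0 s_lt1).
  by under eq_integral do rewrite /= ger0_norm//.
have FC x y : `|F r x y| <= \1_(B r) x * (C * kb y).
  by rewrite normrM (ger0_norm (b0 x)) ler_wpM2l.
split; first exact: (Rintegral_fubini mF mb mkb b0 k0 bfin kfin FC).
exact: (measurable_Rintegral_r mF mb mkb b0 k0 bfin kfin FC).
Qed.

Let F_E r y : \int[mu]_x F r x y = S r y / enorm y `^ p.
Proof.
rewrite /S /F; under eq_Rintegral do rewrite mulrA.
rewrite RintegralZr//.
apply: (@integrable_dominated _ _ _ (fun x => \1_(B r) (x + 0)) (4 * eta 0)).
- apply: measurable_funM; first by apply: measurable_indic; exact: measurable_eball.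
  have ms a : measurable_fun setT (fun x : 'rV[R]_n => eta (x + a)).
    apply: (measurableT_comp meta).
    by apply: measurable_rVD => //; exact: measurable_cst.
  have msy : measurable_fun setT (fun x : 'rV[R]_n => eta (x - y)) by exact: ms.
  by apply: measurable_funB => //; apply: measurable_funB => //; exact: measurable_funM.
- exact: iB.
- have eb z : 0 <= eta z <= eta 0.
    by rewrite bump_ge0/= bump_decr// enorm0 enorm_ge0.
  move=> x; have b0 : 0 <= (\1_(B r) x : R) by rewrite indicE.
  rewrite addr0 normrM (ger0_norm b0) mulrC ler_wpM2r// /diff2.
  have /andP[a1 a2] := eb x; have /andP[b1 b2] := eb (x + y); have /andP[c1 c2] := eb (x - y).
  by rewrite ler_norml; apply/andP; split; lra.
Qed.

Let ball_Lap_swap r : ball_Lap r = \int[mu]_y (S r y / enorm y `^ p).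
Proof.
transitivity (\int[mu]_x \int[mu]_y F r x y).
  apply: eq_Rintegral => x _; rewrite RintegralZl//.
  exact: (integrable_diff2 n_gt0 s_gt0 s_lt1 x (@smooth_cs_bump R n)).
by rewrite (F_fubini r).1; apply: eq_Rintegral => y _; exact: F_E.
Qed.

Lemma ball_Lap_ge0 r : 0 < r -> 0 <= ball_Lap r.
Proof.
move=> r0; rewrite ball_Lap_swap; apply: Rintegral_ge0 => y _.
by rewrite divr_ge0 ?powR_ge0// S_ge0.
Qed.

Let q (y : 'rV[R]_n) : R := \1_[set t : R | 1 <= t] (enorm y) * enorm y `^ (- p).

Let mq : measurable_fun setT q.
Proof.
apply: (measurableT_comp (f := fun t : R => \1_[set t : R | 1 <= t] t * t `^ (- p))); last exact: measurable_enorm.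
apply: measurable_funM; last exact: measurable_powR.
apply: measurable_indic; rewrite (_ : [set t | _] = `[1, +oo[%classic); first exact: measurable_itv.
by apply/seteqP; split=> t /=; rewrite in_itv/= andbT.
Qed.

Let iq : mu.-integrable setT (EFin \o q).
Proof.
apply: integrable_ge0_fin => //; first by move=> y; rewrite mulr_ge0 ?powR_ge0.
apply: (@radial_integral_fin _ _ n_gt0 (fun t : R => \1_[set t : R | 1 <= t] t * t `^ (- p)) 1 0 p) => //.
- apply: measurable_funM; last exact: measurable_powR.
  apply: measurable_indic; rewrite (_ : [set t | _] = `[1, +oo[%classic); first exact: measurable_itv.
  by apply/seteqP; split=> t /=; rewrite in_itv/= andbT.
- by move=> t; rewrite mulr_ge0 ?powR_ge0.
- by rewrite oppr_lt0 ltr0n.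
- by rewrite ltrDl mulr_gt0.
- move=> t /andP[t0 t1]; rewrite powRr0 mulr1 indicE.
  have [->|tn1] := eqVneq t 1; first by rewrite powR1/= mulr1; case: (_ \in _).
  rewrite memNset ?mul0r//= => h; move: tn1; by rewrite eq_le t1 h.
- by move=> t t1; rewrite mul1r indicE mem_set// mul1r.
Qed.

(** Since [r >= 2], [r / 2 <= r - 1]; hence [S r y] vanishes for [|y| < r / 2], and elsewhere it is
    at most [2 * I]. A dilation by [t = r / 2] reduces the integral of [|y|^(-p)] over [|y| >= t] to
    the constant [J] times [t^(-2s)]. *)
Lemma ball_Lap_le : exists2 C, 0 <= C & forall r, 2 <= r -> ball_Lap r <= C * r `^ (- (2 * s)).
Proof.
have I0 : 0 <= I by apply: Rintegral_ge0 => x _; exact: bump_ge0.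
pose J := \int[mu]_y q y.
have q0 y : 0 <= q y by rewrite mulr_ge0 ?powR_ge0.
have J0 : 0 <= J by apply: Rintegral_ge0.
exists (2 * I * J * 2 `^ (2 * s)); first by rewrite !mulr_ge0 ?powR_ge0.
move=> r r2; rewrite ball_Lap_swap; pose t := r / 2.
have r0 : 0 < r by lra.
have t0 : 0 < t by rewrite divr_gt0.
have ti0 : 0 < t^-1 by rewrite invr_gt0.
have iqt : mu.-integrable setT (EFin \o (fun y => q (t^-1 *: y + 0))).
  have mqt : measurable_fun setT (fun y : 'rV[R]_n => q (t^-1 *: y + 0)).
    exact: (measurableT_comp mq (@measurable_affine R n t^-1 0)).
  have mqE : measurable_fun setT (EFin \o q) by exact/measurable_EFinP.
  apply: (integrable_ge0_fin mqt) => [y|]; first exact: q0.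
  rewrite (@ge0_integral_rV_affine _ _ t^-1 0 (fun y => (q y)%:E) ti0); last 2 first.
  - exact: mqE.
  - by move=> y; rewrite lee_fin q0.
  rewrite lte_mul_pinfty//; first by rewrite lee_fin invr_ge0 exprn_ge0// ltW.
  by have /integrableP[_] := iq; under eq_integral do rewrite /= ger0_norm//.
have e1 : \int[mu]_y q (t^-1 *: y + 0) = t ^+ n * J.
  by rewrite Rintegral_rV_affine// exprVn invrK.
have Sq y : S r y / enorm y `^ p <= (2 * I * t `^ (- p)) * q (t^-1 *: y + 0).
  have [yt|yt] := leP t (enorm y).
    rewrite /q addr0 enormZ gtr0_norm// indicE mem_set/=; last by rewrite mulrC ler_pdivlMr// mul1r.
    have e2 : (t^-1 * enorm y) `^ (- p) = t `^ p * (enorm y `^ p)^-1.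
      rewrite powRM ?enorm_ge0 ?(ltW ti0)// powRN; congr (_ * _); last exact: powRN.
      by rewrite -powRN -powR_inv1 ?(ltW t0)// -powRrM mulN1r opprK.
    rewrite mul1r e2 (powRN t) mulrA -(mulrA (2 * I)) mulVf ?gt_eqF ?powR_gt0// mulr1.
    by rewrite ler_wpM2r ?invr_ge0 ?powR_ge0.
  rewrite S_eq0 ?mul0r; last by move: yt; rewrite /t; lra.
  by rewrite !mulr_ge0 ?powR_ge0.
have iqt' := integrable_scale (2 * I * t `^ (- p)) iqt.
apply: (@le_trans _ _ (\int[mu]_y ((2 * I * t `^ (- p)) * q (t^-1 *: y + 0)))).
  apply: le_Rintegral => //.
  apply: (@integrable_dominated _ _ _ (fun y => (2 * I * t `^ (- p)) * q (t^-1 *: y + 0)) 1) => //.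
    by have [_ mS] := F_fubini r; under eq_fun do rewrite -F_E.
  by move=> y; rewrite mul1r ger0_norm// divr_ge0 ?powR_ge0// S_ge0.
rewrite RintegralZl// e1.
have -> : t `^ (- p) = t ^- n * t `^ (- (2 * s)).
  by rewrite opprD powRD ?(gt_eqF t0) ?implybT// powR_invn// ltW.
have -> : t `^ (- (2 * s)) = 2 `^ (2 * s) * r `^ (- (2 * s)).
  rewrite /t powRM ?(ltW r0)// mulrC; congr (_ * _).
  by rewrite -powR_inv1// -powRrM mulN1r opprK.
rewrite le_eqVlt; apply/orP; left; apply/eqP; move: (2 `^ (2 * s)) (r `^ _) => a b.
have : t ^+ n != 0 by rewrite expf_neq0// gt_eqF.
by move: (t ^+ n) => T T0; field.
Qed.

End ball_integral.

(** * The kernel averaged over scales *)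

Section avg_kernel.
Variables (R : realType) (n : nat) (s : R).
Hypotheses (n_gt0 : (0 < n)%N) (s_gt0 : 0 < s) (s_lt1 : s < 1).
Local Notation pd := (@partial_deriv R n).
Local Notation mu := (lebesgue_rV R n).
Local Notation leb := (@lebesgue_measure R).
Local Notation p := (n%:R + 2 * s).
Local Notation w := (weight (n := n) s).

Local Notation h := (Lap s (@bump R n)).
Local Notation e i := (delta_mx ord0 i : 'rV[R]_n).
Local Notation rt t := (t `^ n%:R^-1).
Implicit Types (N : R) (x : 'rV[R]_n) (l : seq 'I_n).

Let p_gt0 : 0 < p. Proof. by rewrite ltr_wpDl// mulr_gt0. Qed.

Let n0 : 0 < n%:R :> R. Proof. by rewrite ltr0n. Qed.

(* With t = r^n, the integral of r^(n-1) h(r x) over 0 < r <= N^(1/n), up to the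
   factor n. *)
Definition avg_kernel N x : R := \int[leb]_(t in `]0, N]) h (rt t *: x).

Let D l x (t : measurableTypeR R) : R := rt t ^+ size l * foldr pd h l (rt t *: x).

Let h_bound l : exists2 C : R, 0 < C & forall x, `|foldr pd h l x| <= C * w x.
Proof.
have sb := smooth_cs_foldr l (@smooth_cs_bump R n).
have [C C0 hC] := Lap_bound n_gt0 s_gt0 s_lt1 sb; exists C => // x.
by rewrite (foldr_Lap n_gt0 s_gt0 s_lt1 l (@smooth_cs_bump R n)).
Qed.

Let smooth_h : smooth_on setT h.
Proof. exact: (smooth_Lap n_gt0 s_gt0 s_lt1 (@smooth_cs_bump R n)). Qed.

Let measurable_rt : measurable_fun setT (fun t : measurableTypeR R => rt t).
Proof. exact: measurable_powR. Qed.

Let mD l x (A : set (measurableTypeR R)) : measurable_fun A (D l x : measurableTypeR R -> R).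
Proof.
apply: measurable_funTS; apply: measurable_funM.
  exact: (measurableT_comp (exprn_measurable _) measurable_rt).
apply: (measurableT_comp (f := foldr pd h l)).
  by apply: rV_continuous_measurable; apply: smooth_continuous; exact: smooth_foldr.
by apply: measurable_rVZ => //; exact: measurable_cst.
Qed.

Let dD l i x (t : R) : is_derive x (e i) (fun x => D l x t) (D (i :: l) x t).
Proof.
have dg : derivable (foldr pd h l) (rt t *: x) (e i).
  by apply: smooth_derivable; exact: smooth_foldr.
have := is_deriveZ (rt t ^+ size l) (is_derive_scale_arg dg).
rewrite /GRing.scale/= mulrA -exprSr; exact.
Qed.

Let rt_le N (t : R) : 0 < t -> t <= N -> rt t <= rt N.
Proof.
move=> t0 tN; apply: ge0_ler_powR; rewrite ?nnegrE ?invr_ge0 ?(ltW n0) ?(ltW t0)//.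
exact/ltW/(lt_le_trans t0).
Qed.

Let D_bound l N : exists2 C : R, 0 <= C & forall x (t : R), 0 < t -> t <= N -> `|D l x t| <= C.
Proof.
have [C C0 hC] := h_bound l.
exists (rt N ^+ size l * C) => [|x t t0 tN]; first by rewrite mulr_ge0 ?exprn_ge0 ?powR_ge0 ?(ltW C0).
rewrite normrM ger0_norm ?exprn_ge0 ?powR_ge0//; apply: ler_pM => //.
- by rewrite exprn_ge0 ?powR_ge0.
- by rewrite lerXn2r ?nnegrE ?powR_ge0// rt_le.
- by rewrite (le_trans (hC _))// -[leRHS]mulr1 ler_pM2l// weight_le1.
Qed.

Let mI N : @measurable _ (measurableTypeR R) `]0, N]%classic.
Proof. exact: measurable_itv. Qed.

Let icst N (C : R) : leb.-integrable `]0, N] (EFin \o (fun=> C) : measurableTypeR R -> \bar R).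
Proof.
apply/integrableP; split; first exact/measurable_EFinP.
rewrite integral_cst//; apply: lte_mul_pinfty => //.
by rewrite [X in (X < _)%E]lebesgue_measure_itv/=; case: ifP => _; rewrite ?oppr0 ?addr0 ltry.
Qed.

Let bD N l x0 : exists2 g : measurableTypeR R -> R, leb.-integrable `]0, N] (EFin \o g) &
  exists2 eps, 0 < eps & forall x, `|x - x0| < eps -> forall t : R, `]0, N]%classic t -> `|D l x t| <= g t.
Proof.
have [C C0 hC] := D_bound l N; exists (fun=> C); first exact: icst.
by exists 1 => // x _ t; rewrite /= in_itv/= => /andP[t0 tN]; exact: hC.
Qed.

Let kernelE N : avg_kernel N = fun x => \int[leb]_(t in `]0, N]) D [::] x t.
Proof.
by apply/funext => x; apply: eq_Rintegral => t _; rewrite /D expr0 mul1r.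
Qed.

Let foldr_kernel N l :
  foldr pd (avg_kernel N) l = fun x => \int[leb]_(t in `]0, N]) D l x t.
Proof.
rewrite kernelE.
have mB := @mI N.
have H := @foldr_partial_integral _ (measurableTypeR R) R leb `]0, N]%classic n D mB (fun l x => @mD l x _) (fun l i x t _ => dD l i x t).
exact: (H (bD N)).
Qed.

Lemma smooth_kernel N : smooth_on setT (avg_kernel N).
Proof.
rewrite kernelE.
have mB := @mI N.
have H := @smooth_integral _ (measurableTypeR R) R leb `]0, N]%classic n D mB (fun l x => @mD l x _) (fun l i x t _ => dD l i x t).
exact: (H (bD N)).
Qed.

Let iD N l x : leb.-integrable `]0, N] (EFin \o D l x : measurableTypeR R -> \bar R).
Proof.
have mB := @mI N.
have H := @integrable_param _ (measurableTypeR R) R leb `]0, N]%classic n D mB (fun l x => @mD l x _).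
exact: (H (bD N)).
Qed.

Lemma kernel_bounded N : exists2 C : R, 0 <= C & forall x, `|avg_kernel N x| <= C.
Proof.
have [C C0 hC] := D_bound [::] N.
exists (\int[leb]_(t in `]0, N]) (C : R)) => [|x]; first exact: Rintegral_ge0.
rewrite kernelE.
apply: (le_trans (@le_normr_Rintegral _ _ R leb _ (D [::] x) (@mI N) (iD N [::] x))).
apply: le_Rintegral => //.
- apply: (le_integrable _ _ _ (iD N [::] x)) => //.
    by apply/measurable_EFinP; apply: measurableT_comp => //; exact: mD.
  by move=> t _ /=; rewrite normr_id.
- by move=> t; rewrite /= in_itv/= => /andP[t0 tN]; exact: hC.
Qed.

Lemma integrable_kernel_slice N x :
  leb.-integrable `]0, N] (EFin \o (fun t : measurableTypeR R => h (rt t *: x))).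
Proof.
have := iD N [::] x; apply: eq_integrable => // t _ /=.
by rewrite /D expr0 mul1r.
Qed.

Let weight_scale (c : R) x : 0 < c -> 0 < enorm x -> w (c *: x) <= c `^ (- p) * enorm x `^ (- p).
Proof.
move=> c0 x0; rewrite -powRM ?(ltW c0) ?(ltW x0)// /weight enormZ gtr0_norm// powRN.
rewrite lef_pV2 ?posrE ?powR_gt0 ?mulr_gt0//; last by rewrite ltr_pwDl// powR_ge0.
by rewrite lerDr.
Qed.

(* Beyond order 2s the decay of h survives the integration in t. *)
Lemma kernel_bound2 N l : 0 < N -> (2 <= size l)%N ->
  exists2 C : R, 0 < C & forall x, `|foldr pd (avg_kernel N) l x| <= C * w x.
Proof.
move=> N0 l2; have [C C0 hC] := h_bound l.
have [C1 C10 hC1] := D_bound l N.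
(* The integrand is at most [C * t^(size l / n) * (t^(1/n) |x|)^(-p)], and [a] is its exponent in
   [t]. It exceeds -1 because [size l >= 2 > 2 s]. *)
pose a : R := ((size l)%:R - p) / n%:R.
have a1 : -1 < a.
  rewrite ltr_pdivlMr// mulN1r.
  have l2' : (2 : R) <= (size l)%:R by rewrite ler_nat.
  by move: ((size l)%:R : R) (n%:R : R) l2' s_lt1 => b1 b2; lra.
have ipow : leb.-integrable `]0, N] (EFin \o (fun t : measurableTypeR R => C * t `^ a)).
  have mpow A : measurable_fun A (fun t : measurableTypeR R => t `^ a).
    by apply: measurable_funTS; exact: measurable_powR.
  apply/integrableP; split.
    by apply/measurable_EFinP; exact: measurable_funM.
  rewrite (eq_integral (fun t : measurableTypeR R => C%:E * (t `^ a)%:E)%E) => [|t _]; last first.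
    by rewrite /= ger0_norm// mulr_ge0 ?powR_ge0 ?(ltW C0).
  rewrite ge0_integralZl//; last 3 first.
    exact/measurable_EFinP.
    by move=> t _; rewrite lee_fin powR_ge0.
    by rewrite lee_fin ltW.
  by apply: lte_mul_pinfty; rewrite ?lee_fin ?(ltW C0)//; exact: integral_powR_near0.
pose J := \int[leb]_(t in `]0, N]) (C * t `^ a).
pose K1 := \int[leb]_(t in `]0, N]) (C1 : R).
have J0 : 0 <= J by apply: Rintegral_ge0 => t _; rewrite mulr_ge0 ?powR_ge0 ?(ltW C0).
have K10 : 0 <= K1 by apply: Rintegral_ge0.
have JK0 : 0 <= J + K1 by rewrite addr_ge0.
have [C' C'0 hC'] := weight_bound n s_gt0 ltr01 JK0; exists C' => //.
have inD x : leb.-integrable `]0, N] (EFin \o (fun t : measurableTypeR R => `|D l x t|)).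
  apply: (le_integrable _ _ _ (iD N l x)) => //.
    by apply/measurable_EFinP; apply: measurableT_comp => //; exact: mD.
  by move=> t _ /=; rewrite normr_id.
have mB := @mI N.
have nD x : `|\int[leb]_(t in `]0, N]) D l x t| <= \int[leb]_(t in `]0, N]) `|D l x t|.
  exact: (@le_normr_Rintegral _ _ R leb _ (D l x) mB (iD N l x)).
apply: hC' => [x|x x1]; rewrite foldr_kernel.
  apply: (le_trans (nD x)).
  apply: (@le_trans _ _ K1); last by rewrite lerDr.
  apply: le_Rintegral => // t; rewrite /= in_itv/= => /andP[t0 tN]; exact: hC1.
apply: (le_trans (nD x)).
apply: (@le_trans _ _ (J * enorm x `^ (- p))); last by rewrite ler_wpM2r ?powR_ge0// lerDl.
rewrite mulrC /J -RintegralZl//.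
have ipow' : leb.-integrable `]0, N] (EFin \o (fun t : measurableTypeR R => enorm x `^ (- p) * (C * t `^ a))).
  have := integrableZl mB (enorm x `^ (- p)) ipow.
  by apply: eq_integrable.
apply: le_Rintegral => // t; rewrite /= in_itv/= => /andP[t0 tN].
have x0 : 0 < enorm x by exact: lt_le_trans x1.
have c0 : 0 < rt t by rewrite powR_gt0.
rewrite normrM ger0_norm ?exprn_ge0 ?powR_ge0//.
apply: (@le_trans _ _ (rt t ^+ size l * (C * (rt t `^ (- p) * enorm x `^ (- p))))).
  apply: ler_wpM2l; first by rewrite exprn_ge0 ?powR_ge0.
  by apply: (le_trans (hC _)); rewrite ler_pM2l// weight_scale.
have -> : t `^ a = rt t ^+ size l * rt t `^ (- p).
  rewrite -powR_mulrn ?powR_ge0// -powRD ?(gt_eqF c0) ?implybT//.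
  by rewrite -powRrM mulrC.
by rewrite le_eqVlt; apply/orP; left; apply/eqP; ring.
Qed.

End avg_kernel.

(** * The kernel as a ball integral *)

Section kernel_radial.
Variables (R : realType) (n : nat) (s : R).
Hypotheses (n_gt0 : (0 < n)%N) (s_gt0 : 0 < s) (s_lt1 : s < 1).
Local Notation mu := (lebesgue_rV R n).
Local Notation leb := (@lebesgue_measure R).
Local Notation p := (n%:R + 2 * s).
Local Notation h := (Lap s (@bump R n)).
Local Notation rt t := (t `^ n%:R^-1).
Local Notation K := (avg_kernel (n := n) s).
Local Notation cn := (ball_vol R n).
Implicit Types (N : R) (x : 'rV[R]_n).

Let n0 : 0 < n%:R :> R. Proof. by rewrite ltr0n. Qed.

Let measurable_rt : measurable_fun setT (fun t : measurableTypeR R => rt t : measurableTypeR R).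
Proof. exact: measurable_powR. Qed.

Lemma polar_Rintegral (G : R -> R) : measurable_fun setT G ->
  \int[mu]_x G (enorm x) = cn * \int[leb]_(u in `]0%R, +oo[) G (rt u).
Proof.
move=> mG; have cn0 := @ball_vol_gt0 R n.
have mE : measurable_fun setT (EFin \o G) by exact/measurable_EFinP.
have e1 := polar_integral n_gt0 (measurable_funepos mE) (fun t => funepos_ge0 (EFin \o G) t).
have e2 := polar_integral n_gt0 (measurable_funeneg mE) (fun t => funeneg_ge0 (EFin \o G) t).
rewrite /Rintegral [in LHS]integralE [in RHS]integralE.
rewrite [X in fine (X - _)%E](_ : _ = cn%:E * \int[leb]_(u in `]0%R, +oo[) (fun u => (EFin \o G)^\+ (rt u)) u)%E; last first.
  by rewrite -e1; apply: eq_integral => t _; rewrite !funeposE.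
rewrite [X in fine (_ - X)%E](_ : _ = cn%:E * \int[leb]_(u in `]0%R, +oo[) (fun u => (EFin \o G)^\- (rt u)) u)%E; last first.
  by rewrite -e2; apply: eq_integral => t _; rewrite !funenegE.
rewrite [X in _ = _ * fine (X - _)%E](_ : _ = \int[leb]_(u in `]0%R, +oo[) (fun u => (EFin \o G)^\+ (rt u)) u)%E; last first.
  by apply: eq_integral => t _; rewrite !funeposE.
rewrite [X in _ = _ * fine (_ - X)%E](_ : _ = \int[leb]_(u in `]0%R, +oo[) (fun u => (EFin \o G)^\- (rt u)) u)%E; last first.
  by apply: eq_integral => t _; rewrite !funenegE.
have : (0 <= \int[leb]_(u in `]0%R, +oo[) (fun u => (EFin \o G)^\+ (rt u)) u)%E by exact: integral_ge0.
have : (0 <= \int[leb]_(u in `]0%R, +oo[) (fun u => (EFin \o G)^\- (rt u)) u)%E by exact: integral_ge0.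
case: (integral _ _ _) => [a||]; case: (integral _ _ _) => [b||]//= _ _.
- by rewrite mulrBr.
- by rewrite gt0_muley ?lte_fin//= mulr0.
- by rewrite gt0_muley ?lte_fin//= mulr0.
- by rewrite gt0_muley ?lte_fin//= mulr0.
Qed.

Let v : 'rV[R]_n := delta_mx ord0 (Ordinal n_gt0).

Let H (t : R) : R := h (t *: v).

Let HE x : h x = H (enorm x).
Proof.
by apply: Lap_bump_radial; rewrite enormZ enorm_delta mulr1 ger0_norm// enorm_ge0.
Qed.

Let mH : measurable_fun setT (H : measurableTypeR R -> R).
Proof.
apply: (measurableT_comp (f := h)); last first.
  by apply: measurable_rVZ => //; exact: measurable_cst.
apply: rV_continuous_measurable; apply: smooth_continuous.
exact: (smooth_Lap n_gt0 s_gt0 s_lt1 (@smooth_cs_bump R n)).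
Qed.

(* In polar coordinates, averaging h over the scales below N^(1/n) at the point x is
   integrating it over the ball of radius N^(1/n) |x|. *)
Lemma kernel_ball N x : 0 < N -> x != 0 ->
  cn * enorm x ^+ n * K N x = ball_Lap n s (rt N * enorm x).
Proof.
move=> N0 x0; have r0 : 0 < enorm x by rewrite enorm_gt0.
have rN0 : 0 < rt N by rewrite powR_gt0.
pose r := rt N * enorm x; have r_gt0 : 0 < r by rewrite mulr_gt0.
pose A : set (measurableTypeR R) := `]-oo, r[%classic.
pose G (t : measurableTypeR R) : R := \1_A t * H t.
have mA : measurable A by exact: measurable_itv.
have mG : measurable_fun setT G by apply: measurable_funM => //; exact: measurable_indic.
have -> : ball_Lap n s r = \int[mu]_x G (enorm x).
  apply: eq_Rintegral => y _; rewrite HE /G; congr (_ * _); rewrite !indicE.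
  congr (nat_of_bool _)%:R; apply/idP/idP; rewrite !in_setE /A /eball/= subr0 in_itv//=.
rewrite polar_Rintegral// -mulrA; congr (_ * _).
pose Phi (u : measurableTypeR R) : R := \1_(`]0%R, +oo[%classic) u * G (rt u).
have mPhi : measurable_fun setT Phi.
  apply: measurable_funM; first by apply: measurable_indic; exact: measurable_itv.
  exact: (measurableT_comp mG measurable_rt).
have a0 : 0 < enorm x ^+ n by rewrite exprn_gt0.
(* Substitution [u = |x|^n t] in the radial variable: it turns [rt u] into [rt t * |x|]. *)
have sc := @Rintegral_comp_scaling _ (measurableTypeR R) R leb
  (fun t : measurableTypeR R => (enorm x ^+ n * t + 0)%R : measurableTypeR R) (enorm x ^- n).
have {}sc : \int[leb]_t Phi (enorm x ^+ n * t + 0) = enorm x ^- n * \int[leb]_t Phi t.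
  apply: sc => //; first by rewrite invr_gt0.
    by apply: measurable_funD => //; exact: measurable_funM.
  by move=> B mB; exact: lebesgue_measure_affine.
rewrite [RHS]Rintegral_indic_mul -/(Phi) -[RHS](mulVKf (lt0r_neq0 a0)) -sc; congr (_ * _).
have ik : leb.-integrable `]0, N[ (EFin \o (fun t : measurableTypeR R => h (rt t *: x))).
  apply: (integrableS _ _ _ (integrable_kernel_slice n_gt0 s_gt0 s_lt1 N x)).
  - exact: measurable_itv.
  - exact: measurable_itv.
  - by move=> t; rewrite /= !in_itv/= => /andP[-> /ltW].
(* The end point [N] is dropped so that the interval matches the open ball. *)
rewrite /avg_kernel -Rintegral_itv_bndo_bndc// Rintegral_indic_mul.
apply: eq_Rintegral => t _; rewrite /Phi /G addr0.
have [t0|t0] := ltP 0 t; last first.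
  have f1 : (\1_(`]0%R, N[%classic) t : R) = 0.
    by rewrite indicE memNset//= in_itv/= ltNge t0.
  have f2 : (\1_(`]0%R, +oo[%classic) (enorm x ^+ n * t) : R) = 0.
    by rewrite indicE memNset//= in_itv/= andbT pmulr_rgt0// ltNge t0.
  by rewrite f1 f2 !mul0r.
have e1 : rt (enorm x ^+ n * t) = rt t * enorm x.
  rewrite powRM ?(ltW a0) ?(ltW t0)// mulrC; congr (_ * _).
  by rewrite -powR_mulrn ?enorm_ge0// -powRrM mulfV ?(gt_eqF n0)// powRr1 ?enorm_ge0.
rewrite e1 HE enormZ (ger0_norm (powR_ge0 _ _)) mulrA; congr (_ * _).
rewrite !indicE -[RHS]natrM mulnb; congr (nat_of_bool _)%:R.
apply/idP/andP; rewrite !in_setE /A/= !in_itv/= !andbT ?t0/=.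
  move=> tN; rewrite pmulr_rgt0//; split=> //.
  rewrite /r ltr_pM2r//.
  by apply: gt0_ltr_powR; rewrite ?invr_gt0 ?nnegrE ?(ltW t0) ?(ltW N0).
move=> [_]; rewrite /r ltr_pM2r// => h1; rewrite ltNge; apply/negP => Nt.
move: h1; rewrite ltNge => /negP; apply.
by apply: ge0_ler_powR; rewrite ?nnegrE ?invr_ge0 ?(ltW n0) ?(ltW t0) ?(ltW N0).
Qed.

End kernel_radial.

(** * Scaling, sign and decay of the kernel *)

Section weight_smooth.
Variables (R : realType) (n : nat) (s : R).
Hypotheses (n_gt0 : (0 < n)%N) (s_gt0 : 0 < s) (s_lt1 : s < 1).
Local Notation pd := (@partial_deriv R n).
Local Notation mu := (lebesgue_rV R n).
Local Notation p := (n%:R + 2 * s).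
Local Notation w := (weight (n := n) s).
Local Notation h := (Lap s (@bump R n)).
Local Notation rt t := (t `^ n%:R^-1).
Local Notation K := (avg_kernel (n := n) s).
Local Notation cn := (ball_vol R n).
Local Notation e i := (delta_mx ord0 i : 'rV[R]_n).
Implicit Types (N : R) (x : 'rV[R]_n).

Let n0 : 0 < n%:R :> R. Proof. by rewrite ltr0n. Qed.

Let cn0 : 0 < cn. Proof. exact: ball_vol_gt0. Qed.

Let rt_gt0 N : 0 < N -> 0 < rt N. Proof. exact: powR_gt0. Qed.

Let rt1 : rt 1 = 1 :> R. Proof. by rewrite powR1. Qed.

Let rtn N : 0 <= N -> rt N ^+ n = N.
Proof.
by move=> N0; rewrite -powR_mulrn ?powR_ge0// -powRrM mulVf ?(gt_eqF n0)// powRr1.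
Qed.

Lemma kernel_at0 N : 0 < N -> K N 0 = N * h 0.
Proof.
move=> N0; transitivity (\int[@lebesgue_measure R]_(t in `]0, N]) h 0).
  by apply: eq_Rintegral => t _; rewrite scaler0.
rewrite Rintegral_cst//.
rewrite mulrC; congr (_ * _).
by rewrite [X in fine X]lebesgue_measure_itv/= lte_fin N0 oppr0 addr0.
Qed.

(** By [kernel_ball] both sides come from the same integral, over the ball of radius
    [rt N * enorm x]. That formula is empty at the origin, where [kernel_at0] takes over. *)
Lemma kernel_scale N x : 0 < N -> K N x = N * K 1 (rt N *: x).
Proof.
move=> N0; have [->|x0] := eqVneq x 0.
  by rewrite scaler0 !kernel_at0// mul1r.
have c0 := rt_gt0 N0.
have cx0 : rt N *: x != 0 by rewrite scaler_eq0 negb_or gt_eqF.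
have ex0 : 0 < enorm x by rewrite enorm_gt0.
have := kernel_ball n_gt0 s_gt0 s_lt1 ltr01 cx0.
rewrite rt1 mul1r enormZ gtr0_norm// -(kernel_ball n_gt0 s_gt0 s_lt1 N0 x0).
rewrite (exprMn n (rt N) (enorm x)) (rtn (ltW N0)) => E.
have a0 : cn * enorm x ^+ n != 0 by rewrite mulf_neq0 ?expf_neq0 ?gt_eqF.
by apply: (mulfI a0); rewrite -E; ring.
Qed.

Lemma kernel_ge0 N x : 0 < N -> 0 <= K N x.
Proof.
move=> N0; have [->|x0] := eqVneq x 0.
  by rewrite kernel_at0// mulr_ge0 ?(ltW N0)// ltW// Lap_bump0_gt0.
have ex0 : 0 < enorm x by rewrite enorm_gt0.
have a0 : 0 < cn * enorm x ^+ n by rewrite mulr_gt0 ?exprn_gt0.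
rewrite -(pmulr_rge0 _ a0) kernel_ball//.
by apply: ball_Lap_ge0 => //; rewrite mulr_gt0 ?rt_gt0.
Qed.

(** The factor [|x|^n] of [kernel_ball] and the decay [(rt N * |x|)^(-2s)] of the ball integral add
    up to the exponent [p]; for [N >= 1] the factor [rt N] only helps, so [C] does not depend on
    [N]. *)
Lemma kernel_tail : exists2 C : R, 0 <= C & forall N x, 1 <= N -> 2 <= enorm x ->
  K N x <= C * enorm x `^ (- p).
Proof.
have [C C0 hC] := ball_Lap_le n_gt0 s_gt0 s_lt1.
exists (C / cn) => [|N x N1 x2]; first by rewrite divr_ge0// ltW.
have N0 : 0 < N by exact: lt_le_trans N1.
have ex0 : 0 < enorm x by exact: lt_le_trans x2.
have x0 : x != 0 by rewrite -enorm_gt0.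
have a0 : 0 < cn * enorm x ^+ n by rewrite mulr_gt0 ?exprn_gt0.
have c1 : 1 <= rt N by rewrite -[leLHS]rt1 ge0_ler_powR ?nnegrE ?invr_ge0 ?(ltW n0) ?(ltW N0).
rewrite -(ler_pM2l a0) kernel_ball//.
have h2 : 2 <= rt N * enorm x by rewrite (le_trans x2)// ler_peMl ?enorm_ge0.
apply: (le_trans (hC _ h2)).
have -> : cn * enorm x ^+ n * (C / cn * enorm x `^ (- p)) = C * enorm x `^ (- (2 * s)).
  have -> : enorm x `^ (- p) = enorm x ^- n * enorm x `^ (- (2 * s)).
    by rewrite opprD powRD ?(gt_eqF ex0) ?implybT// powR_invn// ltW.
  have en0 : enorm x ^+ n != 0 by rewrite expf_neq0// gt_eqF.
  have c0 : cn != 0 by rewrite gt_eqF.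
  by move: (enorm x `^ _) (enorm x ^+ n) en0 => A B B0; field; rewrite c0 B0.
apply: ler_wpM2l => //; rewrite !powRN lef_pV2 ?posrE ?powR_gt0 ?mulr_gt0 ?rt_gt0//.
apply: ge0_ler_powR; rewrite ?nnegrE ?mulr_ge0 ?enorm_ge0 ?powR_ge0 ?(ltW s_gt0)//.
by rewrite ler_peMl ?enorm_ge0.
Qed.

Lemma kernel_decay N : 1 <= N -> exists2 C : R, 0 < C & forall x, `|K N x| <= C * w x.
Proof.
move=> N1; have N0 : 0 < N by exact: lt_le_trans N1.
have [C1 C10 h1] := kernel_bounded n_gt0 s_gt0 s_lt1 N.
have [C2 C20 h2] := kernel_tail.
have C0 : 0 <= C1 + C2 by rewrite addr_ge0.
have [C C_gt0 hC] := weight_bound n s_gt0 (ltr0Sn R 1) C0.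
exists C => //; apply: hC => [x|x x2]; first by rewrite (le_trans (h1 x))// lerDl.
rewrite ger0_norm ?kernel_ge0// (le_trans (h2 N x N1 x2))// ler_wpM2r ?powR_ge0//.
by rewrite lerDr.
Qed.

(** The class of functions whose convolution with an element of [L_s] is smooth. *)
Definition weight_smooth (f : 'rV[R]_n -> R) : Prop := smooth_on setT f /\
  forall l, exists2 C : R, 0 < C & forall x, `|foldr pd f l x| <= C * w x.

(** Order 0 follows from the tail bound, orders from 2 on from [kernel_bound2]. The direct estimate
    for order 1 breaks down when [s >= 1/2], so this derivative is interpolated: by the mean value
    theorem on a unit step along [e i], it differs from an increment of the kernel by an increment
    of itself, which the second derivative controls. Unit steps change the weight by a bounded
    factor. *)
Lemma weight_smooth_kernel N : 1 <= N -> weight_smooth (K N).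
Proof.
move=> N1; have N0 : 0 < N by exact: lt_le_trans N1.
have sK := smooth_kernel n_gt0 s_gt0 s_lt1 N.
split=> // -[|i [|j l]]; first exact: kernel_decay.
  have [C0 C00 h0] := kernel_decay N1.
  have [C2 C20 h2] := kernel_bound2 n_gt0 s_gt0 s_lt1 (l := [:: i; i]) N0 isT.
  have [Cs Cs0 hs] := weight_shift n s_gt0 ler01.
  exists (C0 * Cs + C0 + C2 * Cs) => [|x]; first by rewrite !addr_gt0 ?mulr_gt0.
  have enorm_e (t : R) : `|t| <= 1 -> enorm (t *: e i) <= 1.
    by move=> t1; rewrite enormZ enorm_delta mulr1.
  have dK z : derivable (K N) z (e i) by exact: smooth_derivable.
  have dpK z : derivable (pd i (K N)) z (e i) by apply: smooth_derivable; exact: smooth_partial.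
  pose g (t : R) := K N (x + t *: e i).
  have dg (t : R) : is_derive t 1 g (pd i (K N) (x + t *: e i)).
    by apply: DeriveDef; [exact/derivable_line|rewrite derive_line].
  have cg : {within `[0, 1], continuous g}.
    apply: continuous_in_subspaceT => t _; apply: differentiable_continuous.
    by apply/derivable1_diffP; have [] := dg t.
  have [t + E] := @MVT_segment _ g (fun t : R => pd i (K N) (x + t *: e i)) 0 1 ler01 (fun t _ => dg t) cg.
  rewrite in_itv/= => /andP[t0 t1].
  have tn : `|t| <= 1 by rewrite ger0_norm.
  have d2 : `|pd i (K N) (x + t *: e i) - pd i (K N) x| <= C2 * Cs * w x.
    rewrite -[leRHS]mulr1; apply: (le_trans (_ : _ <= C2 * Cs * w x * `|t|)); last first.
      by apply: ler_wpM2l => //; rewrite !mulr_ge0 ?(ltW C20) ?(ltW Cs0)// ltW// weight_gt0.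
    apply: coord_mean_value => r rt; split=> //.
    apply: (le_trans (h2 _)); rewrite -mulrA ler_pM2l//; apply: hs.
    exact/enorm_e/(le_trans rt).
  have e1 : `|K N (x + e i)| <= C0 * Cs * w x.
    apply: (le_trans (h0 _)); rewrite -mulrA ler_pM2l//; apply: hs.
    by rewrite -[e i]scale1r; apply: enorm_e; rewrite normr1.
  have e2 := h0 x.
  rewrite /= (_ : pd i (K N) x = K N (x + e i) - K N x - (pd i (K N) (x + t *: e i) - pd i (K N) x)); last first.
    by move: E; rewrite subr0 mulr1 /g => <-; rewrite scale1r scale0r addr0 opprB addrC addrNK.
  apply: (le_trans (ler_normB _ _)); rewrite mulrDl; apply: lerD => //.
  by apply: (le_trans (ler_normB _ _)); rewrite mulrDl; apply: lerD.
exact: (kernel_bound2 n_gt0 s_gt0 s_lt1).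
Qed.

End weight_smooth.

(** * Dominated convergence and the approximate identity *)

Section dominated_Rintegral.
Context d (T : measurableType d) (R : realType) (m : {measure set T -> \bar R}).

Lemma dominated_Rintegral (f_ : nat -> T -> R) (f g : T -> R) :
  (forall j, measurable_fun setT (f_ j)) -> measurable_fun setT f ->
  m.-integrable setT (EFin \o g) -> (forall j x, `|f_ j x| <= g x) ->
  {ae m, forall x, f_ j x @[j --> \oo] --> f x} ->
  \int[m]_x f_ j x @[j --> \oo] --> \int[m]_x f x.
Proof.
move=> mf_ mf ig fg cvf.
have m_ j : measurable_fun setT (EFin \o f_ j) by exact/measurable_EFinP.
have mf' : measurable_fun setT (EFin \o f) by exact/measurable_EFinP.
have cv : {ae m, forall x, setT x -> (EFin \o f_ j) x @[j --> \oo] --> (EFin \o f) x}.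
  by apply: filterS cvf => x h _; exact: cvg_EFin (nearW _ _) h.
have dom : {ae m, forall x j, setT x -> (`|(EFin \o f_ j) x| <= (EFin \o g) x)%E}.
  by apply: aeW => x j _; rewrite /= lee_fin.
have [i1 _ c] := dominated_convergence measurableT m_ mf' cv ig dom.
have E : (\int[m]_x f x)%:E = (\int[m]_x (EFin \o f) x)%E.
  by rewrite fineK//; exact: integrable_fin_num.
rewrite -E in c; have /fine_cvgP[_ h] := c; exact: h.
Qed.

End dominated_Rintegral.

Section approximate_identity.
Variables (R : realType) (n : nat) (s : R).
Hypotheses (n_gt0 : (0 < n)%N) (s_gt0 : 0 < s) (s_lt1 : s < 1).
Local Notation mu := (lebesgue_rV R n).
Local Notation p := (n%:R + 2 * s).
Local Notation w := (weight (n := n) s).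
Local Notation rt t := (t `^ n%:R^-1).
Local Notation K := (avg_kernel (n := n) s).
Implicit Types (N : R) (x : 'rV[R]_n).

Let p_gt0 : 0 < p. Proof. by rewrite ltr_wpDl// mulr_gt0. Qed.

Let n0 : 0 < n%:R :> R. Proof. by rewrite ltr0n. Qed.

Let rt_gt0 N : 0 < N -> 0 < rt N. Proof. exact: powR_gt0. Qed.

Let rtn N : 0 <= N -> rt N ^+ n = N.
Proof.
by move=> N0; rewrite -powR_mulrn ?powR_ge0// -powRrM mulVf ?(gt_eqF n0)// powRr1.
Qed.

Lemma cvg_inv_root : (rt j.+1%:R)^-1 @[j --> \oo] --> (0 : R).
Proof.
have c0 (j : nat) : 0 < (rt j.+1%:R)^-1 :> R by rewrite invr_gt0 rt_gt0.
apply/cvgrPdist_lt => eps eps0.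
have en0 : 0 < eps ^+ n by rewrite exprn_gt0.
have /cvgrPdist_lt/(_ _ en0) := @cvg_harmonic R.
apply: filterS => j; rewrite /= !sub0r !normrN.
rewrite (gtr0_norm (c0 j)) gtr0_norm ?invr_gt0// => h.
rewrite -(@ltr_pXn2r _ n)// ?nnegrE ?(ltW (c0 j)) ?(ltW eps0)//.
by rewrite exprVn rtn.
Qed.

Definition kernel_mass : R := \int[mu]_x K 1 x.

Lemma measurable_kernel N : measurable_fun setT (K N).
Proof.
by apply: rV_continuous_measurable; apply: smooth_continuous; exact: smooth_kernel.
Qed.

Lemma integrable_kernel N : 1 <= N -> mu.-integrable setT (EFin \o K N).
Proof.
move=> N1; have [C _ hC] := kernel_decay n_gt0 s_gt0 s_lt1 N1.
apply: (integrable_dominated _ (integrable_weight n_gt0 s_gt0) hC).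
exact: measurable_kernel.
Qed.

(** [K 1] is nonnegative, continuous, and positive at 0, hence above half its value at 0 on an open
    set. *)
Lemma kernel_mass_gt0 : 0 < kernel_mass.
Proof.
have k0 : 0 < K 1 0 by rewrite kernel_at0// mul1r; exact: Lap_bump0_gt0.
pose a := K 1 0 / 2; have a0 : 0 < a by rewrite divr_gt0.
pose U := K 1 @^-1` [set t | a < t] `&` eball 0 1.
have oU : open U.
  apply: openI; last exact: open_eball.
  apply: open_comp; last exact: open_gt.
  by move=> x _; apply: smooth_continuous; exact: smooth_kernel.
have U0 : U !=set0.
  by exists 0; split; rewrite /eball/= ?subr0 ?enorm0// /a ltr_pdivrMr// ltr_pMr// ltr1n.
have Upos := open_measure_gt0 oU U0.
have mU : measurable U by exact: rV_open_measurable.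
have Ufin : (mu U < +oo)%E.
  apply: le_lt_trans (@eball_measure_fin R n 0 1).
  by apply: le_measure; rewrite ?inE//; [exact: measurable_eball|exact: subIsetr].
have iU := integrable_indic_fin mU Ufin.
apply: (@lt_le_trans _ _ (\int[mu]_y (a * \1_U y))).
  rewrite RintegralZl// mulr_gt0// /Rintegral integral_indic// setIT fine_gt0// Upos Ufin//.
apply: (le_Rintegral measurableT (integrable_scale a iU) (integrable_kernel (lexx 1))) => y _.
rewrite indicE; have [|_] := boolP (y \in U).
  by rewrite inE mulr1 => -[/= /ltW].
by rewrite mulr0 kernel_ge0.
Qed.

Let K_ge0 N y : 1 <= N -> 0 <= K N y.
Proof. by move=> N1; apply: kernel_ge0 => //; exact: lt_le_trans N1. Qed.

Let integrable_kernelM N x (c B : R) (g : 'rV[R]_n -> R) : 1 <= N -> 0 < c ->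
  measurable_fun setT g -> (forall z, `|g z| <= B) ->
  mu.-integrable setT (EFin \o (fun y => K N y * g (c *: y + x))).
Proof.
move=> N1 c0 mg gB.
apply: (@integrable_dominated _ _ _ (K N) B); last 2 first.
- exact: integrable_kernel.
- by move=> y; rewrite normrM mulrC (ger0_norm (K_ge0 y N1)) ler_wpM2r// K_ge0.
apply: measurable_funM; first exact: measurable_kernel.
exact: (measurableT_comp mg (@measurable_affine R n c x)).
Qed.

Lemma kernel_rescale N x (B : R) (g : 'rV[R]_n -> R) : 0 < N -> measurable_fun setT g ->
  (forall z, `|g z| <= B) ->
  \int[mu]_z (K N (z - x) * g z) = \int[mu]_y (K 1 y * g ((rt N)^-1 *: y + x)).
Proof.
move=> N0 mg gB; have c0 := rt_gt0 N0.
pose F z := K N (z - x) * g z.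
have mF : measurable_fun setT F.
  apply: measurable_funM => //; apply: (measurableT_comp (measurable_kernel N)).
  by apply: measurable_rVB => //; exact: measurable_cst.
have ci0 : 0 < (rt N)^-1 by rewrite invr_gt0.
have := Rintegral_rV_affine x ci0 mF.
rewrite exprVn invrK (rtn (ltW N0)) => E.
apply: (mulfI (lt0r_neq0 N0)); rewrite -E.
rewrite -(RintegralZl N measurableT (integrable_kernelM x (lexx 1) ci0 mg gB)).
apply: eq_Rintegral => y _; rewrite /F addrK (@kernel_scale _ _ _ n_gt0 s_gt0 s_lt1 N)//.
by rewrite scalerA mulfV ?(gt_eqF c0)// scale1r mulrA.
Qed.

(** After [kernel_rescale] the kernel is fixed and [g] is evaluated at points tending to [x];
    [B * K 1] dominates. Continuity is asked at the single point [x], because [g] will later be cut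
    by an orthant. *)
Lemma kernel_approx x (B : R) (g : 'rV[R]_n -> R) : measurable_fun setT g ->
  (forall z, `|g z| <= B) -> {for x, continuous g} ->
  \int[mu]_z (K j.+1%:R (z - x) * g z) @[j --> \oo] --> kernel_mass * g x.
Proof.
move=> mg gB cg.
pose c (j : nat) : R := (rt j.+1%:R)^-1.
have c0 j : 0 < c j by rewrite invr_gt0 rt_gt0.
have cvc := cvg_inv_root.
have -> : kernel_mass * g x = \int[mu]_y (K 1 y * g x).
  by rewrite (RintegralZr (g x) measurableT (integrable_kernel (lexx 1))).
rewrite (_ : (fun j : nat => _) = fun j => \int[mu]_y (K 1 y * g (c j *: y + x))); last first.
  by apply/funext => j; exact: (kernel_rescale _ _ mg gB).
apply: (@dominated_Rintegral _ _ _ _ _ _ (fun y => B * K 1 y)).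
- move=> j; have /integrableP[/measurable_EFinP] := integrable_kernelM x (lexx 1) (c0 j) mg gB.
  exact.
- by apply: measurable_funM => //; exact: measurable_kernel.
- by apply: integrable_scale; exact: integrable_kernel.
- by move=> j y; rewrite normrM mulrC (ger0_norm (K_ge0 y (lexx 1))) ler_wpM2r// K_ge0.
- apply: aeW => y; apply: cvgM; first exact: cvg_cst.
  have cy : (fun j : nat => c j *: y + x) @ \oo --> x.
    apply/cvgrPdist_lt => eps eps0.
    have ey0 : 0 < eps / (`|y| + 1) by rewrite divr_gt0// ltr_wpDl.
    move/cvgrPdist_lt : cvc => /(_ _ ey0); apply: filterS => j.
    rewrite /= sub0r normrN ltr_pdivlMr ?ltr_wpDl// => h.
    rewrite opprD addrCA subrr addr0 normrN normrZ; apply: le_lt_trans h.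
    by rewrite ler_wpM2l// lerDl.
  exact: (cvg_comp _ _ cy cg).
Qed.

Lemma integrable_kernel_shift N x (B : R) (g : 'rV[R]_n -> R) : 1 <= N ->
  measurable_fun setT g -> (forall z, `|g z| <= B) ->
  mu.-integrable setT (EFin \o (fun z => K N (z - x) * g z)).
Proof.
move=> N1 mg gB.
have iKx : mu.-integrable setT (EFin \o (fun z => K N (z - x))).
  have mKx : measurable_fun setT (fun z : 'rV[R]_n => K N (z - x)).
    apply: (measurableT_comp (measurable_kernel N)).
    by apply: measurable_rVB => //; exact: measurable_cst.
  apply: integrable_ge0_fin => //; first by move=> z; exact: K_ge0.
  rewrite (@ge0_integral_rV_shift _ _ (- x) (fun z => (K N z)%:E)).
  - have /integrableP[_] := integrable_kernel N1.
    by under eq_integral do rewrite /= ger0_norm ?K_ge0//.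
  - by apply/measurable_EFinP; exact: measurable_kernel.
  - by move=> z; rewrite lee_fin K_ge0.
apply: (@integrable_dominated _ _ _ (fun z => K N (z - x)) B) => //.
  by apply: measurable_funM => //; have /integrableP[/measurable_EFinP] := iKx.
by move=> z; rewrite normrM mulrC (ger0_norm (K_ge0 _ N1)) ler_wpM2r// K_ge0.
Qed.

(** Provides the majorant, uniform in [N], for passing to the limit under the integral against [u].
    The averages are at most [kernel_mass * B] everywhere; for [|x| >= 4 + 2 r] and [|z| <= r],
    [|z - x|] is at least 2 and at least [|x| / 2], so [kernel_tail] gives the decay. *)
Lemma kernel_avg_bound (B r : R) : 0 <= B -> 0 < r -> exists2 C : R, 0 < C &
  forall N (g : 'rV[R]_n -> R), 1 <= N -> measurable_fun setT g ->
    (forall z, `|g z| <= B) -> (forall z, r < enorm z -> g z = 0) ->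
    forall x, `|\int[mu]_z (K N (z - x) * g z)| <= C * w x.
Proof.
move=> B0 r0; have [C2 C20 hC2] := kernel_tail n_gt0 s_gt0 s_lt1.
pose b : 'rV[R]_n -> R := \1_(eball 0 (r + 1)).
have mb : measurable_fun setT b by apply: measurable_indic; exact: measurable_eball.
have ib : mu.-integrable setT (EFin \o b).
  by apply: integrable_indic_fin; [exact: measurable_eball|exact: eball_measure_fin].
pose V := \int[mu]_z b z.
have V0 : 0 <= V by apply: Rintegral_ge0.
have k0 : 0 <= kernel_mass by exact/ltW/kernel_mass_gt0.
pose A := C2 * 2 `^ p * B.
have A0 : 0 <= A by rewrite !mulr_ge0 ?powR_ge0.
pose Kc := kernel_mass * B + A * V.
have Kc0 : 0 <= Kc by rewrite addr_ge0 ?mulr_ge0.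
have R0 : 0 < 4 + 2 * r by rewrite addr_gt0 ?mulr_gt0.
have [C C0 hC] := weight_bound n s_gt0 R0 Kc0; exists C => // N g N1 mg gB gr.
have N0 : 0 < N by exact: lt_le_trans N1.
have iF x := integrable_kernel_shift x N1 mg gB.
apply: hC => [x|x xr].
  rewrite (kernel_rescale x N0 mg gB).
  have ci0 : 0 < (rt N)^-1 by rewrite invr_gt0 rt_gt0.
  have iK := integrable_kernelM x (lexx 1) ci0 mg gB.
  apply: (le_trans (le_normr_Rintegral measurableT iK)).
  apply: (@le_trans _ _ (kernel_mass * B)); last by rewrite lerDl mulr_ge0.
  rewrite -(RintegralZr B measurableT (integrable_kernel (lexx 1))).
  apply: (le_Rintegral measurableT (integrable_normr iK)).
    rewrite (_ : (fun y => _) = fun y => B * K 1 y); last by apply/funext => y; rewrite mulrC.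
    exact/integrable_scale/integrable_kernel/lexx.
  by move=> y _; rewrite normrM (ger0_norm (K_ge0 _ (lexx 1))) ler_wpM2l// K_ge0.
have x0 : 0 < enorm x by exact: lt_le_trans xr.
apply: (le_trans (le_normr_Rintegral measurableT (iF x))).
apply: (@le_trans _ _ ((A * V) * enorm x `^ (- p))); last first.
  by rewrite ler_wpM2r ?powR_ge0// lerDr mulr_ge0.
rewrite mulrAC -(RintegralZl _ measurableT ib).
apply: (le_Rintegral measurableT (integrable_normr (iF x)) (integrable_scale _ ib)) => z _.
have [zr|zr] := ltP r (enorm z).
  by rewrite gr// mulr0 normr0 !mulr_ge0 ?powR_ge0// /b indicE.
rewrite /b indicE mem_set ?mulr1; last by rewrite /eball/= subr0; lra.
have h : enorm x <= 2 * enorm (z - x).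
  by have := ler_enormB x z; rewrite enorm_distC; lra.
rewrite normrM (ger0_norm (K_ge0 _ N1)) /A mulrAC; apply: ler_pM => //; first exact: K_ge0.
have zx2 : 2 <= enorm (z - x) by lra.
apply: (le_trans (hC2 N _ N1 zx2)); rewrite -mulrA; apply: ler_wpM2l => //.
rewrite !powRN ler_pdivlMr ?powR_gt0// mulrC ler_pdivrMr ?powR_gt0//; last by lra.
rewrite -powRM ?enorm_ge0//.
by apply: ge0_ler_powR; rewrite ?nnegrE ?(ltW p_gt0) ?mulr_ge0 ?enorm_ge0.
Qed.

End approximate_identity.

(** * Convolution of a function of [L_s] with the kernels *)

Section convolution.
Variables (R : realType) (n : nat) (s : R) (u : 'rV[R]_n -> R).
Hypotheses (n_gt0 : (0 < n)%N) (s_gt0 : 0 < s) (s_lt1 : s < 1).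
Local Notation pd := (@partial_deriv R n).
Local Notation mu := (lebesgue_rV R n).
Local Notation leb := (@lebesgue_measure R).
Local Notation p := (n%:R + 2 * s).
Local Notation w := (weight (n := n) s).
Local Notation h := (Lap s (@bump R n)).
Local Notation rt t := (t `^ n%:R^-1).
Local Notation K := (avg_kernel (n := n) s).
Local Notation e i := (delta_mx ord0 i : 'rV[R]_n).
Implicit Types (N : R) (x z : 'rV[R]_n) (f : 'rV[R]_n -> R).

Hypotheses (mu_u : measurable_fun setT u)
  (iu : mu.-integrable setT (EFin \o (fun x => u x * w x))).

Let p_gt0 : 0 < p. Proof. by rewrite ltr_wpDl// mulr_gt0. Qed.

Let iau : mu.-integrable setT (EFin \o (fun x => `|u x| * w x)).
Proof.
have := integrable_normr iu; apply: eq_integrable => // x _ /=.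
by rewrite normrM (gtr0_norm (weight_gt0 _ _)).
Qed.

Let weight_diff (r : R) : 0 <= r -> exists2 C : R, 0 < C &
  forall z x, enorm z <= r -> w (z - x) <= C * w x.
Proof.
move=> r0; have [C C0 hC] := weight_shift n s_gt0 r0; exists C => // z x zr.
by rewrite -(weightN s x) addrC; exact: hC.
Qed.

Lemma weight_expand (c : R) x : 1 <= c -> w (c *: x) <= w x.
Proof.
move=> c1; have pos y : 0 < 1 + enorm (y : 'rV[R]_n) `^ p by rewrite ltr_pwDl// powR_ge0.
rewrite /weight lef_pV2 ?posrE; [|exact: pos..]; rewrite lerD2l.
apply: ge0_ler_powR; rewrite ?nnegrE ?enorm_ge0 ?(ltW p_gt0)// enormZ.
by rewrite ler_peMl ?enorm_ge0// ger0_norm// (le_trans ler01).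
Qed.

Lemma integrable_mul_supported (r B : R) (g : 'rV[R]_n -> R) : 0 < r ->
  measurable_fun setT g -> (forall z, `|g z| <= B) -> (forall z, r < enorm z -> g z = 0) ->
  mu.-integrable setT (EFin \o (fun z => u z * g z)).
Proof.
move=> r0 mg gB gr; have B0 : 0 <= B by exact: le_trans (gB 0).
apply: (@integrable_dominated _ _ _ _ (B * (1 + r `^ p)) _ iau).
  by apply: measurable_funM; [exact: mu_u|exact: mg].
move=> x; have B1 : 0 <= B * (1 + r `^ p) by rewrite mulr_ge0 ?addr_ge0 ?powR_ge0.
have [xr|xr] := ltP r (enorm x).
  by rewrite gr// mulr0 normr0 mulr_ge0// mulr_ge0// ltW// weight_gt0.
rewrite normrM [leRHS]mulrCA; apply: (ler_wpM2l (normr_ge0 _)).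
rewrite /weight ler_pdivlMr; last by rewrite ltr_pwDl// powR_ge0.
apply: ler_pM; [exact: normr_ge0|by rewrite addr_ge0 ?powR_ge0|exact: gB|].
by rewrite lerD2l ge0_ler_powR ?nnegrE ?enorm_ge0 ?(ltW p_gt0) ?(ltW r0).
Qed.

Definition conv (f : 'rV[R]_n -> R) z : R := \int[mu]_x (u x * f (z - x)).

Let mconv f z : measurable_fun setT f -> measurable_fun setT (fun x => u x * f (z - x)).
Proof.
move=> mf; apply: measurable_funM => //; apply: (measurableT_comp mf).
by apply: measurable_rVB => //; exact: measurable_cst.
Qed.

Lemma integrable_conv f z (C : R) : measurable_fun setT f -> (forall x, `|f x| <= C * w x) ->
  mu.-integrable setT (EFin \o (fun x => u x * f (z - x))).
Proof.
move=> mf fC; have [Cs Cs0 hs] := weight_diff (enorm_ge0 z).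
have C0 : 0 <= C by rewrite -(pmulr_lge0 _ (weight_gt0 s (0 : 'rV[R]_n))) (le_trans _ (fC 0)).
apply: (@integrable_dominated _ _ _ _ (C * Cs) (mconv z mf) iau) => x.
rewrite normrM [leRHS]mulrCA; apply: (ler_wpM2l (normr_ge0 _)).
by rewrite (le_trans (fC _))// -mulrA ler_wpM2l// hs.
Qed.

Lemma conv_bounded f (C r : R) : measurable_fun setT f -> (forall x, `|f x| <= C * w x) ->
  0 <= r -> exists B : R, forall z, enorm z <= r -> `|conv f z| <= B.
Proof.
move=> mf fC r0; have [Cs Cs0 hs] := weight_diff r0.
have C0 : 0 <= C by rewrite -(pmulr_lge0 _ (weight_gt0 s (0 : 'rV[R]_n))) (le_trans _ (fC 0)).
exists (\int[mu]_x ((C * Cs) * (`|u x| * w x))) => z zr.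
have ic := integrable_conv z mf fC.
apply: (le_trans (le_normr_Rintegral measurableT ic)).
apply: (le_Rintegral measurableT (integrable_normr ic) (integrable_scale (C * Cs) iau)) => x _.
rewrite normrM [leRHS]mulrCA; apply: (ler_wpM2l (normr_ge0 _)).
by rewrite (le_trans (fC _))// -mulrA ler_wpM2l// hs.
Qed.

(** Near [z0] the points [z] stay in a fixed ball, so the translates of each derivative are
    dominated by one multiple of [|u| * w]. *)
Lemma smooth_conv f : weight_smooth s f -> smooth_on setT (conv f).
Proof.
move=> [sf hf]; pose D l z x := u x * foldr pd f l (z - x).
have mD l z : measurable_fun setT (D l z).
  by apply: mconv; apply: rV_continuous_measurable; apply: smooth_continuous; exact: smooth_foldr.
have dD l i z x : setT x ->
    is_derive z (e i) (fun z => D l z x) (D (i :: l) z x).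
  move=> _; have sg := smooth_foldr l sf; rewrite /D /=; set g := foldr pd f l.
  have hs : is_derive z (e i) (fun z => g (z - x)) (pd i g (z - x)).
    apply: DeriveDef; last exact: derive_shift_arg.
    by apply: (proj2 (derivable_shift_arg g (- x) z _)); exact: smooth_derivable.
  exact: (is_deriveZ (u x) hs).
have bD l z0 : exists2 g : _ -> R, mu.-integrable setT (EFin \o g) &
    exists2 eps : R, 0 < eps & forall z, `|z - z0| < eps -> forall x, setT x -> `|D l z x| <= g x.
  have [C C0 hC] := hf l.
  (* The factor [n] passes from the sup norm, in which [z] is close to [z0], to [enorm]. *)
  have r0 : 0 <= n%:R * (`|z0| + 1) by rewrite mulr_ge0// addr_ge0.
  have [Cs Cs0 hs] := weight_diff r0.
  exists (fun x => (C * Cs) * (`|u x| * w x)); first exact: integrable_scale.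
  exists 1 => // z zz0 x _; rewrite /D normrM [leRHS]mulrCA; apply: (ler_wpM2l (normr_ge0 _)).
  apply: (le_trans (hC _)); rewrite -mulrA ler_pM2l//; apply: hs.
  apply: (le_trans (enorm_le_norm _)); rewrite ler_wpM2l//.
  by rewrite -[z](subrK z0) addrC (le_trans (ler_normD _ _))// lerD2l ltW.
exact: (smooth_integral measurableT mD dD bD).
Qed.

Let K_ge0 N y : 1 <= N -> 0 <= K N y.
Proof. by move=> N1; apply: kernel_ge0 => //; exact: lt_le_trans N1. Qed.

Lemma smooth_conv_kernel N : 1 <= N -> smooth_on setT (conv (K N)).
Proof. by move=> N1; apply: smooth_conv; exact: weight_smooth_kernel. Qed.

Let dominating (a : R) : 0 <= a ->
  [/\ measurable_fun setT (fun x => a * (`|u x| * w x)),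
      forall x, 0 <= a * (`|u x| * w x) &
      (\int[mu]_x (a * (`|u x| * w x))%:E < +oo)%E].
Proof.
move=> a0; have /integrableP[/measurable_EFinP mw wfin] := integrable_scale a iau.
have w0 x : 0 <= a * (`|u x| * w x) by rewrite !mulr_ge0// ltW// weight_gt0.
split=> //; move: wfin; under eq_integral do rewrite /= ger0_norm ?w0//.
by [].
Qed.

(** Fubini applies because, on the support of [g], the shifted kernel is at most a multiple of
    [w x]. The measurability is recorded for the dominated convergence in [conv_kernel_weak]. *)
Lemma conv_kernel_adjoint N (B r : R) (g : 'rV[R]_n -> R) : 1 <= N ->
  measurable_fun setT g -> (forall z, `|g z| <= B) -> (forall z, r < enorm z -> g z = 0) ->
  0 < r ->
  measurable_fun setT (fun x => u x * \int[mu]_z (K N (z - x) * g z)) /\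
  \int[mu]_z (conv (K N) z * g z) = \int[mu]_x (u x * \int[mu]_z (K N (z - x) * g z)).
Proof.
move=> N1 mg gB gr r0; have [C C0 hC] := kernel_decay n_gt0 s_gt0 s_lt1 N1.
have mK : measurable_fun setT (K N) by exact: measurable_kernel.
have B0 : 0 <= B by exact: le_trans (gB 0).
have [Cs Cs0 hs] := weight_diff (ltW r0).
pose b : 'rV[R]_n -> R := \1_(eball 0 (r + 1)).
pose F z x : R := u x * K N (z - x) * g z.
have mF : measurable_fun setT (fun q : 'rV[R]_n * 'rV[R]_n => F q.1 q.2).
  apply: measurable_funM; last exact: (measurableT_comp mg).
  apply: measurable_funM; first exact: (measurableT_comp mu_u).
  by apply: (measurableT_comp mK); apply: measurable_rVB.
have mb : measurable_fun setT (fun z => B * b z).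
  by apply: measurable_funM => //; apply: measurable_indic; exact: measurable_eball.
have b0 z : 0 <= B * b z by rewrite mulr_ge0// /b indicE.
have bfin : (\int[mu]_z (B * b z)%:E < +oo)%E.
  have ib : mu.-integrable setT (EFin \o b).
    by apply: integrable_indic_fin; [exact: measurable_eball|exact: eball_measure_fin].
  have /integrableP[_] := integrable_scale B ib.
  by under eq_integral do rewrite /= ger0_norm ?b0//.
have [mw w0 wfin] := dominating (mulr_ge0 (ltW C0) (ltW Cs0)).
have FB z x : `|F z x| <= (B * b z) * ((C * Cs) * (`|u x| * w x)).
  have [zr|zr] := ltP r (enorm z); first by rewrite /F gr// mulr0 normr0 mulr_ge0.
  rewrite /b indicE mem_set ?mulr1; last by rewrite /eball/= subr0 (le_lt_trans zr)// ltrDl.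
  rewrite /F normrM mulrC; apply: ler_pM => //.
  rewrite normrM [leRHS]mulrCA; apply: (ler_wpM2l (normr_ge0 _)).
  by rewrite (le_trans (hC _))// -mulrA ler_pM2l// hs.
have E := Rintegral_fubini mF mb mw b0 w0 bfin wfin FB.
have mE := measurable_Rintegral_r mF mb mw b0 w0 bfin wfin FB.
have EF x : \int[mu]_z F z x = u x * \int[mu]_z (K N (z - x) * g z).
  have iK := integrable_kernel_shift n_gt0 s_gt0 s_lt1 x N1 mg gB.
  rewrite -(RintegralZl _ measurableT iK).
  by apply: eq_Rintegral => z _; rewrite /F mulrA.
split; first by rewrite (_ : (fun x => _) = fun x => \int[mu]_z F z x)//; exact/funext.
transitivity (\int[mu]_z \int[mu]_x F z x).
  apply: eq_Rintegral => z _; rewrite /F /conv -RintegralZr//.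
  exact: (integrable_conv z mK hC).
by rewrite E; apply: eq_Rintegral => x _; exact: EF.
Qed.

(** [K M - K N] integrates the dilates of [h] over [N < t <= M], and each of them integrates to 0
    against [u]. As [t >= 1], [weight_expand] bounds all these dilates by one multiple of the
    weight, which justifies the exchange. *)
Lemma conv_kernel_eq N M z : 1 <= N -> N <= M ->
  (forall t : R, N < t -> t <= M -> \int[mu]_x (u x * h (rt t *: (z - x))) = 0) ->
  conv (K M) z = conv (K N) z.
Proof.
move=> N1 NM h0; have M1 : 1 <= M by exact: le_trans NM.
have [C C0 hC] := Lap_bound n_gt0 s_gt0 s_lt1 (@smooth_cs_bump R n).
have [Cs Cs0 hs] := weight_diff (enorm_ge0 z).
have n0 : 0 < n%:R :> R by rewrite ltr0n.
pose I : set (measurableTypeR R) := `]N, M]%classic.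
have mI : measurable I by exact: measurable_itv.
pose b : measurableTypeR R -> R := \1_I.
have mb : measurable_fun setT b by exact: measurable_indic.
have mh : measurable_fun setT h.
  apply: rV_continuous_measurable; apply: smooth_continuous.
  exact: (smooth_Lap n_gt0 s_gt0 s_lt1 (@smooth_cs_bump R n)).
pose F x (t : measurableTypeR R) : R := u x * (b t * h (rt t *: (z - x))).
have mF : measurable_fun setT (fun q : 'rV[R]_n * measurableTypeR R => F q.1 q.2).
  apply: measurable_funM; first exact: (measurableT_comp mu_u).
  apply: measurable_funM; first exact: (measurableT_comp mb).
  apply: (measurableT_comp mh); apply: measurable_rVZ.
    exact: (measurableT_comp (@measurable_powR R _)).
  by apply: measurable_rVB => //; exact: measurable_cst.
have [mw w0 wfin] := dominating (mulr_ge0 (ltW C0) (ltW Cs0)).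
have b0 t : 0 <= b t by rewrite /b indicE.
have bfin : (\int[leb]_t (b t)%:E < +oo)%E.
  rewrite integral_indic// setIT [X in (X < _)%E]lebesgue_measure_itv/=.
  by case: ifP => _; rewrite -?EFinB ltry.
have FB x t : `|F x t| <= ((C * Cs) * (`|u x| * w x)) * b t.
  rewrite /F !normrM (ger0_norm (b0 t)).
  have [tI|tI] := boolP (t \in I); last by rewrite /b indicE (negbTE tI) mul0r !mulr0.
  rewrite /b indicE tI mul1r mulr1 [leRHS]mulrCA; apply: (ler_wpM2l (normr_ge0 _)).
  apply: (le_trans (hC _)); rewrite -mulrA ler_pM2l//.
  apply: le_trans (hs z x (lexx _)).
  move: tI; rewrite inE /I/= in_itv/= => /andP[Nt tM].
  have t1 : 1 <= rt t.
    have t1 : 1 <= t by exact: le_trans (ltW Nt).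
    have e1 : rt 1 = 1 :> R by rewrite powR1.
    rewrite -[leLHS]e1.
    by apply: ge0_ler_powR; rewrite ?nnegrE ?invr_ge0 ?(ltW n0)// (le_trans ler01).
  exact: weight_expand.
have E := Rintegral_fubini mF mw mb w0 b0 wfin bfin FB.
have slice y : K M y - K N y = \int[leb]_t (b t * h (rt t *: y)).
  rewrite -Rintegral_indic_mul /avg_kernel Rintegral_itvB//.
  - exact: integrable_kernel_slice.
  - by rewrite bnd_simp (le_trans _ N1).
have iK L : 1 <= L -> mu.-integrable setT (EFin \o (fun x => u x * K L (z - x))).
  move=> L1; have [C1 _ hC1] := kernel_decay n_gt0 s_gt0 s_lt1 L1.
  by apply: integrable_conv hC1; exact: measurable_kernel.
apply/eqP; rewrite -subr_eq0 /conv -(RintegralB measurableT (iK M M1) (iK N N1)); apply/eqP.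
transitivity (\int[mu]_x \int[leb]_t F x t).
  apply: eq_Rintegral => x _; rewrite -mulrBr slice -RintegralZl//.
  have ib : leb.-integrable setT (EFin \o (fun t => C * b t)).
    have := integrableZl measurableT C (integrable_ge0_fin mb b0 bfin).
    exact: eq_integrable.
  apply: (le_integrable measurableT _ _ ib).
    apply/measurable_EFinP; apply: measurable_funM; first exact: mb.
    apply: (measurableT_comp mh).
    apply: measurable_rVZ; last exact: measurable_cst.
    exact: measurable_powR.
  move=> t _ /=; rewrite lee_fin normrM (ger0_norm (b0 t)) mulrC (ger0_norm (mulr_ge0 (ltW C0) (b0 t))).
  apply: (ler_wpM2r (b0 t)); apply: (le_trans (hC _)).
  by rewrite -[leRHS]mulr1 ler_pM2l// weight_le1.
rewrite E; transitivity (\int[leb]_(t in setT) (0 : R)); last first.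
  by rewrite Rintegral_cst// mul0r.
apply: eq_Rintegral => t _; rewrite /F; have [tI|tI] := boolP (t \in I); last first.
  under eq_Rintegral do rewrite /b indicE (negbTE tI) mul0r mulr0.
  by rewrite Rintegral_cst// mul0r.
under eq_Rintegral do rewrite /b indicE tI mul1r.
by move: tI; rewrite inE /I/= in_itv/= => /andP[Nt tM]; exact: h0.
Qed.

(** On the support of [g] the convolution no longer changes from index [N] on, so the pairing equals
    its limit. The limit is computed with the kernel moved onto [g]: [u] is merely integrable
    against the weight, whereas the averages of [g] converge wherever [g] is continuous. *)
Lemma conv_kernel_weak (N : nat) (r B : R) (g : 'rV[R]_n -> R) : 0 < r ->
  measurable_fun setT g -> (forall z, `|g z| <= B) -> (forall z, r < enorm z -> g z = 0) ->
  {ae mu, forall z, {for z, continuous g}} ->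
  (forall z (M : nat), (N <= M)%N -> g z != 0 -> conv (K M.+1%:R) z = conv (K N.+1%:R) z) ->
  \int[mu]_z (conv (K N.+1%:R) z * g z) = kernel_mass n s * \int[mu]_z (u z * g z).
Proof.
move=> r0 mg gB gr cg eqg.
have j1 (j : nat) : 1 <= j.+1%:R :> R by rewrite ler1n.
have B0 : 0 <= B by exact: le_trans (gB 0).
have [C C0 hC] := kernel_avg_bound n_gt0 s_gt0 s_lt1 B0 r0.
pose A (j : nat) x := \int[mu]_z (K j.+1%:R (z - x) * g z).
pose k := kernel_mass n s.
have iug := integrable_mul_supported r0 mg gB gr.
have cv : \int[mu]_x (u x * A j x) @[j --> \oo] --> \int[mu]_x (u x * (k * g x)).
  apply: (@dominated_Rintegral _ _ _ _ _ _ (fun x => C * (`|u x| * w x))).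
  - by move=> j; have [] := conv_kernel_adjoint (j1 j) mg gB gr r0.
  - by apply: measurable_funM; [exact: mu_u|exact: measurable_funM].
  - exact: integrable_scale.
  - move=> j x; rewrite normrM [leRHS]mulrCA; apply: (ler_wpM2l (normr_ge0 _)).
    exact: (hC _ _ (j1 j) mg gB gr).
  - apply: filterS cg => x cgx; apply: cvgM; first exact: cvg_cst.
    exact: (kernel_approx n_gt0 s_gt0 s_lt1 mg gB cgx).
have eqM (a b c : R) : (c != 0 -> a = b) -> a * c = b * c.
  by have [->|c0 ->] := eqVneq c 0; rewrite ?mulr0.
have cst : \int[mu]_x (u x * A j x) @[j --> \oo] --> \int[mu]_z (conv (K N.+1%:R) z * g z).
  apply: cvg_near_cst; exists N => // j /= Nj.
  have [_ <-] := conv_kernel_adjoint (j1 j) mg gB gr r0; apply: eq_Rintegral => z _.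
  by apply: eqM => gz; exact: (eqg z j Nj gz).
rewrite -/k -(RintegralZl k measurableT iug).
transitivity (\int[mu]_x (u x * (k * g x))); last first.
  by apply: eq_Rintegral => x _; rewrite mulrCA.
exact: (cvg_unique (@norm_hausdorff _ _) cst cv).
Qed.

End convolution.

(** * Positivity of the normalizing constant *)

Section gamma_function.
Variable R : realType.
Local Notation leb := (@lebesgue_measure R).

(** A divergent integral has real value 0, so positivity also requires convergence: compare with
    [t^(a - 1)] on []0, 1]] and with a multiple of [t^(-2)] beyond 1. *)
Lemma Gamma_gt0 (a : R) : 0 < a -> 0 < Gamma a.
Proof.
move=> a0; pose f (t : measurableTypeR R) : R := t `^ (a - 1) * expR (- t).
have f0 t : 0 <= f t by rewrite mulr_ge0 ?powR_ge0 ?expR_ge0.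
have mf (D : set (measurableTypeR R)) : measurable_fun D (EFin \o f).
  apply/measurable_EFinP; apply: measurable_funTS; apply: measurable_funM.
    exact: measurable_powR.
  by apply: measurableT_comp; [exact: measurable_expR|exact: oppr_measurable].
rewrite (_ : Gamma a = \int[leb]_(t in `]0, +oo[) f t)// /Rintegral fine_gt0//; apply/andP; split.
  pose I : set (measurableTypeR R) := `[1, 2]%classic.
  have mI : measurable I by exact: measurable_itv.
  pose c : R := 2^-1 * expR (- 2).
  have c0 : 0 < c by rewrite mulr_gt0 ?invr_gt0 ?expR_gt0.
  apply: (@lt_le_trans _ _ (\int[leb]_(t in I) c%:E)%E).
    rewrite integral_cst// mule_gt0 ?lte_fin// [X in (_ < X)%E]lebesgue_measure_itv/=.
    by rewrite lte_fin ltr1n lte_fin; lra.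
  apply: (@le_trans _ _ (\int[leb]_(t in I) (f t)%:E)%E).
    apply: ge0_le_integral => //; first by move=> t _; rewrite lee_fin ltW.
    move=> t; rewrite /I/= in_itv/= => /andP[t1 t2]; rewrite lee_fin /f /c.
    have t0 : 0 < t by exact: lt_le_trans t1.
    apply: ler_pM; rewrite ?invr_ge0 ?expR_ge0//; last by rewrite ler_expR lerN2.
    apply: (@le_trans _ _ (t `^ (- 1))).
      by rewrite powR_inv1 ?(ltW t0)// lef_pV2 ?posrE.
    by apply: ler_powR => //; lra.
  apply: ge0_subset_integral => // [t _|t]; first by rewrite lee_fin.
  rewrite /I/= !in_itv/= andbT => /andP[t1 _]; exact: lt_le_trans t1.
rewrite (@itv_bndbnd_setU _ _ _ (BRight (1 : R))); [|by rewrite bnd_simp..].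
rewrite ge0_integral_setU//=; last 2 first.
- by move=> u _; rewrite lee_fin; exact: f0.
- apply/disj_setPS => u /= []; rewrite !in_itv/= andbT => /andP[_ u1].
  by rewrite ltNge u1.
have mp (c : R) D : measurable_fun D (fun t : measurableTypeR R => (t `^ c)%:E).
  by apply/measurable_EFinP; apply: measurable_funTS; exact: measurable_powR.
apply: lte_add_pinfty.
- apply: (@le_lt_trans _ _ (\int[leb]_(t in `]0%R, 1%R]) (t `^ (a - 1))%:E)%E).
    apply: ge0_le_integral => //; first by move=> t _; rewrite lee_fin.
    move=> t /=; rewrite in_itv/= => /andP[t0 _]; rewrite lee_fin /f.
    by rewrite ler_piMr ?powR_ge0// -expR0 ler_expR oppr_le0 ltW.
  by apply: integral_powR_near0 => //; lra.
(* For [t >= 1] the exponential term of order [j + 2] dominates [t^(a + 1)], up to its factorial, as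
   soon as [a <= j + 1]. *)
- pose j := (Num.truncn a).+1.
  have ja : a <= j.+1%:R by rewrite (le_trans (ltW (truncnS_gt a)))// ler_nat.
  pose C : R := (j.+2)`!%:R.
  have C0 : 0 < C by rewrite ltr0n fact_gt0.
  apply: (@le_lt_trans _ _ (\int[leb]_(t in `]1%R, +oo[) (C%:E * (t `^ (- 2))%:E))%E).
    apply: ge0_le_integral => //.
    + by move=> t _; rewrite lee_fin.
    + by apply: emeasurable_funM.
    + move=> t /=; rewrite in_itv/= andbT => t1; rewrite -EFinM lee_fin /f.
      have t0 : 0 < t by exact: lt_trans t1.
      rewrite expRN ler_pdivrMr ?expR_gt0//.
      have h := @expR_ge1Dxn _ _ j.+1 (ltW t0).
      have {}h : t ^+ j.+2 / C <= expR t by apply: le_trans h; rewrite lerDr.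
      apply: (@le_trans _ _ (C * t `^ (- 2) * (t ^+ j.+2 / C))); last first.
        by rewrite ler_wpM2l// mulr_ge0 ?powR_ge0// ltW.
      have -> : C * t `^ (- 2) * (t ^+ j.+2 / C) = t `^ (- 2) * t ^+ j.+2.
        by field; rewrite gt_eqF.
      rewrite -powR_mulrn ?(ltW t0)// -powRD ?(gt_eqF t0) ?implybT//.
      apply: ler_powR; first exact: ltW.
      by rewrite -(natr1 j.+1); lra.
  rewrite ge0_integralZl//; [|by move=> t _; rewrite lee_fin powR_ge0|by rewrite lee_fin ltW].
  apply: lte_mul_pinfty; rewrite ?lee_fin ?(ltW C0)//.
  apply: le_lt_trans (@integral_powR_infty R (- 2) _); last by lra.
  apply: ge0_subset_integral => // [t _|u]; first by rewrite lee_fin powR_ge0.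
  by rewrite /= !in_itv/= !andbT => /ltW.
Qed.

Lemma gamma_ns_gt0 (n : nat) (s : R) : 0 < s -> s < 1 -> 0 < gamma_ns n s.
Proof.
move=> s0 s1; rewrite /gamma_ns divr_gt0//.
  by rewrite !mulr_gt0 ?powR_gt0// Gamma_gt0// divr_gt0// ltr_wpDl// mulr_gt0.
by rewrite mulr_gt0 ?powR_gt0 ?pi_gt0// Gamma_gt0// subr_gt0.
Qed.

End gamma_function.

(** * Borel representatives of Lebesgue measurable functions *)

Section completion.
Context d (T : measurableType d) (R : realType) (mu : {measure set T -> \bar R}).

(** Agreement with a measurable set off a measurable null set passes to complements and countable
    unions, and the generators have it. *)
Lemma completed_measurable_approx (B : set T) : <<s completed_algebra_gen mu >> B ->
  exists A N, [/\ measurable A, measurable N, mu N = 0 & forall x, ~ N x -> (B x <-> A x)].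
Proof.
apply: (@smallest_sub _ _ _ [set B | exists A N,
  [/\ measurable A, measurable N, mu N = 0 & forall x, ~ N x -> (B x <-> A x)]]); last first.
  move=> _ [A mA [N [M [mM M0 NM]]] <-]; exists A, M; split=> // x Mx.
  by split=> [[//|/NM]|]; [move=> /Mx|left].
split.
- by exists set0, set0; split=> //; exact: measure0.
- move=> C /= [A [N [mA mN N0 h]]]; exists (~` A), N; split=> //; first exact: measurableC.
  by move=> x /h Cx; split=> [[_ nC] /Cx|nA]; [|split=> // /Cx].
- move=> F hF.
  have /choice[A /choice[N h]] : forall k, exists A, exists N,
    [/\ measurable A, measurable N, mu N = 0 & forall x, ~ N x -> (F k x <-> A x)] by [].
  exists (\bigcup_k A k), (\bigcup_k N k); split.
  + by apply: bigcup_measurable => k _; have [] := h k.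
  + by apply: bigcup_measurable => k _; have [] := h k.
  + have negN : mu.-negligible (\bigcup_k N k).
      by apply: negligible_bigcup => k; exists (N k); have [_ mN N0 _] := h k; split.
    have mNN : measurable (\bigcup_k N k) by apply: bigcup_measurable => k _; have [] := h k.
    exact: (measure_negligible mNN negN).
  + move=> x Nx; have hx k : F k x <-> A k x.
      have [_ _ _] := h k; apply=> Nkx; by apply: Nx; exists k.
    by split=> -[k _ /hx Fk]; exists k.
Qed.

(* Discard the countable union of the null sets attached to the sublevel sets at
   rational heights. *)
Lemma completed_measurable_representative (u : T -> R) :
  measurable_fun setT (u : g_sigma_algebraType (completed_algebra_gen mu) -> R) ->
  exists2 v : T -> R, measurable_fun setT v & {ae mu, forall x, u x = v x}.
Proof.
move=> mu_u; pose q (k : nat) : R := ratr (odflt 0 (unpickle k) : rat).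
have /choice[A /choice[N h]] : forall k, exists A, exists N,
    [/\ measurable A, measurable N, mu N = 0 & forall x, ~ N x -> (u x < q k <-> A x)].
  move=> k; apply: (@completed_measurable_approx [set x | u x < q k]).
  have := mu_u measurableT `]-oo, q k[%classic (measurable_itv _).
  rewrite setTI (_ : u @^-1` _ = [set x | u x < q k]); first exact.
  by apply/seteqP; split=> x; rewrite /= in_itv.
pose M := \bigcup_k N k.
have mM : measurable M by apply: bigcup_measurable => k _; have [] := h k.
have M0 : mu.-negligible M.
  by apply: negligible_bigcup => k; exists (N k); have [_ mN N0 _] := h k; split.
have hM k x : ~ M x -> (u x < q k <-> A k x).
  move=> Mx; have [_ _ _] := h k; apply=> Nx; by apply: Mx; exists k.
(* The value 0 on [M] puts [M] into the sublevel set of height [r] exactly when [0 < r]. *)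
pose v x := if x \in M then 0 else u x.
exists v; last first.
  apply: negligibleS M0 => x /=; apply: contra_notP => Mx.
  by rewrite /v memNset.
apply: (measurability _ (RGenInftyO.measurableE R)) => _ [_ [r ->] <-]; rewrite setTI.
rewrite (_ : _ @^-1` _ = (if 0 < r then M else set0) `|`
    (~` M `&` \bigcup_(k in [set k | q k <= r]) A k)).
  apply: measurableU; first by case: ifP.
  apply: measurableI; first exact: measurableC.
  by apply: bigcup_measurable => k _; have [] := h k.
apply/seteqP; split=> x /=; rewrite in_itv/= /v.
  have [Mx|Mx] := boolP (x \in M); first by move=> r0; rewrite r0; left; rewrite inE in Mx.
  rewrite notin_setE in Mx => ur; right; split=> //.
  have [y] := rat_in_itvoo ur; rewrite in_itv/= => /andP[uy yr].
  exists (pickle y); first by rewrite /= /q pickleK/= ltW.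
  by apply/(hM _ _ Mx); rewrite /q pickleK.
move=> [|[Mx [k qr /(hM _ _ Mx) uq]]]; last by rewrite memNset// (lt_le_trans uq).
by case: ifPn => // r0 Mx; rewrite mem_set.
Qed.

(** Applied with [f] built from the original [u], measurable only for the completion; hence the
    detour through positive and negative parts. *)
Lemma ae_integral_EFin (f g : T -> R) : measurable_fun setT g ->
  {ae mu, forall x, f x = g x} -> (\int[mu]_x (f x)%:E = \int[mu]_x (g x)%:E)%E.
Proof.
move=> mg fg; rewrite integralE [RHS]integralE; congr (_ - _)%E.
  apply: ge0_integral_ae_measurable => //.
    by apply: measurable_funepos; exact/measurable_EFinP.
  by apply: filterS fg => x e; rewrite !funeposE e.
apply: ge0_integral_ae_measurable => //.
  by apply: measurable_funeneg; exact/measurable_EFinP.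
by apply: filterS fg => x e; rewrite !funenegE e.
Qed.

End completion.

(** * Functions whose integrals over orthants vanish *)

Section vanishing_on_orthants.
Variables (R : realType) (n : nat).
Local Notation mu := (lebesgue_rV R n).

(** Orthants are stable under intersection and generate the Borel sets, and their indicators are
    continuous off [n] hyperplanes, as [conv_kernel_weak] will require. *)
Definition orthant (a : 'rV[R]_n) : set 'rV[R]_n := box (fun i => [set t | a ord0 i < t]).

Let measurable_ray (a : R) : measurable ([set t | a < t] : set (measurableTypeR R)).
Proof.
rewrite (_ : [set t | _] = `]a, +oo[%classic); first exact: measurable_itv.
by apply/seteqP; split=> t /=; rewrite in_itv/= andbT.
Qed.

Lemma measurable_orthant a : measurable (orthant a).
Proof. by apply: measurable_box => i; exact: measurable_ray. Qed.

Let G := [set orthant a | a in [set: 'rV[R]_n]].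

Let measurable_rV_orthants : @measurable _ 'rV[R]_n = <<s G >>.
Proof.
apply/seteqP; split; last first.
  apply: smallest_sub; first exact: sigma_algebra_measurable.
  by move=> _ [a _ <-]; exact: measurable_orthant.
apply: smallest_sub; first exact: smallest_sigma_algebra.
rewrite -bigcup_seq => C /= -[i _ [D mD <-]].
have : measurable_fun setT ((fun x : 'rV[R]_n => x ord0 i) : g_sigma_algebraType G -> measurableTypeR R).
  apply: (measurability _ (RGenOInfty.measurableE R)) => _ [_ [r ->] <-]; rewrite setTI.
  pose a (k : nat) : 'rV[R]_n := \row_j (if j == i then r else - k%:R).
  rewrite (_ : _ @^-1` _ = \bigcup_k orthant (a k)).
    by apply: bigcup_measurable => k _; apply: sub_sigma_algebra; exists (a k).
  apply/seteqP; split=> x; rewrite /= in_itv/= andbT.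
    move=> rx; exists (Num.truncn `|x|).+1 => // j; rewrite /= mxE.
    case: eqP => [->//|_].
    have : `|x ord0 j| < (Num.truncn `|x|).+1%:R.
      exact: le_lt_trans (coord_le_norm x j) (truncnS_gt _).
    by rewrite ltr_norml => /andP[].
  by move=> [k _ /(_ i)]; rewrite /= mxE eqxx.
by move=> /(_ measurableT D mD).
Qed.

(** The sets over which [f] integrates to 0 form a Dynkin class: complements use that the total
    integral vanishes, disjoint unions that [f] induces a charge. *)
Lemma ae_eq0_orthants (f : 'rV[R]_n -> R) : mu.-integrable setT (EFin \o f) ->
  \int[mu]_x f x = 0 -> (forall a, \int[mu]_x (f x * \1_(orthant a) x) = 0) ->
  {ae mu, forall x, f x = 0}.
Proof.
move=> intf f0 fa.
have fin A : measurable A -> (\int[mu]_(x in A) f x)%:E = (\int[mu]_(x in A) (f x)%:E)%E.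
  move=> mA; rewrite fineK//; apply: integrable_fin_num => //.
  exact: (integrableS measurableT mA _ intf).
have f0E : (\int[mu]_x (f x)%:E = 0)%E by rewrite -fin// f0.
suff H : forall A, <<s G >> A -> (\int[mu]_(x in A) (f x)%:E = 0)%E.
  have H' A : A `<=` setT -> measurable A ->
      (\int[mu]_(x in A) (EFin \o f) x = \int[mu]_(x in A) cst 0 x)%E.
    by move=> _ mA; rewrite integral0; apply: H; rewrite -measurable_rV_orthants.
  have := @integral_ae_eq _ _ _ mu setT measurableT (cst 0%E) (EFin \o f) intf (measurable_cst _) H'.
  by apply: filterS => x /(_ I)/= -[].
apply: (dynkin_induction measurable_rV_orthants) => //=.
- move=> _ _ [a _ <-] [b _ <-]; exists (\row_i Num.max (a ord0 i) (b ord0 i)) => //.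
  apply/seteqP; split=> x.
    by move=> h; split=> i; have := h i; rewrite /= mxE gt_max => /andP[].
  by move=> [h1 h2] i; rewrite /= mxE gt_max h1 h2.
- move=> _ [a _ <-]; rewrite -fin; last exact: measurable_orthant.
  rewrite Rintegral_indic_mul; congr (_%:E); rewrite -[RHS](fa a).
  by apply: eq_Rintegral => x _; rewrite mulrC.
- move=> S mS S0.
  have := f0E; rewrite -(setUv S) integral_setU//= ?S0 ?add0e//.
  + exact: measurableC.
  + by rewrite setUv; case/integrableP : intf.
  + by apply/disj_setPS => x [].
- move=> F mF tF F0.
  have cv := @charge_semi_sigma_additive _ _ _ (induced_charge intf) F mF tF
    (bigcup_measurable (fun k _ => mF k)).
  rewrite (_ : (fun k => _) = fun=> 0%E) in cv; last first.
    by apply/funext => k; rewrite big1// => i _; exact: F0.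
  exact: (cvg_unique (@ereal_hausdorff R) cv (cvg_cst _)).
Qed.

End vanishing_on_orthants.

(** * Testing the equation against rescaled bumps *)

Section bump_test_functions.
Variables (R : realType) (n : nat) (s : R).
Hypotheses (n_gt0 : (0 < n)%N) (s_gt0 : 0 < s) (s_lt1 : s < 1).
Local Notation mu := (lebesgue_rV R n).
Local Notation eta := (@bump R n).
Local Notation h := (Lap s eta).
Implicit Types (c : R) (x y z : 'rV[R]_n).

Lemma bump_gt0 x : enorm x < 1 -> 0 < eta x.
Proof.
move=> x1; rewrite /bump /ebump subr_gt0 -sqr_enorm expr_lt1 ?enorm_ge0// x1.
by rewrite expr0 mul1r expR_gt0.
Qed.

Lemma bump_le x : eta x <= eta 0.
Proof. by apply: bump_decr; rewrite enorm0 enorm_ge0. Qed.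

Lemma smooth_bump_affine c z : smooth_on setT (fun x => eta (c *: (x - z))).
Proof.
apply: Ck_smooth => k; apply: Ck_ebump_comp => {}k.
rewrite (_ : (fun x => _) = fun x : 'rV[R]_n =>
    1 + (-1) * \sum_(i < n) (c * (x ord0 i + - z ord0 i)) * (c * (x ord0 i + - z ord0 i))); last first.
  apply/funext => x; rewrite mulN1r /dot; congr (_ - _).
  by apply: eq_bigr => i _; rewrite !mxE.
apply: CkD; first exact: Ck_cst.
apply: CkM; first exact: Ck_cst.
have cc i : Ck k (fun x : 'rV[R]_n => c * (x ord0 i + - z ord0 i)).
  apply: CkM; first exact: Ck_cst.
  by apply: CkD; [exact: Ck_coord|exact: Ck_cst].
by apply: Ck_sum => i; exact: CkM.
Qed.

Lemma bump_affine_out c z x : 0 < c -> c^-1 <= enorm (x - z) -> eta (c *: (x - z)) = 0.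
Proof.
move=> c0 xz; apply: bump_out; rewrite enormZ gtr0_norm//.
by rewrite -(mulfV (lt0r_neq0 c0)) ler_pM2l.
Qed.

Lemma test_function_bump c z (Omega : set 'rV[R]_n) : 0 < c ->
  (forall x, enorm (x - z) <= c^-1 -> Omega x) ->
  test_function Omega (fun x => eta (c *: (x - z))).
Proof.
move=> c0 zO; pose C := [set x : 'rV[R]_n | enorm (x - z) <= c^-1].
have cC : closed C.
  rewrite (_ : C = (fun x => enorm (x - z)) @^-1` [set t | t <= c^-1])//.
  apply: closed_comp; last exact: closed_le.
  move=> y _; apply: (@continuous_comp _ _ _ (fun y => y - z) (@enorm R n)).
    apply: (@cvgB _ _ _ (nbhs y) (nbhs_filter y) id (cst z)); first exact: cvg_id.
    exact: (@cvg_cst _ z _ (nbhs y) (nbhs_filter y)).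
  exact: enorm_continuous.
have sC : tsupport (fun x => eta (c *: (x - z))) `<=` C.
  have -> : C = closure C by exact/closure_id.
  apply: closureS => x /=; apply: contraNP => /negP; rewrite -ltNge => xz.
  by rewrite bump_affine_out// ltW.
split; first exact: smooth_bump_affine.
- apply: bounded_closed_compact; last exact: closed_closure.
  exists (c^-1 + enorm z); split; first exact: num_real.
  move=> M hM x /sC xC /=; apply/ltW; apply: le_lt_trans hM.
  apply: (le_trans (norm_le_enorm x)); rewrite -{1}(subrK z x).
  by apply: (le_trans (ler_enormD _ _)); rewrite lerD2r.
- by move=> x /sC; exact: zO.
Qed.

Lemma Lap_bump_affine c z x : 0 < c ->
  Lap s (fun x => eta (c *: (x - z))) x = c `^ (2 * s) * h (c *: (z - x)).
Proof.
move=> c0.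
have -> : h (c *: (z - x)) = h (c *: (x - z)).
  by apply: Lap_bump_radial; rewrite !enormZ enorm_distC.
rewrite -(Lap_scale n_gt0 s_gt0 s_lt1 (x - z) (@smooth_cs_bump R n) c0).
have dE y : diff2 (fun x => eta (c *: (x - z))) x y = diff2 (fun x => eta (c *: x)) (x - z) y.
  by rewrite /diff2 (addrAC x y) (addrAC x (- y)).
by apply: eq_Rintegral => y _; rewrite dE.
Qed.

(** The scaled bump about [z] has fractional Laplacian [h (c *: (z - x))] up to a positive constant,
    which is divided out together with [a]. The factor [a] allows [u] to be normalized by the mass
    of the kernel. *)
Lemma frac_harmonic_bump (Omega : set 'rV[R]_n) (u ut : 'rV[R]_n -> R) (a : R) :
  frac_harmonic s Omega u -> a != 0 -> measurable_fun setT ut ->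
  mu.-integrable setT (EFin \o (fun x => ut x * weight s x)) ->
  {ae mu, forall x, u x = a * ut x} ->
  forall c z, 1 <= c -> (forall x, enorm (x - z) <= c^-1 -> Omega x) ->
  \int[mu]_x (ut x * h (c *: (z - x))) = 0.
Proof.
move=> hu a0 mut iut aeu c z c1 zO; have c0 : 0 < c by exact: lt_le_trans c1.
have := hu _ (test_function_bump c0 zO).
have [C C0 hC] := Lap_bound n_gt0 s_gt0 s_lt1 (@smooth_cs_bump R n).
have mh : measurable_fun setT (fun y => h (c *: y)).
  apply: (measurableT_comp (f := h)).
    apply: rV_continuous_measurable; apply: smooth_continuous.
    exact: (smooth_Lap n_gt0 s_gt0 s_lt1 (@smooth_cs_bump R n)).
  by apply: measurable_rVZ => //; exact: measurable_cst.
have hc y : `|h (c *: y)| <= C * weight s y.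
  by apply: (le_trans (hC _)); rewrite ler_pM2l//; exact: weight_expand.
have ic := integrable_conv s_gt0 mut iut z mh hc.
pose b := a * (gamma_ns n s / 2 * c `^ (2 * s)).
have b0 : b != 0.
  apply: mulf_neq0 => //; rewrite mulf_neq0 ?gt_eqF ?powR_gt0//.
  by rewrite divr_gt0// gamma_ns_gt0.
rewrite (@ae_integral_EFin _ _ _ mu _ (fun x => b * (ut x * h (c *: (z - x))))).
- move=> E; apply: (mulfI b0); rewrite mulr0 -(RintegralZl b measurableT ic).
  by rewrite /Rintegral E.
- by have /integrableP[/measurable_EFinP] := integrable_scale b ic.
- apply: filterS aeu => x ->.
  have -> : frac_laplacian s (fun x => eta (c *: (x - z))) x =
      gamma_ns n s / 2 * Lap s (fun x => eta (c *: (x - z))) x by [].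
  rewrite (Lap_bump_affine z x c0) /b.
  by move: (h _) (c `^ _) (gamma_ns n s) => A1 A2 A3; ring.
Qed.

End bump_test_functions.

(** * Local identification of [u] with its mollifications *)

Section interior_regularity.
Variables (R : realType) (n : nat) (s : R) (Omega : set 'rV[R]_n) (u : 'rV[R]_n -> R).
Hypotheses (n_gt0 : (0 < n)%N) (s_gt0 : 0 < s) (s_lt1 : s < 1).
Local Notation mu := (lebesgue_rV R n).
Local Notation w := (weight (n := n) s).
Local Notation eta := (@bump R n).
Local Notation h := (Lap s eta).
Local Notation rt t := (t `^ n%:R^-1).
Local Notation k := (kernel_mass n s).
Implicit Types (x y z q : 'rV[R]_n) (N M : nat).

Hypotheses (mu_u : measurable_fun setT u)
  (iu : mu.-integrable setT (EFin \o (fun x => u x * w x))).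
Hypothesis u_harmonic : forall c z, 1 <= c -> (forall x, enorm (x - z) <= c^-1 -> Omega x) ->
  \int[mu]_x (u x * h (c *: (z - x))) = 0.

Definition mollified N : 'rV[R]_n -> R := conv u (avg_kernel s N.+1%:R).

(* The supports of all the test functions bump (c *: (x - z)) with
   c >= (N + 1)^(1/n) lie in Omega. *)
Definition deep N z := forall y, enorm (y - z) <= (rt N.+1%:R)^-1 -> Omega y.

Let n0 : 0 < n%:R :> R. Proof. by rewrite ltr0n. Qed.

Let N1 N : 1 <= N.+1%:R :> R. Proof. by rewrite ler1n. Qed.

Let rt_gt0 N : 0 < rt N.+1%:R :> R. Proof. exact: powR_gt0. Qed.

Let rt_le (a b : R) : 0 <= a -> a <= b -> rt a <= rt b.
Proof.
by move=> a0 ab; apply: ge0_ler_powR; rewrite ?nnegrE ?invr_ge0 ?(ltW n0)// (le_trans a0).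
Qed.

(** The scales in which the two kernels differ exceed [N + 1], so the corresponding bumps about [z]
    fit in the ball that [deep] puts inside [Omega]. *)
Lemma mollified_eq N M z : deep N z -> (N <= M)%N -> mollified M z = mollified N z.
Proof.
move=> dN NM; have h0 (t : R) : N.+1%:R < t -> t <= M.+1%:R ->
    \int[mu]_x (u x * h (rt t *: (z - x))) = 0.
  move=> Nt _; have t1 : rt N.+1%:R <= rt t by apply: rt_le => //; exact: ltW.
  have rt1 : 1 <= rt N.+1%:R :> R.
    have e1 : rt 1 = 1 :> R by rewrite powR1.
    by rewrite -[leLHS]e1 rt_le.
  apply: u_harmonic => [|x xz]; first exact: le_trans t1.
  apply: dN; apply: (le_trans xz).
  by rewrite lef_pV2 ?posrE// (lt_le_trans _ t1).
have NM' : N.+1%:R <= M.+1%:R :> R by rewrite ler_nat.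
exact: (conv_kernel_eq n_gt0 s_gt0 s_lt1 mu_u iu (N1 N) NM' h0).
Qed.

Lemma smooth_mollified N : smooth_on setT (mollified N).
Proof. exact: smooth_conv_kernel. Qed.

(** Off the walls the indicator is constant near [z], since strict inequalities between coordinates
    persist. *)
Let continuous_orthant_indic (g : 'rV[R]_n -> R) (a z : 'rV[R]_n) : {for z, continuous g} ->
  (forall i, z ord0 i != a ord0 i) -> {for z, continuous (fun x => g x * \1_(orthant a) x)}.
Proof.
move=> cg za.
have nz i : \forall x \near z, (a ord0 i < (x : 'rV[R]_n) ord0 i) = (a ord0 i < z ord0 i).
  have cci : {for z, continuous (fun x : 'rV[R]_n => x ord0 i)} by exact: coord_continuous.
  have /orP[lt|lt] : (z ord0 i < a ord0 i) || (a ord0 i < z ord0 i) by rewrite -neq_lt.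
    have : \forall x \near z, (x : 'rV[R]_n) ord0 i < a ord0 i := cci _ (open_nbhs_nbhs (conj (@open_lt R (a ord0 i)) lt)).
    by apply: filterS => x /= xa; rewrite !ltNge (ltW xa) (ltW lt).
  have : \forall x \near z, a ord0 i < (x : 'rV[R]_n) ord0 i := cci _ (open_nbhs_nbhs (conj (@open_gt R (a ord0 i)) lt)).
  by apply: filterS => x /= xa; rewrite xa lt.
have {}nz := filter_forall (nbhs_filter z) nz.
pose c : R := \1_(orthant a) z.
have nE : {near z, (fun x => g x * c) =1 (fun x => g x * \1_(orthant a) x)}.
  apply: filterS nz => x hx; congr (_ * _); rewrite /c !indicE; congr (nat_of_bool _)%:R.
  by apply/idP/idP; rewrite !in_setE => hh i; have := hh i; rewrite /= hx.
rewrite /prop_for /continuous_at -(nbhs_singleton nE).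
apply: (cvg_trans (near_eq_cvg nE)).
by apply: cvgM; [exact: cg|exact: cvg_cst].
Qed.

(** A wall is a box with one side reduced to a point. The [n] walls are completed by empty sets into
    a sequence, as countable subadditivity is stated for sequences. *)
Let ae_off_walls (a : 'rV[R]_n) : {ae mu, forall z, forall i, z ord0 i != a ord0 i}.
Proof.
pose A (i : 'I_n) : set 'rV[R]_n :=
  box (fun j => if j == i then [set a ord0 i] else setT : set (measurableTypeR R)).
have mA i : measurable (A i) by apply: measurable_box => j; case: ifP.
have A0 i : mu (A i) = 0%E.
  rewrite lebesgue_boxE => [|j]; last by case: ifP.
  by rewrite (bigD1 i)//= eqxx lebesgue_measure_set1 mul0e.
pose F (j : nat) : set 'rV[R]_n := if insub j is Some i then A i else set0.
apply: (@negligibleS _ _ _ _ (\bigcup_j F j)); last first.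
  apply: negligible_bigcup => j; rewrite /F; case: insubP => [i _ _|_].
    by exists (A i); split; [exact: mA|exact: A0|].
  exact: negligible_set0.
move=> z /= /existsNP[i /negP]; rewrite negbK => /eqP zi.
exists i => //; rewrite /F valK => j; rewrite /=.
by case: eqP => [->|].
Qed.

(** The cut-off [chi] vanishes outside the ball of radius [c^-1] about [q], and the points where it
    is nonzero are [deep], thanks to the radius [2 * c^-1] in the hypothesis. The weak identity for
    [chi] and for its cuts by orthants forces [(mollified N - k * u) * chi = 0] almost everywhere,
    and [chi] is positive inside the ball. *)
Lemma mollified_ae_ball N q :
  (forall y, enorm (y - q) <= 2 * (rt N.+1%:R)^-1 -> Omega y) ->
  {ae mu, forall y, enorm (y - q) < (rt N.+1%:R)^-1 -> mollified N y = k * u y}.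
Proof.
move=> qO; pose c : R := rt N.+1%:R; have c0 : 0 < c by exact: rt_gt0.
pose chi y := eta (c *: (y - q)).
have chi_out y : c^-1 <= enorm (y - q) -> chi y = 0 by exact: bump_affine_out.
have cchi : continuous chi by exact/smooth_continuous/smooth_bump_affine.
have mchi : measurable_fun setT chi by exact: rV_continuous_measurable.
have chi0 y : 0 <= chi y by exact: bump_ge0.
have chiB y : `|chi y| <= eta 0 by rewrite ger0_norm// bump_le.
pose r := enorm q + c^-1; have r0 : 0 < r by rewrite ltr_wpDl ?enorm_ge0 ?invr_gt0.
have chi_r z : r < enorm z -> chi z = 0.
  move=> rz; apply: chi_out; have := ler_enormB z (z - q).
  have -> : z - (z - q) = q by rewrite opprB addrCA subrr addr0.
  by rewrite /r in rz; lra.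
have deepN z : chi z != 0 -> deep N z.
  move=> /eqP cz y yz; apply: qO.
  have zq : enorm (z - q) < c^-1 by rewrite ltNge; apply/negP => /chi_out.
  rewrite -[y](subrK z) -addrA; apply: (le_trans (ler_enormD _ _)).
  by rewrite -/c in yz *; lra.
have weak (g : 'rV[R]_n -> R) : measurable_fun setT g -> (forall z, `|g z| <= `|chi z|) ->
    {ae mu, forall z, {for z, continuous g}} ->
    \int[mu]_z (mollified N z * g z) = k * \int[mu]_z (u z * g z).
  move=> mg gchi cg.
  have gB z : `|g z| <= eta 0 by exact: le_trans (chiB z).
  have g0 z : chi z = 0 -> g z = 0.
    by move=> cz; have := gchi z; rewrite cz normr0 normr_le0 => /eqP.
  apply: (conv_kernel_weak n_gt0 s_gt0 s_lt1 mu_u iu r0 mg gB _ cg).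
    by move=> z /chi_r /g0.
  move=> z M NM gz; apply: mollified_eq NM; apply: deepN.
  by apply: contra_neq gz => /g0.
have mmol : measurable_fun setT (mollified N).
  by apply: rV_continuous_measurable; exact/smooth_continuous/smooth_mollified.
have [B hB] : exists B : R, forall z, enorm z <= r -> `|mollified N z| <= B.
  have [C C_gt0 hC] := kernel_decay n_gt0 s_gt0 s_lt1 (N1 N).
  apply: (conv_bounded s_gt0 mu_u iu _ hC (ltW r0)); exact: measurable_kernel.
have B0 : 0 <= B by apply: le_trans (hB 0 _) => //; rewrite enorm0 ltW.
have ib : mu.-integrable setT (EFin \o (\1_(eball 0 (r + 1)) : 'rV[R]_n -> R)).
  by apply: integrable_indic_fin; [exact: measurable_eball|exact: eball_measure_fin].
have iV (g : 'rV[R]_n -> R) : measurable_fun setT g -> (forall z, `|g z| <= `|chi z|) ->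
    mu.-integrable setT (EFin \o (fun z => mollified N z * g z)).
  move=> mg gchi; apply: (@integrable_dominated _ _ _ _ (B * eta 0) _ ib).
    by apply: measurable_funM.
  move=> z; rewrite normrM indicE; have [zr|zr] := leP (enorm z) r.
    rewrite mem_set ?mulr1; last by rewrite /eball/= subr0 (le_lt_trans zr)// ltrDl.
    by apply: ler_pM => //; [exact: hB|exact: le_trans (chiB z)].
  have := gchi z; rewrite chi_r// normr0 normr_le0 => /eqP ->.
  by rewrite normr0 mulr0 !mulr_ge0 ?bump_ge0.
have iU (g : 'rV[R]_n -> R) : measurable_fun setT g -> (forall z, `|g z| <= `|chi z|) ->
    mu.-integrable setT (EFin \o (fun z => u z * g z)).
  move=> mg gchi; apply: (integrable_mul_supported s_gt0 mu_u iu r0 mg (B := eta 0)).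
    by move=> z; exact: le_trans (chiB z).
  by move=> z zr; have := gchi z; rewrite chi_r// normr0 normr_le0 => /eqP.
pose f z := mollified N z * chi z - k * (u z * chi z).
have zero (g : 'rV[R]_n -> R) : measurable_fun setT g -> (forall z, `|g z| <= `|chi z|) ->
    {ae mu, forall z, {for z, continuous g}} ->
    \int[mu]_z (mollified N z * g z - k * (u z * g z)) = 0.
  move=> mg gchi cg.
  rewrite (RintegralB measurableT (iV g mg gchi) (integrable_scale k (iU g mg gchi))).
  by rewrite (RintegralZl k measurableT (iU g mg gchi)) weak// subrr.
have cchi_ae : {ae mu, forall z, {for z, continuous chi}} by apply: aeW => z; exact: cchi.
have if_ : mu.-integrable setT (EFin \o f).
  by apply: integrable_subr; [exact: iV|apply: integrable_scale; exact: iU].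
have f0 : \int[mu]_z f z = 0 by exact: zero.
have fa a : \int[mu]_z (f z * \1_(orthant a) z) = 0.
  have mia : measurable_fun setT (\1_(orthant a) : 'rV[R]_n -> R).
    by apply: measurable_indic; exact: measurable_orthant.
  rewrite -(zero (fun z => chi z * \1_(orthant a) z)).
  - by apply: eq_Rintegral => z _; rewrite /f mulrBl !mulrA.
  - exact: measurable_funM.
  - move=> z; rewrite normrM indicE; case: (z \in _).
      by rewrite normr1 mulr1.
    by rewrite normr0 mulr0.
  - have := ae_off_walls a; apply: filterS => z za.
    by apply: continuous_orthant_indic => //; exact: cchi.
have := ae_eq0_orthants if_ f0 fa; apply: filterS => y fy yq.
have cy : chi y != 0.
  rewrite gt_eqF// bump_gt0// enormZ gtr0_norm//.
  by rewrite -(mulfV (lt0r_neq0 c0)) ltr_pM2l.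
apply: (mulIf cy); apply/eqP; rewrite -subr_eq0 -mulrA; exact/eqP.
Qed.

End interior_regularity.

(** * Gluing the local mollifications *)

Theorem theorem12p17 (R : realType) (n : nat) (s : R)
    (Omega : set 'rV[R]_n) (u : 'rV[R]_n -> R)
    (n_ge2 : (2 <= n)%N) (s_gt0 : 0 < s) (s_lt1 : s < 1)
    (oOmega : open Omega) (uL : L_s s u) (hu : frac_harmonic s Omega u) :
  exists v : 'rV[R]_n -> R,
    [/\ [set x | v x <> u x] `<=` Omega,
        (lebesgue_rV R n).-negligible [set x | v x <> u x] &
        smooth_on Omega v].
Proof.
have n_gt0 : (0 < n)%N by exact: leq_trans n_ge2.
case: uL => uM uI; set mu := lebesgue_rV R n in uI *.
have [u' mu' uu'] := completed_measurable_representative uM.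
pose k := kernel_mass n s.
have k0 : k != 0 by rewrite gt_eqF// kernel_mass_gt0.
(* Dividing by the kernel mass makes the mollifications reproduce [u] itself rather than a multiple
   of it. *)
pose ut x := k^-1 * u' x.
have mut : measurable_fun setT ut by exact: measurable_funM.
have aeu : {ae mu, forall x, u x = k * ut x}.
  by apply: filterS uu' => x ->; rewrite /ut mulVKf.
have iu' : mu.-integrable setT (EFin \o (fun x => u' x * weight s x)).
  have mu'w : measurable_fun setT (fun x => u' x * weight s x).
    by apply: measurable_funM => //; exact: measurable_weight.
  apply/integrableP; split; first exact/measurable_EFinP.
  rewrite -(@ge0_integral_ae_measurable _ _ _ mu (fun x => (`|u x| / (1 + enorm x `^ (n%:R + 2 * s)))%:E))//.
  - by move=> x; rewrite lee_fin divr_ge0// addr_ge0 ?powR_ge0.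
  - by apply: measurableT_comp => //; exact/measurable_EFinP.
  - apply: filterS uu' => x -> /=.
    by rewrite normrM (gtr0_norm (weight_gt0 _ _)).
have iut : mu.-integrable setT (EFin \o (fun x => ut x * weight s x)).
  have := integrable_scale k^-1 iu'; apply: eq_integrable => // x _ /=.
  by rewrite mulrA.
have harm := frac_harmonic_bump n_gt0 s_gt0 s_lt1 hu k0 mut iut aeu.
have := mollified_eq n_gt0 s_gt0 s_lt1 mut iut harm.
have := mollified_ae_ball n_gt0 s_gt0 s_lt1 mut iut harm.
have := smooth_mollified n_gt0 s_gt0 s_lt1 mut iut.
move: (mollified s ut) => V smoothV aeV eqV.
pose c (N : nat) : R := (N.+1%:R `^ n%:R^-1)^-1.
have c0 N : 0 < c N by rewrite invr_gt0 powR_gt0.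
(* The radius [3 * c N] leaves room for a rational centre within [c N] of [x] whose ball of radius
   [2 * c N] still lies in [Omega]. *)
have exN x : Omega x -> exists N, forall y, enorm (y - x) <= 3 * c N -> Omega y.
  move=> Ox; move/open_nbhs_nbhs : (conj oOmega Ox) => /nbhs_ballP[e /= e0 eO].
  have e30 : 0 < e / 3 by rewrite divr_gt0.
  have /cvgrPdist_lt/(_ _ e30)[N _ /(_ N (leqnn N))] := @cvg_inv_root R n n_gt0.
  rewrite /= sub0r normrN gtr0_norm ?c0// ltr_pdivlMr// mulrC => h.
  exists N => y yx; apply: eO; rewrite mx_norm_ball /ball_/= -normrN opprB.
  exact: (le_lt_trans (norm_le_enorm _) (le_lt_trans yx h)).
have /choice[NN hNN] : forall x, exists N, Omega x -> deep Omega N x.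
  move=> x; have [Ox|nOx] := pselect (Omega x); last by exists 0%N.
  have [N hN] := exN x Ox; exists N => _ y yx; apply: hN.
  by apply: (le_trans yx); rewrite ler_peMl ?ler1n// ltW// c0.
have deep_in N x : deep Omega N x -> Omega x.
  by apply; rewrite subrr enorm0 ltW// c0.
(* The index varies with the point without harm: [eqV] gives the same value at every index for which
   the point is deep. *)
pose v x := if x \in Omega then V (NN x) x else u x.
have vE N x : deep Omega N x -> v x = V N x.
  move=> dN; have Ox := deep_in _ _ dN.
  have -> : v x = V (NN x) x by rewrite /v (mem_set Ox).
  rewrite -(eqV _ _ _ (hNN x Ox) (leq_maxl (NN x) N)).
  exact: (eqV _ _ _ dN (leq_maxr (NN x) N)).
exists v; split.
- by move=> x /=; apply: contra_notP => nOx; rewrite /v (memNset nOx).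
- pose P (a : 'rV[rat]_n * nat) := forall y, enorm (y - map_mx ratr a.1) <= 2 * c a.2 -> Omega y.
  (* The almost everywhere identity is available ball by ball; rational centres reduce the
     exceptional sets to countably many. *)
  pose E (a : 'rV[rat]_n * nat) : set 'rV[R]_n :=
    [set y | P a /\ enorm (y - map_mx ratr a.1) < c a.2 /\ V a.2 y <> k * ut y].
  pose F (j : nat) : set 'rV[R]_n := if unpickle j is Some a then E a else set0.
  have negF : mu.-negligible (\bigcup_j F j).
    apply: negligible_bigcup => j; rewrite /F; case: unpickle => [a|]; last exact: negligible_set0.
    have [Pa|nPa] := pselect (P a); last first.
      rewrite (_ : E a = set0); first exact: negligible_set0.
      by apply/seteqP; split=> // y [].
    apply: negligibleS (aeV _ _ Pa).
    by move=> y [_ [ya nV]] /= /(_ ya).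
  apply: negligibleS (negligibleU aeu negF) => y /= vu; have [uy|nuy] := pselect (u y = k * ut y); last by left.
  right; have Oy : Omega y by apply: contra_notP vu => nOy; rewrite /v (memNset nOy).
  have [N hN] := exN y Oy.
  (* [n] pays for passing from the coordinates to [enorm], and 2 makes the final inequality
     strict. *)
  pose d := c N / (2 * n%:R); have d0 : 0 < d by rewrite divr_gt0 ?mulr_gt0 ?ltr0n.
  have hq i : {q : rat | `|y ord0 i - ratr q| < d}.
    apply: cid; have /rat_in_itvoo[q] : y ord0 i < y ord0 i + d by rewrite ltrDl.
    rewrite in_itv/= => /andP[q1 q2]; exists q.
    by rewrite ltr_distlC ltrBlDr (lt_trans q1) ?ltrDl//= q2.
  pose q : 'rV[rat]_n := \row_i sval (hq i).
  have yq : enorm (y - map_mx ratr q) < c N.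
    apply: (le_lt_trans (enorm_le_norm _)).
    have yd : `|y - map_mx ratr q| <= d.
      by apply: norm_le_coord (ltW d0) _ => i; rewrite !mxE ltW// (svalP (hq i)).
    apply: (@le_lt_trans _ _ (n%:R * d)); first by rewrite ler_wpM2l.
    have n0 : n%:R != 0 :> R by rewrite pnatr_eq0 -lt0n.
    have -> : n%:R * d = c N / 2 by rewrite /d; field.
    by rewrite ltr_pdivrMr// ltr_pMr// ltr1n.
  exists (pickle (q, N)) => //; rewrite /F pickleK; split.
    move=> z /= zq; apply: hN.
    rewrite -[z](subrK (map_mx ratr q)) -addrA; apply: (le_trans (ler_enormD _ _)).
    by have := ltW yq; rewrite enorm_distC; lra.
  split=> //= Vk; apply: vu; rewrite uy -Vk; apply: vE => z zy; apply: hN.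
  by apply: (le_trans zy); rewrite ler_peMl ?ler1n// ltW// c0.
- move=> l x Ox; have [N hN] := exN x Ox.
  (* Every point of [U] is deep at the one index [N], so [v] coincides there with the smooth
     function [V N]. *)
  pose U := eball x (c N).
  have UV y : U y -> V N y = v y.
    move=> Uy; apply/esym/vE => z zy; apply: hN.
    rewrite -[z](subrK y) -addrA; apply: (le_trans (ler_enormD _ _)).
    have yx : enorm (y - x) < c N by exact: Uy.
    by have : enorm (z - y) <= c N by []; move: yx (c0 N); lra.
  have sV : smooth_on U (V N).
    by move=> l' y _; exact: (smoothV N l' y I).
  have Ux : U x by rewrite /U /eball/= subrr enorm0 c0.
  have sv : smooth_on U v := eq_open_smooth_on (@open_eball R n x (c N)) UV sV.
  exact: (sv l x Ux).
Qed.
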